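(* Consider a pairwise Markov random field on a tree-structured graph, with state space $\mathcal{X}$ closed and bounded and with continuous node and edge potential functions, let $m^*$ be the (unique) BP message fixed point, and let $r\ge 1$. Suppose that for all $x\in\mathcal{X}$ and all directed edges $(v\to u)\in\vec{\mathcal{E}}$, $$\inf_{y\in\mathcal{X}}\Pi^r\big(\Gamma_{uv}(x,y)\big)>0\quad\text{and}\quad |A^r_{v\to u}(x)|\le \tfrac12\inf_{y\in\mathcal{X}}\Pi^r\big(\Gamma_{uv}(x,y)\big),$$ where $\Pi^r$ acts on $\Gamma_{uv}(\cdot,y)$ as a function of its first argument. Then the sequence of messages $\{m^t\}_{t=0}^\infty$ generated by the SOSMP algorithm (with step sizes $\eta^t=1/(t+1)$) has the following properties. (a) There is a nilpotent matrix $N\in\mathbb{R}^{|\vec{\mathcal{E}}|\times|\vec{\mathcal{E}}|}$ such that the error vector $\rho^2(\Delta^t)$ converges almost surely to the set $$\mathcal{B}:=\big\{e\in\mathbb{R}^{|\vec{\mathcal{E}}|}\ \mid\ |e|\preceq N(I-N)^{-1}\rho^2(A^r)\big\},$$ i.e. $\rho^2(\Delta^t)-\Pi_{\mathcal{B}}\big(\rho^2(\Delta^t)\big)\to 0$ almost surely as $t\to\infty$, where $\Pi_{\mathcal B}$ denotes projection onto $\mathcal{B}$. (b) Furthermore, with this same $N$, for all iterations $t=1,2,\ldots$, $$\mathbb{E}\big[\rho^2(\Delta^t)\big]\ \preceq\ \Big(6\sum_{j=1}^r B_j^2\Big)\frac{(I-\log t\; N)^{-1}}{t}\,\big(N\vec{1}+16\,\vec{1}\big)+N(I-N)^{-1}\rho^2(A^r).$$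 Here $\preceq$ is elementwise inequality, $|e|$ is the elementwise absolute value, and $\vec 1$ is the all-ones vector.
   Context: **Model and BP.** $\mathcal{G}=(\mathcal{V},\mathcal{E})$ is a finite undirected graph without self-edges, $\mathcal{N}(v)$ is the set of neighbors of $v$, and $\vec{\mathcal{E}}$ is the set of all directed edges $(v\to u)$ (both orientations of each edge). Each node carries a variable in a state space $\mathcal{X}$ with base measure $\mu$ (typically Lebesgue measure). Node potentials are $\psi_u:\mathcal{X}\to(0,\infty)$ and edge potentials are $\psi_{uv}:\mathcal{X}\times\mathcal{X}\to(0,\infty)$, with $\psi_{uv}(x_u,x_v)=\psi_{vu}(x_v,x_u)$; the model is $p(x_1,\dots,x_n)\propto\prod_u\psi_u(x_u)\prod_{(u,v)\in\mathcal{E}}\psi_{uv}(x_u,x_v)$. $\mathcal{M}\subset L^2(\mathcal{X};\mu)$ is the set of probability densities on $\mathcal{X}$ with respect to $\mu$. For a collection of messages $m=\{m_{v\to u}\}$, the BP update is $$[\mathcal{F}_{v\to u}(m)](x)=\kappa\int_{\mathcal{X}}\psi_{uv}(x,y)\psi_v(y)\prod_{w\in\mathcal{N}(v)\setminus\{u\}}m_{w\to v}(y)\,\mu(dy),$$ with $\kappa$ chosen so that the result integrates to 1. A BP fixed point is $m^*\in\mathcal{M}^{|\vec{\mathcal{E}}|}$ with $\mathcal{F}_{v\to u}(m^* )=m^*_{v\to u}$ for all $(v\to u)$; it is unique on trees. **Normalized compatibility function.** $\beta_{uv}(y)=\psi_v(y)\int_{\mathcal{X}}\psi_{uv}(x,y)\mu(dx)$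 and $\Gamma_{uv}(x,y)=\psi_{uv}(x,y)\psi_v(y)/\beta_{uv}(y)$, so $\int\Gamma_{uv}(x,y)\mu(dx)=1$. **Basis.** $\{\phi_j\}_{j\ge1}$ is an orthonormal basis of $L^2(\mathcal{X};\mu)$; $\Pi^r(f)=\sum_{j=1}^r\langle f,\phi_j\rangle_{L^2}\phi_j$. **SOSMP algorithm** (parameters: basis, number of coefficients $r\ge1$, number of samples $k\ge1$, step sizes $\eta^t$). Initialize $a^0_{v\to u;j}=1/r$ for $j=1,\dots,r$ and all $(v\to u)$. For $t=0,1,2,\ldots$ and each $(v\to u)$: (i) form $\hat m^t_{w\to v}=\big[\sum_{j=1}^r a^t_{w\to v;j}\phi_j\big]_+$ for $w\in\mathcal{N}(v)\setminus\{u\}$, where $[s]_+=\max\{0,s\}$; (ii) conditionally on the past, draw i.i.d. $Y_1,\dots,Y_k$ from the density proportional to $\beta_{uv}(y)\prod_{w\in\mathcal{N}(v)\setminus\{u\}}\hat m^t_{w\to v}(y)$ (assumed well defined); (iii) set $\widetilde b^{t+1}_{v\to u;j}=\frac1k\sum_{i=1}^k\langle\Gamma_{uv}(\cdot,Y_i),\phi_j\rangle_{L^2}$, $j=1,\dots,r$; (iv) set $a^{t+1}_{v\to u}=(1-\eta^t)a^t_{v\to u}+\eta^t\,\widetilde b^{t+1}_{v\to u}$. The message at time $t$ is $m^t_{v\to u}=\sum_{j=1}^r a^t_{v\to u;j}\phi_j$. **Errors and constants.** $\Delta^t_{v\to u}=m^t_{v\to u}-\Pi^r(m^*_{v\to u})$;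 $A^r_{v\to u}=m^*_{v\to u}-\Pi^r(m^*_{v\to u})$; $\rho^2(\Delta^t)=\{\|\Delta^t_{v\to u}\|_{L^2}^2\}_{(v\to u)\in\vec{\mathcal{E}}}$ and $\rho^2(A^r)=\{\|A^r_{v\to u}\|_{L^2}^2\}_{(v\to u)\in\vec{\mathcal{E}}}$, vectors in $\mathbb{R}^{|\vec{\mathcal{E}}|}$; $B_j=\max_{(v\to u)\in\vec{\mathcal{E}}}\sup_{y\in\mathcal{X}}|\langle\Gamma_{uv}(\cdot,y),\phi_j\rangle_{L^2}|$. *)

(* Defs.v *)
From mathcomp Require Import all_boot all_order all_algebra.
From mathcomp Require Import all_classical all_reals all_analysis.
Set Implicit Arguments.
Unset Strict Implicit.
Unset Printing Implicit Defensive.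

Import Order.TTheory GRing.Theory Num.Theory.
Import numFieldNormedType.Exports.

Local Open Scope classical_set_scope.
Local Open Scope ring_scope.

(* R^n with its Borel sigma-algebra; convertible to 'rV[R]_n, which carries
   the topology. *)
Notation borel_rV R n := (g_sigma_algebraType (@open 'rV[R]_n)).

(* Self-edges are excluded by irreflexivity, and a cycle of size 2 just
   traverses one edge back and forth. *)
Definition is_tree (V : finType) (e : rel V) : Prop :=
  (forall u v, connect e u v) /\
  (forall c : seq V, ucycle e c -> (size c <= 2)%N).

(* The functions are total on R^n but only their values on the state space
   (and, for edge_pot, only the pairs (u, v) that are edges) are used. *)
Record pairwise_mrf (R : realType) (n : nat) (V : finType) := PairwiseMRF {
  edge : rel V;
  edge_sym : symmetric edge;
  edge_irr : irreflexive edge;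
  state : set 'rV[R]_n;
  base : {measure set (borel_rV R n) -> \bar R};
  node_pot : V -> 'rV[R]_n -> R;
  edge_pot : V -> V -> 'rV[R]_n -> 'rV[R]_n -> R;
  node_pot_gt0 : forall u x, state x -> 0 < node_pot u x;
  edge_pot_gt0 : forall u v x y, edge u v -> state x -> state y ->
    0 < edge_pot u v x y;
  edge_potC : forall u v x y, edge u v -> state x -> state y ->
    edge_pot u v x y = edge_pot v u y x }.

Section Model.
Context {R : realType} {n : nat} {V : finType}.
Variable M : pairwise_mrf R n V.

Local Notation T := (borel_rV R n).
Local Notation X := (state M).
Local Notation mu := (base M).

Definition continuous_potentials : Prop :=
  (forall u, {within X, continuous (node_pot M u)}) /\
  (forall u v, edge M u v ->
     {within X `*` X, continuous (fun p => edge_pot M u v p.1 p.2)}).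

(* The pair (v, u) is the directed edge v -> u. *)
Definition dedge : finType := {p : V * V | edge M p.1 p.2}.

Definition src (d : dedge) : V := (val d).1.
Definition dst (d : dedge) : V := (val d).2.

(* For d = (v -> u), these are the edges w -> v with w in N(v) \ {u}. *)
Definition feeds (d : dedge) : pred dedge :=
  fun f => (dst f == src d) && (src f != dst d).

Definition L2 (f : T -> R) : Prop := f \_ X \in Lfun mu 2%:E.

Definition dotL2 (f g : T -> R) : R := \int[mu]_(x in X) (f x * g x).

Definition sqnormL2 (f : T -> R) : R := dotL2 f f.

Definition density (f : T -> R) : Prop :=
  [/\ L2 f, forall x, X x -> 0 <= f x &
      (\int[mu]_(x in X) (f x)%:E = 1)%E].

Definition bp_integral (m : dedge -> T -> R) (d : dedge) (x : T) : R :=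
  \int[mu]_(y in X) (edge_pot M (dst d) (src d) x y * node_pot M (src d) y
                     * \prod_(f | feeds d f) m f y).

Definition bp_update (m : dedge -> T -> R) (d : dedge) (x : T) : R :=
  bp_integral m d x / \int[mu]_(z in X) bp_integral m d z.

(* Messages are elements of L^2, hence the equality almost everywhere. *)
Definition bp_fixed_point (m : dedge -> T -> R) : Prop :=
  (forall d, density (m d)) /\
  (forall d, {ae mu, forall x, X x -> bp_update m d x = m d x}).

Definition beta (d : dedge) (y : T) : R :=
  node_pot M (src d) y *
  \int[mu]_(x in X) edge_pot M (dst d) (src d) x y.

Definition Gam (d : dedge) (x y : T) : R :=
  edge_pot M (dst d) (src d) x y * node_pot M (src d) y / beta d y.

(* The basis is indexed from 0: phi j stands for the (j+1)-st function. *)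
Definition proj_basis (phi : nat -> T -> R) (r : nat) (f : T -> R) (x : T) : R :=
  \sum_(j < r) dotL2 f (phi j) * phi j x.

Definition orthonormal_basis (phi : nat -> T -> R) : Prop :=
  [/\ forall j, L2 (phi j),
      forall i j, dotL2 (phi i) (phi j) = (i == j)%:R &
      forall f, L2 f ->
        sqnormL2 (f \- proj_basis phi r f) @[r --> \oo] --> (0 : R)].

Definition inf_proj_Gam (phi : nat -> T -> R) (r : nat) (d : dedge) (x : T) : R :=
  inf [set proj_basis phi r (Gam d ^~ y) x | y in X].

Definition Bcoef (phi : nat -> T -> R) (j : nat) : R :=
  \big[Num.max/0]_(d : dedge) sup [set `|dotL2 (Gam d ^~ y) (phi j)| | y in X].

Definition expansion (phi : nat -> T -> R) (r : nat)
    (a : dedge -> 'I_r -> R) (d : dedge) (x : T) : R :=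
  \sum_(j < r) a d j * phi j x.

(* y t d i is the i-th sample drawn on the edge d during the iteration
   t -> t.+1. *)
Fixpoint sosmp_coef (phi : nat -> T -> R) (r k : nat) (eta : nat -> R)
    (y : nat -> dedge -> 'I_k -> T) (t : nat) (d : dedge) (j : 'I_r) : R :=
  if t is t'.+1 then
    (1 - eta t') * sosmp_coef phi eta y t' d j +
    eta t' * (k%:R^-1 * \sum_(i < k) dotL2 (Gam d ^~ (y t' d i)) (phi j))
  else r%:R^-1.

Definition sosmp_msg (phi : nat -> T -> R) (r k : nat) (eta : nat -> R)
    (y : nat -> dedge -> 'I_k -> T) (t : nat) : dedge -> T -> R :=
  expansion phi (@sosmp_coef phi r k eta y t).

Definition sampling_weight (m : dedge -> T -> R) (d : dedge) (y : T) : R :=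
  beta d y * \prod_(f | feeds d f) Num.max 0 (m f y).

Definition sampling_density (m : dedge -> T -> R) (d : dedge) (y : T) : R :=
  sampling_weight m d y / \int[mu]_(z in X) sampling_weight m d z.

Section Draws.
Context {dO : measure_display} {Omega : measurableType dO}.
Variables (P : probability Omega R) (k : nat).
Variable Y : nat -> dedge -> 'I_k -> {RV P >-> borel_rV R n}.

(* The sigma-algebra generated by all the samples drawn before iteration t. *)
Definition past (t : nat) : set (set Omega) :=
  <<s [set H : set Omega | exists s d i (B : set T),
         [/\ (s < t)%N, measurable B & H = Y s d i @^-1` B]] >>.

Definition samples_at (w : Omega) : nat -> dedge -> 'I_k -> T :=
  fun t d i => Y t d i w.

(* The last clause says that, conditionally on the past of iteration t, the
   samples Y t d 0, ..., Y t d k.-1 are i.i.d. with density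
   sampling_density (m^t) d; no joint law is prescribed for the samples drawn on
   different edges in the same iteration. *)
Definition sosmp_draws (phi : nat -> T -> R) (r : nat) (eta : nat -> R) : Prop :=
  let m t w := sosmp_msg phi r eta (samples_at w) t in
  [/\ forall t d i w, X (Y t d i w),
      forall t d, {ae P, forall w,
        (0 < \int[mu]_(y in X) (sampling_weight (m t w) d y)%:E < +oo)%E} &
      forall t d (H : set Omega) (B : 'I_k -> set T),
        past t H -> (forall i, measurable (B i)) ->
        P (H `&` \bigcap_i (Y t d i @^-1` B i)) =
        (\int[P]_(w in H) \prod_(i < k)
           \int[mu]_(y in X `&` B i) (sampling_density (m t w) d y)%:E)%E].

End Draws.

Definition sqnorm_vec (f : dedge -> T -> R) : 'cV[R]_#|{: dedge}| :=
  \col_i sqnormL2 (f (enum_val i)).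

Definition proj_residual (phi : nat -> T -> R) (r : nat) (m : dedge -> T -> R)
    (d : dedge) (x : T) : R :=
  m d x - proj_basis phi r (m d) x.

Definition sosmp_error (phi : nat -> T -> R) (r k : nat) (eta : nat -> R)
    (mstar : dedge -> T -> R) (y : nat -> dedge -> 'I_k -> T) (t : nat)
    (d : dedge) (x : T) : R :=
  sosmp_msg phi r eta y t d x - proj_basis phi r (mstar d) x.

End Model.

Section Projection.
Context {R : realType} {p : nat}.

Definition sqdist (x y : 'cV[R]_p) : R := \sum_i (x i 0 - y i 0) ^+ 2.

Definition is_projection (S : set 'cV[R]_p) (x z : 'cV[R]_p) : Prop :=
  S z /\ forall s, S s -> sqdist x z <= sqdist x s.

(* Defaults to 0 when S has no point nearest to x. *)
Definition projection (S : set 'cV[R]_p) (x : 'cV[R]_p) : 'cV[R]_p :=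
  xget 0 (is_projection S x).

Definition box (c : 'cV[R]_p) : set 'cV[R]_p :=
  [set e | forall i, `|e i 0| <= c i 0].

End Projection.

(* Main.v *)
Require Import Defs.
From mathcomp Require Import all_boot all_order all_algebra.
From mathcomp Require Import all_classical all_reals all_analysis.
From mathcomp Require Import measurable_realfun ring lra zify.

(* Call an edge f an input of the edge d when the message on f enters the update
   of the message on d.  In a tree this relation has no infinite chains, so any
   matrix N supported on it is nilpotent; here N is a large enough multiple of
   its indicator, row by row.

   With eta^t = 1/(t+1) the coefficients at time t are the averages of the first
   t sample means.  Centring these at the coefficients of mstar splits the error
   into an average of bounded, pairwise orthogonal noises (a conditionally
   centred sequence) and an average of biases.  The noise averages are O(1/t) in
   mean square and vanish almost surely.  The bias at a time s >= 1 is Lipschitz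
   in the incoming messages, its square being bounded by the d-th entry of
   N (rho^2(Delta^s) + rho^2(A^r)), so both claims follow from the recursion
     e(t) <= o(1) + (1/t) sum_{1 <= s < t} N (e(s) + rho^2(A^r)).

   The Lipschitz bound needs the messages to be uniformly bounded although the
   basis functions may be unbounded.  The hypothesis on Pi^r and A^r makes the
   function y |-> Pi^r(Gamma(x,y)) nonnegative, and makes its mean under the
   strictly positive limiting sampling density at most 2 mstar(x).  Since it
   ranges in a finite-dimensional space that does not depend on x, it is bounded
   by a constant times this mean. *)

(** Write S for the sum of the B_j^2. The limiting equation x = N (x + A) has the single solution N
    (I - N)^{-1} A, and since N is nilpotent, iterating x |-> N (x + A) from any bound lands on it
    after finitely many steps; hence the exact box in (a). In (b), a bound of order 1/s averaged
    over 2 <= s < t produces log t / t. The profile 6 S U(t) / t reproduces itself under the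
    recursion when U(t) = N 1 + 16 1 + log t N U(t), which is the stated resolvent; the vector N 1
    in it pays for the time s = 1, which stays outside the logarithmic sum. Noise and bias are
    separated by (a + b)^2 <= 2 a^2 + 2 b^2. The noise costs 8 S / t. Another 8 S / t comes from the
    bias at time 0, which is treated apart: the initial message is no average of values
    Pi^r(Gamma(x,y)), so it may be unbounded. As eta^0 = 1, it is forgotten at once and affects only
    the first draws. The fixed point equation holds only almost everywhere; the draws have
    densities, so almost surely they avoid the exceptional sets. *)

Set Implicit Arguments.
Unset Strict Implicit.
Unset Printing Implicit Defensive.

Import Order.TTheory GRing.Theory Num.Theory.
Import numFieldNormedType.Exports.

Local Open Scope classical_set_scope.
Local Open Scope ring_scope.

(** * Trees and nilpotent matrices *)

Section FeedingWalks.
Context {R : realType} {n : nat} {V : finType}.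
Variable M : pairwise_mrf R n V.

(* A repeated vertex would close a cycle, of length at most 2 in a tree; length
   1 is a self-edge and length 2 is a backtracking step, which feeds excludes. *)
Lemma feeding_walk_uniq (d : dedge M) (p : seq (dedge M)) :
  is_tree (edge M) -> path (@feeds R n V M) d p ->
  uniq (map (@dst R n V M) (d :: p)).
Proof.
move=> [_ acyclic]; elim: p d => [|g p IH] d //= /andP[dg gp].
move/(_ g gp): IH => /= IH; rewrite IH andbT; apply/negP => dp.
have {dp} : dst d \in map (@dst R n V M) (g :: p) by [].
move: gp IH dg; rewrite -/(uniq (dst g :: _)) -(map_cons _ g) => gp IH dg dp.
(* The first return to [dst d]: the part of the walk before it avoids [dst d] and is duplicate-free
   by induction, so it closes into a cycle. *)
have [i ilt iE] : exists2 i, (i < size (g :: p))%N &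
    nth (dst d) (map (@dst R n V M) (g :: p)) i = dst d /\
    dst d \notin take i (map (@dst R n V M) (g :: p)).
  exists (index (dst d) (map (@dst R n V M) (g :: p))).
    by rewrite -(size_map (@dst R n V M)) index_mem.
  split; first exact: nth_index.
  by apply/negP => /index_ltn; rewrite ltnn.
case: iE => iE notin.
have dgp : path (@feeds R n V M) d (g :: p) by apply/andP.
have walk (x : dedge M) s : path (@feeds R n V M) x s ->
    path (edge M) (dst x) (map (@dst R n V M) s).
  elim: s x => //= y s IHs x /andP[xy ys]; rewrite IHs// andbT.
  case/andP: xy => /eqP -> _; rewrite edge_sym; exact: (valP x).
have szmap : (i < size (map (@dst R n V M) (g :: p)))%N by rewrite size_map.
have : ucycle (edge M) (dst d :: take i (map (@dst R n V M) (g :: p))).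
  apply/andP; split; last by rewrite cons_uniq notin take_uniq.
  rewrite /cycle -[X in rcons _ X]iE -take_nth//.
  by apply: take_path; exact: walk.
move=> /acyclic; rewrite /= size_take szmap ltnS.
case: i ilt iE {notin szmap} => [|[|//]] ilt iE _.
  move: iE => /= iE; move: (valP d); case/andP: dg => /eqP dg _.
  by rewrite -/(src d) -/(dst d) -dg iE edge_irr.
case: p gp ilt iE {IH dp dgp} => [//|g' p] /= /andP[gg' _] _ g'd.
case/andP: gg' => /eqP g'g _; case/andP: dg => _.
by rewrite -g'g g'd eqxx.
Qed.

Lemma feeding_walk_size (d : dedge M) (p : seq (dedge M)) :
  is_tree (edge M) -> path (@feeds R n V M) d p -> (size p < #|V|)%N.
Proof.
move=> tree /(feeding_walk_uniq tree) /card_uniqP; rewrite size_map /= => <-.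
exact: max_card.
Qed.

End FeedingWalks.

Section NilpotentMatrix.
Context {R : realType} {p : nat}.
Variable N : 'M[R]_p.

Lemma expmx_neq0_path q (i j : 'I_p) : (N ^+ q) i j != 0 ->
  exists2 s, path (fun a b => N a b != 0) i s & size s = q.
Proof.
elim: q i => [|q IH] i; first by exists [::].
rewrite exprS => Nij.
have [l Nl] : exists l, N i l * (N ^+ q) l j != 0.
  apply/existsP; apply: contraNT Nij => /existsPn h.
  by rewrite mxE big1// => l _; apply/eqP; move: (h l); rewrite negbK.
move: Nl; rewrite mulf_eq0 negb_or => /andP[Nil /IH[s sp sq]].
by exists (l :: s) => /=; rewrite ?Nil ?sq.
Qed.

Lemma nilpotent_of_path_size q :
  (forall i s, path (fun a b => N a b != 0) i s -> (size s < q)%N) -> N ^+ q = 0.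
Proof.
move=> h; apply/matrixP => i j; rewrite mxE; apply/eqP/negP => /negP.
by move=> /expmx_neq0_path[s /h]; rewrite ltn_neqAle => /andP[/eqP].
Qed.

(** The finite geometric series of [x *: N]. When [N ^+ q = 0] it inverts [1%:M - x *: N] for every
    [x], however large, and it makes the signs of the entries and their monotonicity in [x]
    visible. *)
Definition neumann (q : nat) (x : R) : 'M[R]_p := \sum_(i < q) x ^+ i *: N ^+ i.

Lemma neumannE q x : N ^+ q = 0 -> neumann q x = 1%:M + x *: (N *m neumann q x).
Proof.
move=> Nq; have -> : x *: (N *m neumann q x) = \sum_(i < q) x ^+ i.+1 *: N ^+ i.+1.
  rewrite scalemxAl mulmx_sumr; apply: eq_bigr => i _.
  by rewrite -scalemxAl -scalemxAr scalerA [N ^+ _.+1]exprS [x ^+ _.+1]exprS.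
have -> : 1%:M = x ^+ 0 *: N ^+ 0 by rewrite !expr0 scale1r.
have := @big_ord_recl _ 0 +%R q (fun i => x ^+ i *: N ^+ i).
by rewrite big_ord_recr /= Nq scaler0 addr0 => <-.
Qed.

Lemma invmx_neumann q x : N ^+ q = 0 -> invmx (1%:M - x *: N) = neumann q x.
Proof.
move=> Nq; have inv : (1%:M - x *: N) *m neumann q x = 1%:M.
  rewrite mulmxBl mul1mx -scalemxAl {1}(neumannE x Nq).
  by rewrite addrK.
have /mulmx1_unit[u _] := inv.
by rewrite -[RHS](mulKmx u) inv mulmx1.
Qed.

Lemma neumann_ge0 q x : 0 <= x -> (forall i j, 0 <= N i j) ->
  forall i j, 0 <= neumann q x i j.
Proof.
move=> x0 N0 i j; rewrite summxE sumr_ge0// => l _; rewrite mxE mulr_ge0 ?exprn_ge0//.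
elim: {l}(l : nat) i j => [|l IH] i j; first by rewrite expr0 mxE ler0n.
by rewrite exprS mxE sumr_ge0// => k _; rewrite mulr_ge0.
Qed.

Lemma neumann_mono q x y : 0 <= x -> x <= y -> (forall i j, 0 <= N i j) ->
  forall i j, neumann q x i j <= neumann q y i j.
Proof.
move=> x0 xy N0 i j; rewrite !summxE; apply: ler_sum => l _.
rewrite !mxE ler_wpM2r//.
  elim: {l}(l : nat) i j => [|l IH] i j; first by rewrite expr0 mxE ler0n.
  by rewrite exprS mxE sumr_ge0// => k _; rewrite mulr_ge0.
by rewrite lerXn2r// nnegrE (le_trans x0).
Qed.

End NilpotentMatrix.

(** * Error recursions *)

Section ErrorRecursions.
Context {R : realType} {p : nat}.
Variables (N : 'M[R]_p) (q : nat) (A : 'cV[R]_p).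
Hypotheses (Nq : N ^+ q = 0) (N0 : forall i j, 0 <= N i j).
Hypothesis A0 : forall i, 0 <= A i 0.

(** The corner of the limiting box, and the fixed point of the error recursion. *)
Let c : 'cV[R]_p := N *m invmx (1%:M - N) *m A.

Lemma mulmx_le (x y : 'cV[R]_p) : (forall i, x i 0 <= y i 0) ->
  forall i, (N *m x) i 0 <= (N *m y) i 0.
Proof. by move=> xy i; rewrite !mxE ler_sum// => j _; rewrite ler_wpM2l. Qed.

Lemma mulmx_ge0 (x : 'cV[R]_p) : (forall i, 0 <= x i 0) ->
  forall i, 0 <= (N *m x) i 0.
Proof. by move=> x0 i; rewrite mxE sumr_ge0// => j _; rewrite mulr_ge0. Qed.

Lemma fixed_point_recE : c = N *m (c + A).
Proof.
have E : invmx (1%:M - N) = 1%:M + N *m invmx (1%:M - N).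
  have := invmx_neumann 1 Nq; rewrite scale1r => ->.
  by rewrite [in LHS](neumannE 1 Nq) scale1r.
rewrite /c -mulmxA [in LHS]E mulmxDl mul1mx mulmxDr.
by rewrite addrC mulmxDr !mulmxA.
Qed.

Lemma fixed_point_rec_ge0 i : 0 <= c i 0.
Proof.
have := invmx_neumann 1 Nq; rewrite scale1r /c -mulmxA => ->; apply: mulmx_ge0 => j.
rewrite mxE sumr_ge0// => l _; rewrite mulr_ge0//.
exact: neumann_ge0.
Qed.

(** Term by term, 1/(u+2) <= -ln (1 - 1/(u+2)) = ln (u+2) - ln (u+1). Starting at 2 gives [ln t]
    with no additive constant. *)
Lemma sum_inv_le_ln (t : nat) : (0 < t)%N ->
  \sum_(2 <= s < t) (s%:R^-1 : R) <= ln t%:R.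
Proof.
have H u : \sum_(2 <= s < u.+2) (s%:R^-1 : R) <= ln u.+1%:R.
  elim: u => [|u IH]; first by rewrite big_geq// ln1.
  rewrite big_nat_recr//=; apply: (le_trans (lerD IH (lexx _))).
  have u0 : 0 < u.+1%:R :> R by rewrite ltr0n.
  have u1 : 0 < u.+2%:R :> R by rewrite ltr0n.
  have -> : ln u.+2%:R = ln u.+1%:R - ln (u.+1%:R / u.+2%:R) :> R.
    by rewrite ln_div ?posrE//; ring.
  have -> : u.+1%:R / u.+2%:R = 1 - u.+2%:R^-1 :> R.
    have u2 : u.+2%:R = u.+1%:R + 1 :> R by rewrite natr1.
    by move: u1; rewrite u2 => u1; field; rewrite gt_eqF.
  have : u.+2%:R^-1 < 1 :> R by rewrite invf_lt1// ltr1n.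
  by rewrite -ltrN2 => /le_ln1Dx le1; rewrite lerD2l lerNr.
case: t => [//|[_|t _]]; first by rewrite big_geq// ln1.
by apply: (le_trans (H t)); rewrite ler_ln ?posrE ?ltr0n// ler_nat.
Qed.

(** Strong induction on the bound 6 sigma U(t) / t + c. Since U(s) <= U(t), the times 2 <= s < t
    contribute at most 6 sigma log t N U(t) besides the multiples of [c], and the equation defining
    U(t) absorbs this. The constant 16 sigma is covered with room to spare by 6 sigma times 16. *)
Lemma expectation_rec (sigma : R) (e : nat -> 'cV[R]_p) : 0 <= sigma ->
  (forall i, e 1%N i 0 <= 4 * sigma) ->
  (forall t, (0 < t)%N -> forall i, e t i 0 <= 16 * sigma / t%:R +
     t%:R^-1 * \sum_(1 <= s < t) (N *m (e s + A)) i 0) ->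
  forall t, (0 < t)%N -> forall i, e t i 0 <=
    ((6 * sigma) *: ((t%:R^-1 *: invmx (1%:M - ln t%:R *: N)) *m
       (N *m const_mx 1 + 16 *: const_mx 1)) + c) i 0.
Proof.
move=> sigma0 e1 erec; pose w : 'cV[R]_p := N *m const_mx 1 + 16 *: const_mx 1.
have Nw0 : forall i, 0 <= (N *m const_mx 1 : 'cV[R]_p) i 0.
  by apply: mulmx_ge0 => j; rewrite mxE.
have w0 i : 0 <= w i 0.
  by have := Nw0 i; rewrite !mxE; lra.
pose U t := neumann N q (ln t%:R) *m w.
have lnt t : (0 < t)%N -> 0 <= ln t%:R :> R by move=> t0; rewrite ln_ge0// ler1n.
have Umono s t : (0 < s)%N -> (s <= t)%N -> forall i, U s i 0 <= U t i 0.
  move=> s0 st i; rewrite !mxE; apply: ler_sum => j _.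
  rewrite ler_wpM2r//; apply: neumann_mono => //; first exact: lnt.
  by rewrite ler_ln ?ler_nat// posrE ltr0n// (leq_trans s0).
suff main t : (0 < t)%N -> forall i, e t i 0 <= 6 * sigma / t%:R * U t i 0 + c i 0.
  move=> t t0 i; apply: (le_trans (main t t0 i)).
  rewrite (invmx_neumann _ Nq) -scalemxAl scalerA [X in _ <= X]mxE [X in _ <= X + _]mxE.
  by rewrite -/w -/(U t) lerD2r.
elim/ltn_ind: t => t IH t0 i.
have tR0 : 0 < t%:R :> R by rewrite ltr0n.
apply: (le_trans (erec t t0 i)).
have step s : (1 < s)%N -> (s < t)%N ->
    (N *m (e s + A)) i 0 <= 6 * sigma / s%:R * (N *m U t) i 0 + c i 0.
  move=> s1 st; rewrite fixed_point_recE.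
  apply: (@le_trans _ _ ((N *m ((6 * sigma / s%:R) *: U t + (c + A))) i 0)).
    apply: mulmx_le => j.
    rewrite addrA [X in X <= _]mxE [X in _ <= X]mxE lerD2r [X in _ <= X]mxE.
    apply: (le_trans (IH s st (ltnW s1) j)).
    rewrite lerD2r [X in _ <= X]mxE ler_wpM2l ?mulr_ge0//.
    by apply: Umono; [exact: ltnW|exact: ltnW].
  by rewrite mulmxDr -scalemxAr mxE [X in X + _ <= _]mxE.
(* Time 1 uses the crude bound [e1] in place of the induction hypothesis, because 1/1 is not part of
   the sum bounded by [ln t]. *)
have first_step : (N *m (e 1%N + A)) i 0 <=
    6 * sigma * (N *m const_mx 1 : 'cV[R]_p) i 0 + c i 0.
  rewrite fixed_point_recE.
  apply: (@le_trans _ _ ((N *m ((6 * sigma) *: const_mx 1 + (c + A))) i 0)).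
    apply: mulmx_le => j; rewrite [X in X <= _]mxE !(mxE, mulr1).
    have := e1 j; have := fixed_point_rec_ge0 j; rewrite /c !mxE; lra.
  by rewrite mulmxDr -scalemxAr mxE [X in X + _ <= _]mxE.
have NU0 : 0 <= (N *m U t) i 0.
  apply: mulmx_ge0 => j; rewrite mxE sumr_ge0// => l _; rewrite mulr_ge0//.
  by apply: neumann_ge0 => //; exact: lnt.
have c0 := fixed_point_rec_ge0 i.
have sumle : \sum_(1 <= s < t) (N *m (e s + A)) i 0 <=
    6 * sigma * (N *m const_mx 1 : 'cV[R]_p) i 0 +
    6 * sigma * ln t%:R * (N *m U t) i 0 + t%:R * c i 0.
  have s6 : 0 <= 6 * sigma * (N *m const_mx 1 : 'cV[R]_p) i 0.
    by rewrite mulr_ge0// mulr_ge0.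
  have [t1|t1] := leqP t 1.
    by rewrite big_geq// !addr_ge0// ?mulr_ge0// lnt.
  rewrite big_ltn//.
  have -> : t%:R * c i 0 = c i 0 *+ 2 + \sum_(2 <= s < t) c i 0.
    by rewrite big_const_nat iter_addr addr0 -mulrnDr mulr_natl subnKC.
  have : \sum_(2 <= s < t) (N *m (e s + A)) i 0 <=
      \sum_(2 <= s < t) (6 * sigma / s%:R * (N *m U t) i 0 + c i 0).
    rewrite big_nat_cond [X in _ <= X]big_nat_cond; apply: ler_sum => s.
    by rewrite andbT => /andP[s1 st]; exact: step.
  rewrite big_split/= -mulr_suml -mulr_sumr => le1.
  have : 6 * sigma * (\sum_(2 <= s < t) s%:R^-1) * (N *m U t) i 0 <=
      6 * sigma * ln t%:R * (N *m U t) i 0.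
    by rewrite ler_wpM2r// ler_wpM2l ?mulr_ge0// sum_inv_le_ln.
  by move: le1 first_step; lra.
(* The resolvent equation, which closes the induction. *)
have UE : U t i 0 = (N *m const_mx 1 : 'cV[R]_p) i 0 + 16 + ln t%:R * (N *m U t) i 0.
  have gen (Z Y : 'cV[R]_p) x :
      (Z + 16 *: const_mx 1 + x *: Y) i 0 = Z i 0 + 16 + x * Y i 0.
    by rewrite !mxE mulr1.
  rewrite -gen [in LHS]/U (neumannE _ Nq) mulmxDl mul1mx -scalemxAl -mulmxA.
  by [].
rewrite UE; have tV0 : 0 < t%:R^-1 :> R by rewrite invr_gt0.
have := ler_wpM2l (ltW tV0) sumle.
rewrite mulrDr [X in _ <= _ + X]mulrA mulVf ?gt_eqF// mul1r.
have : 0 <= sigma * t%:R^-1 by rewrite mulr_ge0// ltW.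
by set y := t%:R^-1; lra.
Qed.

(** The terms before [s0] cost at most [K * s0] in total, which division by [t] makes negligible. *)
Lemma cesaro_limsup (v : nat -> R) (K u : R) : 0 <= K -> 0 <= u ->
  (forall s, (0 < s)%N -> v s <= K) ->
  (forall eps, 0 < eps -> exists s0, forall s, (s0 <= s)%N -> v s <= u + eps) ->
  forall eps, 0 < eps -> exists t0, forall t, (t0 <= t)%N ->
    t%:R^-1 * \sum_(1 <= s < t) v s <= u + eps.
Proof.
move=> K0 u0 vK vu eps eps0.
have e2 : 0 < eps / 2 by rewrite divr_gt0.
have [s0 hs0] := vu _ e2.
have sumle t : \sum_(1 <= s < t) v s <= K * (minn t s0)%:R + t%:R * (u + eps / 2).
  elim: t => [|t IH].
    by rewrite big_geq// min0n mulr0 mul0r addr0.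
  have tu : 0 <= u + eps / 2 by rewrite addr_ge0// ltW.
  case: t IH => [|t] IH.
    by rewrite big_geq// addr_ge0// mulr_ge0.
  rewrite big_nat_recr//=.
  have -> : t.+2%:R * (u + eps / 2) = t.+1%:R * (u + eps / 2) + (u + eps / 2).
    by rewrite -[t.+2%:R]natr1 mulrDl mul1r.
  have [ts0|s0t] := ltnP t.+1 s0.
    have -> : K * (minn t.+2 s0)%:R = K * (minn t.+1 s0)%:R + K.
      by rewrite (minn_idPl ts0) (minn_idPl (ltnW ts0)) -[t.+2%:R]natr1 mulrDr mulr1.
    by move: IH (vK t.+1 isT); lra.
  have -> : minn t.+2 s0 = minn t.+1 s0.
    by rewrite (minn_idPr s0t) (minn_idPr (leqW s0t)).
  by move: IH (hs0 _ s0t); lra.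
have [t0 t0P] : exists t0 : nat, K * s0%:R / (eps / 2) <= t0%:R.
  exists (Num.truncn (K * s0%:R / (eps / 2))).+1.
  by rewrite ltW// truncnS_gt.
exists (maxn t0 1) => t; rewrite geq_max => /andP[t0t t1].
have t_gt0 : 0 < t%:R :> R by rewrite ltr0n.
rewrite mulrC ler_pdivrMr//; apply: (le_trans (sumle t)).
have : K * (minn t s0)%:R <= K * s0%:R.
  by rewrite ler_wpM2l// ler_nat geq_minr.
move: t0P; rewrite ler_pdivrMr// => t0P.
have : t0%:R * (eps / 2) <= t%:R * (eps / 2) by rewrite ler_pM2r// ler_nat.
lra.
Qed.

(** One use of the recursion improves an asymptotic upper bound x to N (x + A). Starting from the
    constant [K], the distance to [c] is multiplied by [N] each time, so after [q] improvements the
    bound is [c] itself. *)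
Lemma limsup_rec (K : R) (e b : nat -> 'cV[R]_p) : 0 <= K ->
  (forall t, (0 < t)%N -> forall i, e t i 0 <= K) ->
  (forall i eps, 0 < eps -> exists t0, forall t, (t0 <= t)%N -> b t i 0 <= eps) ->
  (forall t, (0 < t)%N -> forall i, e t i 0 <= b t i 0 +
     t%:R^-1 * \sum_(1 <= s < t) (N *m (e s + A)) i 0) ->
  forall i eps, 0 < eps -> exists t0, forall t, (t0 <= t)%N ->
    e t i 0 <= c i 0 + eps.
Proof.
move=> K0 eK bto0 erec.
pose u m : 'cV[R]_p := iter m (fun x => N *m (x + A)) (const_mx K).
have u0 m i : 0 <= u m i 0.
  elim: m i => [|m IH] i; first by rewrite mxE.
  by apply: mulmx_ge0 => j; rewrite mxE addr_ge0.
have ucE m : u m - c = N ^+ m *m (const_mx K - c).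
  elim: m => [|m IH]; first by rewrite expr0 mul1mx.
  rewrite /= [in LHS]fixed_point_recE -mulmxBr opprD addrACA subrr addr0 -/(u m) IH.
  by rewrite exprS mulmxA.
have -> : c = u q by apply/esym/eqP; rewrite -subr_eq0 ucE Nq mul0mx.
elim: q => [|m IH] i eps eps0.
  exists 1%N => t t1; rewrite mxE (le_trans (eK _ t1 _))// lerDl ltW//.
have e2 : 0 < eps / 2 by rewrite divr_gt0.
have [tb tbP] := bto0 i _ e2.
have [t1 t1P] : exists t0, forall t, (t0 <= t)%N ->
    t%:R^-1 * \sum_(1 <= s < t) (N *m (e s + A)) i 0 <= u m.+1 i 0 + eps / 2.
  apply: (@cesaro_limsup _ ((N *m (const_mx K + A)) i 0)) => //.
  - by apply: mulmx_ge0 => j; rewrite !mxE addr_ge0.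
  - by move=> s s1; apply: mulmx_le => j; rewrite !mxE lerD2r eK.
  (* A slack [d / D] in every coordinate becomes at most [d] after multiplication by row [i] of [N];
     the 1 keeps [D] positive. *)
  move=> d d0; pose D := 1 + \sum_j N i j.
  have D0 : 0 < D by rewrite ltr_pwDl// sumr_ge0.
  have /choice[f fP] j := IH j (d / D) (divr_gt0 d0 D0).
  exists (\max_j f j)%N => s sP.
  apply: (@le_trans _ _ ((N *m (u m + const_mx (d / D) + A)) i 0)).
    apply: mulmx_le => j; rewrite !mxE lerD2r fP//.
    by rewrite (leq_trans _ sP)// leq_bigmax.
  rewrite addrAC mulmxDr mxE lerD2l mxE.
  under eq_bigr do rewrite mxE.
  rewrite -mulr_suml mulrCA ger_pMr// ler_pdivrMr// mul1r.
  by rewrite lerDr.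
exists (maxn 1 (maxn tb t1)) => t; rewrite !geq_max => /and3P[t_gt0 tbt t1t].
apply: (le_trans (erec t t_gt0 i)).
by move: (tbP t tbt) (t1P t t1t); lra.
Qed.

End ErrorRecursions.

(** * Bounded measurable functions and a strong law *)

Section BoundedMeasurable.
Context d (T : measurableType d) (R : realType).
Implicit Types (D : set T) (f g : T -> R).

(** This class is stable under sums and products and is integrable over sets of finite measure; it
    discharges most integrability conditions below. *)
Definition bounded_mfun D f :=
  measurable_fun D f /\ exists K, forall x, D x -> `|f x| <= K.

Lemma bounded_mfun_ge0 D f : bounded_mfun D f ->
  exists2 K, 0 <= K & forall x, D x -> `|f x| <= K.
Proof.
move=> [_ [K fK]]; exists `|K| => // x Dx.
by rewrite (le_trans (fK x Dx))// ler_norm.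
Qed.

Lemma bounded_mfun_cst D (c : R) : bounded_mfun D (fun=> c).
Proof. by split; [exact: measurable_cst|exists `|c|]. Qed.

Lemma bounded_mfunD D f g : bounded_mfun D f -> bounded_mfun D g ->
  bounded_mfun D (fun x => f x + g x).
Proof.
move=> [mf [K fK]] [mg [L gL]]; split; first exact: measurable_funD.
by exists (K + L) => x Dx; rewrite (le_trans (ler_normD _ _))// lerD ?fK ?gL.
Qed.

Lemma bounded_mfunM D f g : bounded_mfun D f -> bounded_mfun D g ->
  bounded_mfun D (fun x => f x * g x).
Proof.
move=> [mf [K fK]] [mg [L gL]]; split; first exact: measurable_funM.
by exists (K * L) => x Dx; rewrite normrM ler_pM ?fK ?gL.
Qed.

Lemma bounded_mfunZ D (c : R) f : bounded_mfun D f ->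
  bounded_mfun D (fun x => c * f x).
Proof. by move=> bf; apply: bounded_mfunM => //; exact: bounded_mfun_cst. Qed.

Lemma bounded_mfun_sqr D f : bounded_mfun D f -> bounded_mfun D (fun x => f x ^+ 2).
Proof. by move=> bf; have := bounded_mfunM bf bf. Qed.

Lemma bounded_mfunB D f g : bounded_mfun D f -> bounded_mfun D g ->
  bounded_mfun D (fun x => f x - g x).
Proof.
move=> [mf [K fK]] [mg [L gL]]; split; first exact: measurable_funB.
by exists (K + L) => x Dx; rewrite (le_trans (ler_normB _ _))// lerD ?fK ?gL.
Qed.

Lemma bounded_mfun_sum D (I : Type) (s : seq I) (P : pred I) (h : I -> T -> R) :
  (forall i, P i -> bounded_mfun D (h i)) ->
  bounded_mfun D (fun x => \sum_(i <- s | P i) h i x).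
Proof.
move=> bh; elim: s => [|i s IH].
  rewrite (_ : (fun _ => _) = (fun=> 0)); first exact: bounded_mfun_cst.
  by apply/funext => x; rewrite big_nil.
have [Pi|Pi] := boolP (P i); last first.
  by rewrite (_ : (fun _ => _) = (fun x => \sum_(j <- s | P j) h j x))//;
    apply/funext => x; rewrite big_cons (negbTE Pi).
rewrite (_ : (fun _ => _) = (fun x => h i x + \sum_(j <- s | P j) h j x)).
  by apply: bounded_mfunD => //; exact: bh.
by apply/funext => x; rewrite big_cons Pi.
Qed.

Lemma bounded_mfun_indic D (A : set T) : measurable A -> bounded_mfun D (\1_A : T -> R).
Proof.
move=> mA; split; first exact: measurable_indic.
by exists 1 => x _; rewrite indicE ger0_norm ?ler0n// lern1 leq_b1.
Qed.

Variable mu : {measure set T -> \bar R}.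

Lemma bounded_mfun_integrable D f : measurable D -> (mu D < +oo)%E ->
  bounded_mfun D f -> mu.-integrable D (EFin \o f).
Proof.
move=> mD muD [mf [K fK]]; apply: measurable_bounded_integrable => //.
by exists K; split; [exact: num_real|move=> L KL x Dx; exact: le_trans (fK x Dx) (ltW KL)].
Qed.

Lemma integrable_mulbounded D f g : measurable D -> bounded_mfun D f ->
  mu.-integrable D (EFin \o g) -> mu.-integrable D (EFin \o (fun x => f x * g x)).
Proof.
move=> mD [mf [K fK]] ig; apply: (@le_integrable _ _ _ _ _ mD _ (EFin \o (fun x => K * g x))).
- apply/measurable_EFinP; apply: measurable_funM => //.
  by apply/measurable_EFinP; exact: measurable_int ig.
- move=> x Dx /=; rewrite lee_fin !normrM ler_wpM2r//.
  by rewrite (le_trans (fK x Dx))// ler_norm.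
- rewrite (_ : EFin \o _ = (fun x => K%:E * (EFin \o g) x)%E)//.
  exact: integrableZl.
Qed.

End BoundedMeasurable.

Section StrongLaw.
Context d (Omega : measurableType d) (R : realType) (P : probability Omega R).

Lemma prob_bounded_integrable (f : Omega -> R) :
  bounded_mfun setT f -> P.-integrable setT (EFin \o f).
Proof.
by move=> bf; apply: bounded_mfun_integrable => //; rewrite [X in (X < _)%E]probability_setT ltry.
Qed.

Lemma sum_inv_sqr_le m : \sum_(0 <= n < m) (n.+1%:R ^- 2 : R) <= 2.
Proof.
(* The correction term makes the induction telescope: (x+1)^-2 <= 1/x - 1/(x+1). *)
suff H k : \sum_(0 <= n < k.+1) (n.+1%:R ^- 2 : R) <= 2 - k.+1%:R^-1.
  case: m => [|k]; first by rewrite big_geq.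
  by rewrite (le_trans (H k))// gerBl invr_ge0.
elim: k => [|k IH]; first by rewrite big_nat1 mulr1n expr1n invr1 lerBrDr.
rewrite big_nat_recr//=; apply: (le_trans (lerD IH (lexx _))).
have E : k.+2%:R = k.+1%:R + 1 :> R by rewrite natr1.
rewrite E; set x : R := k.+1%:R; have x0 : 0 < x by rewrite ltr0n.
suff : (x + 1) ^- 2 <= x^-1 - (x + 1)^-1.
  by move: ((x + 1) ^- 2) (x^-1) ((x + 1)^-1) => a b c; lra.
have -> : x^-1 - (x + 1)^-1 = (x * (x + 1))^-1.
  by field; rewrite !gt_eqF// addr_gt0.
rewrite lef_pV2 ?posrE; first by rewrite expr2 ler_wpM2r; lra.
  by rewrite exprn_gt0// addr_gt0.
by rewrite mulr_gt0// addr_gt0.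
Qed.

Variables (xi : nat -> Omega -> R) (C : R).
Hypothesis mxi : forall s, measurable_fun setT (xi s).
Hypothesis xiC : forall s w, `|xi s w| <= C.
Hypothesis xi_orth : forall s t, (s < t)%N -> \int[P]_w (xi s w * xi t w) = 0.

Let S t w := \sum_(0 <= s < t) xi s w.

Let bxi s : bounded_mfun setT (xi s).
Proof. by split => //; exists C => w _. Qed.

Let bS t : bounded_mfun setT (S t).
Proof. exact: bounded_mfun_sum. Qed.

Let C0 : 0 <= C.
Proof. by have := xiC 0 point; exact: le_trans. Qed.

Let Sint t : \int[P]_w (S t w * xi t w) = 0.
Proof.
suff H u : (u <= t)%N -> \int[P]_w (S u w * xi t w) = 0 by exact: H.
elim: u => [_|u IH ut].
  rewrite /S; under eq_Rintegral do rewrite big_geq// mul0r.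
  by rewrite Rintegral_cst// mul0r.
rewrite /S; under eq_Rintegral do rewrite big_nat_recr//= mulrDl.
rewrite RintegralD//; last 2 first.
- by apply: prob_bounded_integrable; apply: bounded_mfunM; [exact: bS|].
- by apply: prob_bounded_integrable; exact: bounded_mfunM.
by rewrite IH ?(ltnW ut)// xi_orth// addr0.
Qed.

(** The cross terms integrate to 0, so the second moment grows linearly instead of quadratically. *)
Lemma orthogonal_sum_sqr t : \int[P]_w (S t w ^+ 2) <= t%:R * C ^+ 2.
Proof.
elim: t => [|t IH].
  rewrite /S; under eq_Rintegral do rewrite big_geq// expr0n.
  by rewrite Rintegral_cst// mul0r mul0r.
have bS2 : bounded_mfun setT (fun w => S t w ^+ 2).
  exact: bounded_mfun_sqr.
have bSx : bounded_mfun setT (fun w => 2 * (S t w * xi t w)).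
  by apply: bounded_mfunZ; exact: bounded_mfunM.
have bx2 : bounded_mfun setT (fun w => xi t w ^+ 2).
  exact: bounded_mfun_sqr.
have -> : (fun w => S t.+1 w ^+ 2) =
    (fun w => S t w ^+ 2 + (2 * (S t w * xi t w) + xi t w ^+ 2)).
  by apply/funext => w; rewrite /S big_nat_recr//=; ring.
rewrite RintegralD//; last 2 first.
- exact: prob_bounded_integrable.
- by apply: prob_bounded_integrable; exact: bounded_mfunD.
rewrite RintegralD//; [|exact: prob_bounded_integrable..].
rewrite RintegralZl//; last first.
  by apply: prob_bounded_integrable; exact: bounded_mfunM.
rewrite Sint mulr0 add0r -natr1 mulrDl mul1r lerD//.
apply: (@le_trans _ _ (\int[P]_w (C ^+ 2))).
  apply: le_Rintegral => //; try exact: prob_bounded_integrable.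
    by apply: prob_bounded_integrable; exact: bounded_mfun_cst.
  by move=> w _; rewrite -real_normK ?num_real// lerXn2r ?nnegrE ?xiC.
by rewrite Rintegral_cst// [X in fine X]probability_setT mulr1.
Qed.

(* Along the squares the second moments are summable, so the averages vanish
   there almost surely; boundedness of the increments fills the gaps. *)
Lemma orthogonal_strong_law :
  {ae P, forall w, (fun t => t%:R^-1 * S t w) @ \oo --> (0 : R)}.
Proof.
pose Z n w := (S (n.+1 ^ 2) w / n.+1%:R ^+ 2) ^+ 2.
have bZ n : bounded_mfun setT (Z n).
  have -> : Z n = fun w => (S (n.+1 ^ 2) w * S (n.+1 ^ 2) w) * (n.+1%:R ^+ 2) ^- 2.
    by apply/funext => w; rewrite /Z expr_div_n expr2.
  by apply: bounded_mfunM; [exact: bounded_mfunM|exact: bounded_mfun_cst].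
have Z0 n w : 0 <= Z n w by rewrite sqr_ge0.
have intZ n : (\int[P]_w (Z n w)%:E <= (C ^+ 2 * n.+1%:R ^- 2)%:E)%E.
  rewrite -[X in (X <= _)%E]fineK; last first.
    exact: integrable_fin_num (prob_bounded_integrable (bZ n)).
  rewrite lee_fin -/(Rintegral P setT (Z n)).
  have -> : Rintegral P setT (Z n) =
      (\int[P]_w (S (n.+1 ^ 2) w ^+ 2)) * (n.+1%:R ^+ 2) ^- 2.
    rewrite -RintegralZr//.
      by apply: eq_Rintegral => w _; rewrite /Z expr_div_n.
    by apply: prob_bounded_integrable; exact: bounded_mfun_sqr.
  have n0 : 0 < n.+1%:R ^+ 2 :> R by rewrite exprn_gt0.
  apply: (@le_trans _ _ ((n.+1 ^ 2)%:R * C ^+ 2 * (n.+1%:R ^+ 2) ^- 2)).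
    by rewrite ler_wpM2r ?invr_ge0 ?exprn_ge0// orthogonal_sum_sqr.
  rewrite natrX le_eqVlt; apply/orP; left; apply/eqP.
  by field; rewrite gt_eqF.
have sumZ : (\int[P]_w (\sum_(0 <= n <oo) (Z n w)%:E) < +oo)%E.
  rewrite integral_nneseries//; last 2 first.
  - by move=> n; apply/measurable_EFinP; case: (bZ n).
  - by move=> n w _; rewrite lee_fin.
  apply: (@le_lt_trans _ _ (C ^+ 2 * 2)%:E); last by rewrite ltry.
  apply: lime_le.
    by apply: is_cvg_nneseries => n _ _; apply: integral_ge0 => w _; rewrite lee_fin.
  apply: nearW => m.
  apply: (@le_trans _ _ (\sum_(0 <= n < m) (C ^+ 2 * n.+1%:R ^- 2)%:E)%E).
    by apply: lee_sum => n _; exact: intZ.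
  rewrite sumEFin lee_fin -mulr_sumr ler_wpM2l ?exprn_ge0//.
  exact: sum_inv_sqr_le.
have iZ : P.-integrable setT (fun w => \sum_(0 <= n <oo) (Z n w)%:E)%E.
  apply/integrableP; split.
    by apply: (ge0_emeasurable_sum (P := predT)) => [n x _ _|n _]; [rewrite lee_fin|apply/measurable_EFinP; case: (bZ n)].
  rewrite (eq_integral (fun w => \sum_(0 <= n <oo) (Z n w)%:E)%E)// => w _.
  by rewrite gee0_abs//; apply: nneseries_ge0 => n _ _; rewrite lee_fin.
(* A series with finite expectation is almost surely finite, so its general term tends to 0. *)
have := integrable_ae measurableT iZ.
apply: filterS => w /(_ I) Zfin.
have Zcvg : (fun n => Z n w) @ \oo --> (0 : R).
  apply: cvg_series_cvg_0; apply: nnseries_is_cvg => //.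
  by rewrite ltey_eq Zfin.
have {}Zcvg : forall eps, 0 < eps -> exists n0, forall n, (n0 <= n)%N ->
    `|S (n.+1 ^ 2) w / n.+1%:R ^+ 2| <= eps.
  move=> eps eps0; have e2 : 0 < eps ^+ 2 by rewrite exprn_gt0.
  have /cvgr0Pnorm_lt/(_ _ e2)[n0 _ n0P] := Zcvg.
  exists n0 => n n0n; have := n0P n n0n; rewrite /= ger0_norm ?Z0// /Z => /ltW.
  by rewrite -(real_normK (num_real (_ / _))) ler_pXn2r ?nnegrE// ltW.
apply/cvgr0Pnorm_le => eps eps0.
have e2 : 0 < eps / 2 by rewrite divr_gt0.
have [n0 n0P] := Zcvg _ e2.
(* Between two consecutive squares at most [6 * n.+1] increments are added, each at most [C]; for
   [n] beyond [m0] they weigh at most [eps / 2 * n.+1 ^ 2]. *)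
have [m0 m0P] : exists m0 : nat, 6 * C / (eps / 2) <= m0%:R.
  by exists (Num.truncn (6 * C / (eps / 2))).+1; rewrite ltW// truncnS_gt.
near=> t.
have [n [nt tn]] : exists n, (n.+1 ^ 2 <= t)%N /\ (t < n.+2 ^ 2)%N.
  have t1 : (0 < t)%N by near: t; exact: nbhs_infty_gt.
  have : exists n, (n.+1 ^ 2 <= t)%N by exists 0%N; rewrite exp1n.
  move=> ex; have bd n : (n.+1 ^ 2 <= t)%N -> (n <= t)%N.
    by apply: leq_trans; rewrite expnS expn1 mulSn mulnS; rewrite addSn leqW// leq_addr.
  exists (ex_maxn ex bd); case: ex_maxnP => i it imax; split=> //.
  by rewrite ltnNge; apply/negP => /imax; rewrite ltnn.
have ntbig : (maxn n0 m0 <= n)%N.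
  have : ((maxn n0 m0).+1 ^ 2 <= t)%N by near: t; exact: nbhs_infty_ge.
  by move=> /leq_ltn_trans/(_ tn); rewrite ltn_exp2r.
have {ntbig}/andP[n0n m0n] : (n0 <= n)%N && (m0 <= n)%N by rewrite -geq_max.
have Sgap u v : (u <= v)%N -> `|S v w - S u w| <= (v - u)%:R * C.
  move=> uv; rewrite /S (big_cat_nat (leq0n u) uv)/= addrAC subrr add0r.
  apply: (le_trans (ler_norm_sum _ _ _)).
  apply: (@le_trans _ _ (\sum_(u <= i < v) C)); first exact: ler_sum.
  by rewrite big_const_nat iter_addr addr0 mulr_natl.
have x0 : 0 < n.+1%:R ^+ 2 :> R by rewrite exprn_gt0.
have tR0 : 0 < t%:R :> R.
  by rewrite ltr0n (leq_trans _ nt)// expn_gt0.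
have xt : n.+1%:R ^+ 2 <= t%:R :> R by rewrite -natrX ler_nat.
rewrite normrM ger0_norm ?invr_ge0 ?(ltW tR0)//.
rewrite mulrC ler_pdivrMr//.
apply: (@le_trans _ _ (`|S (n.+1 ^ 2)%N w| + `|S t w - S (n.+1 ^ 2)%N w|)).
  by rewrite -{1}(subrK (S (n.+1 ^ 2)%N w) (S t w)) addrC ler_normD.
have h1 : `|S (n.+1 ^ 2)%N w| <= eps / 2 * t%:R.
  have := n0P n n0n; rewrite normrM [ `|_^-1|]ger0_norm ?invr_ge0 ?(ltW x0)//.
  rewrite ler_pdivrMr// => /le_trans; apply.
  by rewrite ler_wpM2l// ltW.
have h2 : `|S t w - S (n.+1 ^ 2)%N w| <= eps / 2 * t%:R.
  apply: (le_trans (Sgap _ _ nt)).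
  have : (t - n.+1 ^ 2)%:R <= 6 * n.+1%:R :> R.
    rewrite -natrM ler_nat leq_subLR (leq_trans (ltnW tn))//.
    by rewrite !expnS !expn0 !muln1 -[n.+2]addn1 mulnDl mulnDr; lia.
  move=> /(ler_wpM2r C0)/le_trans; apply.
  apply: (@le_trans _ _ (eps / 2 * n.+1%:R ^+ 2)); last by rewrite ler_wpM2l// ltW.
  rewrite mulrAC expr2 mulrA ler_wpM2r//.
  move: m0P; rewrite ler_pdivrMr// => /le_trans; apply.
  by rewrite mulrC ler_wpM2l ?(ltW e2)// ler_nat ltnW.
by rewrite [eps in X in _ <= X]splitr mulrDl lerD.
Unshelve. all: by end_near. Qed.

End StrongLaw.

(** * Iterated integrals *)

Section ProductsOfDomains.
Context d1 d2 (T1 : measurableType d1) (T2 : measurableType d2) (R : realType).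

(** The measure is finite on [X] but arbitrary elsewhere; passing to the restricted finite measure
    gives access to the theorems of Tonelli and Fubini. *)
Lemma integral_mfrestr d (T : measurableType d) (mu : {measure set T -> \bar R})
    (X : set T) (mX : measurable X) (muX : (mu X < +oo)%E) (f : T -> \bar R) :
  (\int[mfrestr mX muX]_x (f \_ X) x = \int[mu]_(x in X) f x)%E.
Proof.
rewrite -integral_mkcond; apply: eq_measure_integral => A mA AX.
by rewrite /= /mfrestr /mrestr setIidl.
Qed.

(** By Tonelli the integrals of the positive and negative parts are measurable in [x] as extended
    reals, hence so is [fine] of their difference, whatever its value where the integral is
    infinite. *)
Lemma measurable_Rintegral_param (mu : {measure set T2 -> \bar R}) (D : set T1)
    (X : set T2) (f : T1 -> T2 -> R) : measurable D -> measurable X ->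
  (mu X < +oo)%E -> measurable_fun (D `*` X) (fun p => f p.1 p.2) ->
  measurable_fun D (fun x => \int[mu]_(y in X) f x y).
Proof.
move=> mD mX muX mf; pose nu := mfrestr mX muX.
pose g : T1 * T2 -> R := (fun p => f p.1 p.2) \_ (D `*` X).
have mg : measurable_fun setT g.
  by apply/(measurable_restrictT _ _).1 => //; exact: measurableX.
have mpos : measurable_fun setT (fun p => ((EFin \o g)^\+ p)%E).
  by apply: measurable_funepos; exact/measurable_EFinP.
have mneg : measurable_fun setT (fun p => ((EFin \o g)^\- p)%E).
  by apply: measurable_funeneg; exact/measurable_EFinP.
have /= mF := measurable_fun_fubini_tonelli_F (m2 := nu) _ mpos (fun p => funepos_ge0 _ p).
have /= mG := measurable_fun_fubini_tonelli_F (m2 := nu) _ mneg (fun p => funeneg_ge0 _ p).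
have mH := measurableT_comp (@fine_measurable R setT measurableT) (emeasurable_funB mF mG).
apply: (eq_measurable_fun (fun x => fine (\int[nu]_y ((EFin \o g)^\+ (x, y)) -
    \int[nu]_y ((EFin \o g)^\- (x, y)))%E)); last exact: measurable_funTS mH.
move=> x /set_mem Dx.
have inE' y : ((x, y) \in D `*` X) = (y \in X).
  by apply/idP/idP => /set_mem; [move=> [_ /mem_set]|move=> Xy; exact/mem_set].
rewrite /Rintegral; congr fine.
rewrite -(@integral_mfrestr _ _ mu X mX muX) [in RHS]integralE; congr (_ - _)%E.
  apply: eq_integral => y _; rewrite !funeposE /= /g !patchE.
  by rewrite inE'; case: ifP.
apply: eq_integral => y _; rewrite !funenegE /= /g !patchE.
by rewrite inE'; case: ifP.
Qed.

End ProductsOfDomains.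

Section IteratedIntegral.
Context d1 d2 (T1 : measurableType d1) (T2 : measurableType d2) (R : realType).

Lemma iterated_integral_mfrestr (mu1 : {measure set T1 -> \bar R})
    (mu2 : {measure set T2 -> \bar R}) (X1 : set T1) (X2 : set T2)
    (mX1 : measurable X1) (mX2 : measurable X2)
    (mu1X : (mu1 X1 < +oo)%E) (mu2X : (mu2 X2 < +oo)%E) (f : T1 -> T2 -> R) :
  (forall x, X1 x -> mu2.-integrable X2 (EFin \o f x)) ->
  \int[mu1]_(x in X1) \int[mu2]_(y in X2) f x y =
  fine (\int[mfrestr mX1 mu1X]_x \int[mfrestr mX2 mu2X]_y
    (if (x \in X1) && (y \in X2) then f x y else 0)%:E)%E.
Proof.
move=> fint; rewrite /Rintegral; congr fine.
rewrite -(@integral_mfrestr R _ _ mu1 X1 mX1 mu1X); apply: eq_integral => x _.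
rewrite patchE; case: ifPn => /= [/set_mem x1|_]; last by rewrite integral0.
rewrite fineK; last exact: integrable_fin_num (fint x x1).
rewrite -(@integral_mfrestr R _ _ mu2 X2 mX2 mu2X); apply: eq_integral => y _.
by rewrite patchE; case: ifPn.
Qed.

End IteratedIntegral.

Section FubiniOnDomains.
Context d1 d2 (T1 : measurableType d1) (T2 : measurableType d2) (R : realType).

(** A dominating function of product form reduces integrability on the product space to that of the
    two factors. *)
Lemma Rintegral_fubini_in (mu1 : {measure set T1 -> \bar R})
    (mu2 : {measure set T2 -> \bar R}) (X1 : set T1) (X2 : set T2)
    (f : T1 -> T2 -> R) (g1 : T1 -> R) (g2 : T2 -> R) :
  measurable X1 -> measurable X2 -> (mu1 X1 < +oo)%E -> (mu2 X2 < +oo)%E ->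
  measurable_fun (X1 `*` X2) (fun p => f p.1 p.2) ->
  mu1.-integrable X1 (EFin \o g1) -> mu2.-integrable X2 (EFin \o g2) ->
  (forall x y, X1 x -> X2 y -> `|f x y| <= g1 x * g2 y) ->
  \int[mu1]_(x in X1) \int[mu2]_(y in X2) f x y =
  \int[mu2]_(y in X2) \int[mu1]_(x in X1) f x y.
Proof.
move=> mX1 mX2 mu1X mu2X mf ig1 ig2 fg.
have m1 x : X1 x -> measurable_fun X2 (f x).
  move=> X1x; apply: (measurable_comp (measurableX mX1 mX2) _ mf (measurable_funTS (pair1_measurable x))).
  by move=> _ [y X2y <-].
have m2 y : X2 y -> measurable_fun X1 (f^~ y).
  move=> X2y; apply: (measurable_comp (measurableX mX1 mX2) _ mf (measurable_funTS (pair2_measurable y))).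
  by move=> _ [x X1x <-].
have if1 x : X1 x -> mu2.-integrable X2 (EFin \o f x).
  move=> X1x; apply: (@le_integrable _ _ _ _ _ mX2 _ (EFin \o (fun y => g1 x * g2 y))).
  - by apply/measurable_EFinP; exact: m1.
  - by move=> y X2y; rewrite /= lee_fin (le_trans (fg _ _ X1x X2y))// ler_norm.
  - by rewrite (_ : EFin \o _ = (fun y => (g1 x)%:E * (EFin \o g2) y)%E)//; exact: integrableZl.
have if2 y : X2 y -> mu1.-integrable X1 (EFin \o f^~ y).
  move=> X2y; apply: (@le_integrable _ _ _ _ _ mX1 _ (EFin \o (fun x => g2 y * g1 x))).
  - by apply/measurable_EFinP; exact: m2.
  - by move=> x X1x; rewrite /= lee_fin (le_trans (fg _ _ X1x X2y))// mulrC ler_norm.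
  - by rewrite (_ : EFin \o _ = (fun x => (g2 y)%:E * (EFin \o g1) x)%E)//; exact: integrableZl.
rewrite (iterated_integral_mfrestr mX1 mX2 mu1X mu2X if1).
rewrite (iterated_integral_mfrestr mX2 mX1 mu2X mu1X if2); congr fine.
pose g p := if (p.1 \in X1) && (p.2 \in X2) then f p.1 p.2 else 0.
have mg : measurable_fun setT g.
  rewrite (_ : g = (fun p => f p.1 p.2) \_ (X1 `*` X2)).
    by apply/(measurable_restrictT _ _).1 => //; exact: measurableX.
  apply/funext => -[x y]; rewrite /g patchE/=; congr (if _ then _ else _).
  by apply/andP/idP => [[/set_mem ? /set_mem ?]|/set_mem[/= ? ?]]; [exact/mem_set|split; exact/mem_set].
have gint : ((mfrestr mX1 mu1X) \x (mfrestr mX2 mu2X))%E.-integrable setT (EFin \o g).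
  apply/integrable12ltyP; first exact/measurable_EFinP.
  pose h x := \int[mu2]_(y in X2) `|f x y|.
  have ih : mu1.-integrable X1 (EFin \o h).
    apply: (@le_integrable _ _ _ _ _ mX1 _
      (EFin \o (fun x => \int[mu2]_(y in X2) `|g2 y| * g1 x))).
    - apply/measurable_EFinP; apply: measurable_Rintegral_param => //.
      exact: measurableT_comp.
    - move=> x X1x; rewrite /= lee_fin ger0_norm ?Rintegral_ge0// normrM.
      rewrite ger0_norm ?Rintegral_ge0// -RintegralZr//; last exact: integrable_norm.
      apply: le_Rintegral => //.
      + exact: integrable_norm (if1 x X1x).
      + rewrite (_ : EFin \o _ = (fun y => (`|g1 x|%R)%:E * (EFin \o (fun z => `|g2 z|%R)) y)%E).
          by apply: integrableZl => //; exact: integrable_norm.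
        by apply/funext => y /=; rewrite -EFinM mulrC.
      + move=> y X2y; rewrite (le_trans (fg _ _ X1x X2y))//.
        by rewrite (le_trans (ler_norm _))// normrM mulrC.
    - rewrite (_ : EFin \o _ = (fun x => (\int[mu2]_(y in X2) `|g2 y|)%R%:E * (EFin \o g1) x)%E)//.
      exact: integrableZl.
  have /integrableP[_] := ih; rewrite -(@integral_mfrestr R _ _ mu1 X1 mX1 mu1X).
  apply: le_lt_trans; rewrite le_eqVlt; apply/orP; left; apply/eqP.
  apply: eq_integral => x _; rewrite patchE; case: ifPn => [/set_mem X1x|/negbTE x1].
    rewrite /= ger0_norm ?Rintegral_ge0// /h /Rintegral fineK.
      rewrite -(@integral_mfrestr R _ _ mu2 X2 mX2 mu2X); apply: eq_integral => y _.
      by rewrite patchE /g/= (mem_set X1x)/=; case: ifPn => //=; rewrite normr0.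
    by apply: integrable_fin_num => //; exact: integrable_norm (if1 x X1x).
  rewrite (eq_integral (fun=> 0%E)) ?integral0// => y _.
  by rewrite /g/= x1/= normr0.
rewrite (Fubini gint); apply: eq_integral => y _; apply: eq_integral => x _.
by rewrite /g/= andbC.
Qed.

End FubiniOnDomains.

(** * Conditional laws *)

(** The range is cut into slices of height [eps], starting from [- K]; [H i] is the preimage of
    slice [i] and [c i] its lower end. *)
Lemma bounded_mfun_approx d (T : measurableType d) (R : realType) (f : T -> R)
    (eps : R) : bounded_mfun setT f -> 0 < eps ->
  exists m (c : 'I_m -> R) (H : 'I_m -> set T), (forall i, measurable (H i)) /\
    forall x, `|f x - \sum_i c i * \1_(H i) x| <= eps.
Proof.
move=> bf eps0; have [K K0 fK] := bounded_mfun_ge0 bf; case: bf => mf _.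
pose m := (Num.truncn (2 * K / eps)).+1.
pose c (i : 'I_m) := - K + i%:R * eps.
pose H (i : 'I_m) := f @^-1` `[c i, c i + eps[%classic.
exists m, c, H; split.
  by move=> i; rewrite /H -[X in measurable X]setTI; exact: mf.
move=> x; have := fK x I; rewrite ler_norml => /andP[f1 f2].
have q0 : 0 <= (f x + K) / eps by rewrite divr_ge0 ?(ltW eps0)// -lerBlDr sub0r.
have /andP[j1 j2] := truncn_itv q0.
have jm : (Num.truncn ((f x + K) / eps) < m)%N.
  rewrite ltnS; apply: le_truncn; rewrite ler_pM2r ?invr_gt0//; lra.
set j := Num.truncn _ in j1 j2 jm.
have HjE (i : 'I_m) : \1_(H i) x = (i == Ordinal jm)%:R :> R.
  rewrite indicE; congr (_%:R); congr nat_of_bool; apply/idP/eqP.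
    move=> /set_mem; rewrite /H /= in_itv/= /c => /andP[ci1 ci2].
    apply/val_inj => /=; apply/eqP; rewrite eqn_leq -ltnS -[X in _ && X]ltnS.
    rewrite -(ltr_nat R) -[X in _ && X](ltr_nat R).
    have i1 : i%:R <= (f x + K) / eps by rewrite ler_pdivlMr//; lra.
    have i2 : (f x + K) / eps < i.+1%:R.
      by rewrite ltr_pdivrMr// -natr1 mulrDl mul1r; lra.
    by rewrite (le_lt_trans i1 j2) (le_lt_trans j1 i2).
  move=> ->; apply/mem_set; rewrite /H /= in_itv/= /c /=.
  move: j1; rewrite ler_pdivlMr// => j1.
  move: j2; rewrite ltr_pdivrMr// -natr1 mulrDl mul1r => j2.
  by apply/andP; split; lra.
rewrite (bigD1 (Ordinal jm))//= HjE eqxx mulr1 big1 ?addr0; last first.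
  by move=> i /negbTE ij; rewrite HjE ij mulr0.
move: j1; rewrite ler_pdivlMr// => j1.
move: j2; rewrite ltr_pdivrMr// -natr1 mulrDl mul1r => j2.
by rewrite /c/= ler_norml; apply/andP; split; lra.
Qed.

Lemma Rintegral_sum d (T : measurableType d) (R : realType)
    (mu : {measure set T -> \bar R}) (D : set T) (I : Type) (s : seq I)
    (h : I -> T -> R) : measurable D ->
  (forall i, mu.-integrable D (EFin \o h i)) ->
  \int[mu]_(x in D) (\sum_(i <- s) h i x) = \sum_(i <- s) \int[mu]_(x in D) h i x.
Proof.
move=> mD ih; elim: s => [|i s IH].
  rewrite big_nil; under eq_Rintegral do rewrite big_nil.
  by rewrite Rintegral_cst// mul0r.
rewrite big_cons -IH -RintegralD//.
- by apply: eq_Rintegral => x _; rewrite big_cons.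
- rewrite (_ : EFin \o _ = (fun x => \sum_(j <- s) (h j x)%:E)%E).
    by apply: (integrable_sum mD) => j _; exact: ih.
  by apply/funext => x /=; rewrite sumEFin.
Qed.

Lemma Rintegral_weighted_norm_le d (T : measurableType d) (R : realType)
    (mu : {measure set T -> \bar R}) (X : set T) (p g : T -> R) (C : R) :
  measurable X -> mu.-integrable X (EFin \o p) -> (forall y, X y -> 0 <= p y) ->
  \int[mu]_(y in X) p y <= 1 -> bounded_mfun X g -> 0 <= C ->
  (forall y, X y -> `|g y| <= C) -> `|\int[mu]_(y in X) (g y * p y)| <= C.
Proof.
move=> mX ip p0 p1 bg C0 gC; have ig := integrable_mulbounded mX bg ip.
apply: (le_trans (le_normr_Rintegral mX ig)).
apply: (@le_trans _ _ (\int[mu]_(y in X) (C * p y))).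
  apply: le_Rintegral => //; first exact: integrable_norm.
    by apply: integrable_mulbounded => //; exact: bounded_mfun_cst.
  by move=> y Xy; rewrite normrM [ `|p y|]ger0_norm ?p0// ler_wpM2r ?p0 ?gC.
by rewrite RintegralZl// -[X in _ <= X]mulr1 ler_wpM2l.
Qed.

Section Conditioning.
Context d (Omega : measurableType d) (R : realType) (P : probability Omega R).

Lemma Rintegral_indicM (H : set Omega) (f : Omega -> R) :
  \int[P]_w (\1_H w * f w) = \int[P]_(w in H) f w.
Proof.
rewrite [RHS]Rintegral_mkcond; apply: eq_Rintegral => w _.
by rewrite patchE indicE; case: ifP => _; rewrite ?mul1r ?mul0r.
Qed.

Lemma le_norm_Rintegral_bounded (f : Omega -> R) (C : R) : measurable_fun setT f ->
  (forall w, `|f w| <= C) -> `|\int[P]_w f w| <= C.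
Proof.
move=> mf fC; have bf : bounded_mfun setT f by split => //; exists C => w _.
apply: (le_trans (le_normr_Rintegral measurableT (prob_bounded_integrable P bf))).
apply: (@le_trans _ _ (\int[P]_w C)).
  apply: le_Rintegral => //.
  - by apply: integrable_norm => //; exact: prob_bounded_integrable.
  - by apply: prob_bounded_integrable; exact: bounded_mfun_cst.
by rewrite Rintegral_cst// [X in fine X]probability_setT mulr1.
Qed.

Lemma Rintegral_sum_bounded (I : Type) (s : seq I) (h : I -> Omega -> R) :
  (forall i, bounded_mfun setT (h i)) ->
  \int[P]_w (\sum_(i <- s) h i w) = \sum_(i <- s) \int[P]_w h i w.
Proof.
by move=> bh; apply: Rintegral_sum => // i; exact: prob_bounded_integrable.
Qed.

(** This replaces the pull-out property of conditional expectations: a function with zero integral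
    on every event of [<<s G>>] is orthogonal to indicators of such events, then to simple
    functions, then to their uniform limits [Z]. *)
Lemma Rintegral_orthogonal (G : set (set Omega)) (Z xi : Omega -> R) :
  (forall H, <<s G >> H -> measurable H) ->
  bounded_mfun setT (Z : g_sigma_algebraType G -> R) ->
  bounded_mfun setT xi ->
  (forall H, <<s G >> H -> \int[P]_(w in H) xi w = 0) ->
  \int[P]_w (Z w * xi w) = 0.
Proof.
move=> sG bZ bxi xi0; have [C C0 xiC] := bounded_mfun_ge0 bxi.
apply/eqP; rewrite -normr_le0; apply/ler_addgt0Pl => eps eps0; rewrite addr0.
have C1 : 0 < C + 1 by rewrite ltr_wpDl.
have [m [c [H [mH ZH]]]] := bounded_mfun_approx bZ (divr_gt0 eps0 C1).
have mHO i : measurable (H i : set Omega) by apply: sG; exact: mH.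
have bZO : bounded_mfun setT Z.
  case: bZ => mZ [K ZK]; split; last by exists K.
  move=> _ B mB; rewrite setTI; apply: sG; rewrite -[X in <<s _ >> X]setTI.
  exact: (mZ measurableT B mB).
have bH i : bounded_mfun setT (\1_(H i) : Omega -> R) by exact: bounded_mfun_indic.
have bZm : bounded_mfun setT (fun w : Omega => \sum_i c i * \1_(H i) w).
  by apply: bounded_mfun_sum => i _; exact: bounded_mfunZ.
have -> : \int[P]_w (Z w * xi w) =
    \int[P]_w ((Z w - \sum_i c i * \1_(H i) w) * xi w) +
    \int[P]_w (\sum_i c i * (\1_(H i) w * xi w)).
  rewrite -RintegralD//.
  - apply: eq_Rintegral => w _; rewrite mulrBl mulr_suml.
    rewrite (eq_bigr (fun i => c i * (\1_(H i) w * xi w))) ?subrK//.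
    by move=> i _; rewrite mulrA.
  - apply: prob_bounded_integrable; apply: bounded_mfunM => //.
    exact: bounded_mfunB.
  - apply: prob_bounded_integrable; apply: bounded_mfun_sum => i _.
    by apply: bounded_mfunZ; exact: bounded_mfunM.
rewrite Rintegral_sum_bounded; last first.
  by move=> i; apply: bounded_mfunZ; exact: bounded_mfunM.
rewrite big1 ?addr0; last first.
  move=> i _; rewrite RintegralZl//; last first.
    by apply: prob_bounded_integrable; exact: bounded_mfunM.
  by rewrite Rintegral_indicM xi0 ?mulr0//; exact: mH.
apply: le_norm_Rintegral_bounded.
  by have [] : bounded_mfun setT (fun w => (Z w - \sum_i c i * \1_(H i) w) * xi w)
    by apply: bounded_mfunM => //; exact: bounded_mfunB.
move=> w; rewrite normrM; apply: (@le_trans _ _ (eps / (C + 1) * C)).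
  by apply: ler_pM => //; exact: xiC.
rewrite -mulrA ger_pMr// mulrC ler_pdivrMr//; lra.
Qed.

Context d' (T : measurableType d') (mu : {measure set T -> \bar R}) (X : set T).
Hypotheses (mX : measurable X) (muX : (mu X < +oo)%E).
Variables (p : Omega -> T -> R) (Y : Omega -> T) (H : set Omega).
Hypothesis mp : measurable_fun (setT `*` X) (fun z => p z.1 z.2).
Hypothesis p0 : forall w y, X y -> 0 <= p w y.
Hypothesis ip : forall w, mu.-integrable X (EFin \o p w).
Hypothesis p1 : forall w, \int[mu]_(y in X) p w y <= 1.
Hypotheses (mH : measurable H) (mY : measurable_fun setT Y) (YX : forall w, X (Y w)).
Hypothesis law : forall B, measurable B -> P (H `&` Y @^-1` B) =
  (\int[P]_(w in H) \int[mu]_(y in X `&` B) (p w y)%:E)%E.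

Lemma bounded_mfun_density (g : T -> R) : bounded_mfun X g ->
  bounded_mfun setT (fun w => \int[mu]_(y in X) (g y * p w y)).
Proof.
move=> bg; split; last first.
  have [C C0 gC] := bounded_mfun_ge0 bg.
  by exists C => w _; apply: Rintegral_weighted_norm_le => //; exact: p0.
apply: measurable_Rintegral_param => //; apply: measurable_funM => //.
apply: (measurable_comp mX _ bg.1) => //; last exact: measurable_funTS.
by move=> _ [[w y] [_ /= Xy] <-].
Qed.

(** The hypothesis [law] is the case of indicators. Linearity extends it to simple functions, and a
    uniform error of [eps / 2] on [g] changes each of the two terms of [D] by at most [eps / 2]. *)
Lemma Rintegral_conditional_law (g : T -> R) : bounded_mfun X g ->
  \int[P]_(w in H) (g (Y w) - \int[mu]_(y in X) (g y * p w y)) = 0.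
Proof.
move=> bg; pose D (h : T -> R) w := h (Y w) - \int[mu]_(y in X) (h y * p w y).
have bD h : bounded_mfun X h -> bounded_mfun setT (D h).
  move=> bh; apply: bounded_mfunB; last exact: bounded_mfun_density.
  case: bh => mh [K hK]; split; last by exists K => w _; exact: hK.
  by apply: (measurable_comp mX _ mh mY) => _ [w _ <-].
have Dindic B : measurable B -> \int[P]_(w in H) (D \1_B w) = 0.
  move=> mB; have bB : bounded_mfun X (\1_B : T -> R) by exact: bounded_mfun_indic.
  rewrite RintegralB//; last 2 first.
  - apply: integrableS (@prob_bounded_integrable _ _ _ P _ _) => //.
    split; last by exists 1 => w _; rewrite indicE ger0_norm ?ler0n// lern1 leq_b1.
    have := measurableT_comp (@measurable_indic _ _ R setT B mB) mY.
    by apply: eq_measurable_fun.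
  - apply: integrableS (@prob_bounded_integrable _ _ _ P _ _) => //.
    exact: bounded_mfun_density.
  apply/eqP; rewrite subr_eq0; apply/eqP.
  transitivity (fine (P (H `&` Y @^-1` B))).
    rewrite -(setIC (Y @^-1` B)) -integral_indic//.
    by rewrite -[X in measurable X]setTI; exact: mY.
  rewrite law//; congr fine; apply: eq_integral => w _.
  rewrite /Rintegral fineK; last first.
    by apply: integrable_fin_num => //; exact: integrable_mulbounded.
  rewrite integral_mkcondr; apply: eq_integral => y _.
  by rewrite patchE indicE; case: ifP => _; rewrite ?mul1r ?mul0r.
(* [g] is controlled on [X] only, so its extension by 0 is approximated; nothing changes along [Y],
   whose values lie in [X]. *)
have bgX : bounded_mfun setT (g \_ X).
  case: bg => mg [K gK]; split; first exact/(measurable_restrictT _ _).1.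
  exists `|K| => y _; rewrite patchE; case: ifPn => [/set_mem Xy|]; last by rewrite normr0.
  by rewrite (le_trans (gK y Xy))// ler_norm.
apply/eqP; rewrite -normr_le0; apply/ler_addgt0Pl => eps eps0; rewrite addr0.
have e2 : 0 < eps / 2 by rewrite divr_gt0.
have [m [c [B [mB gB]]]] := bounded_mfun_approx bgX e2.
pose gm y := \sum_i c i * \1_(B i) y.
have bBi i : bounded_mfun X (\1_(B i) : T -> R) by exact: bounded_mfun_indic.
have bgm : bounded_mfun X gm.
  by apply: bounded_mfun_sum => i _; exact: bounded_mfunZ.
have DE w : D g w = D (fun y => g y - gm y) w + \sum_i c i * D (\1_(B i)) w.
  have -> : \sum_i c i * D (\1_(B i)) w = D gm w.
    under eq_bigr do rewrite mulrBr; rewrite sumrB; congr (_ - _).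
    under eq_bigr => i _.
      rewrite -RintegralZl//; last exact: integrable_mulbounded.
      over.
    rewrite -Rintegral_sum//; last first.
      move=> i; apply: integrable_mulbounded => //; first exact: bounded_mfun_cst.
      exact: integrable_mulbounded.
    apply: eq_Rintegral => y _.
    by rewrite /gm mulr_suml; apply: eq_bigr => i _; rewrite mulrA.
  rewrite /D; have -> : \int[mu]_(y in X) ((g y - gm y) * p w y) =
      \int[mu]_(y in X) (g y * p w y) - \int[mu]_(y in X) (gm y * p w y).
    rewrite -RintegralB//; last 2 first.
    - exact: integrable_mulbounded.
    - exact: integrable_mulbounded.
    by apply: eq_Rintegral => y _; rewrite mulrBl.
  by ring.
rewrite -Rintegral_indicM.
have bH : bounded_mfun setT (\1_H : Omega -> R) by exact: bounded_mfun_indic.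
have bDg : bounded_mfun setT (fun w => \1_H w * D (fun y => g y - gm y) w).
  by apply: bounded_mfunM => //; apply: bD; exact: bounded_mfunB.
have -> : \int[P]_w (\1_H w * D g w) = \int[P]_w (\1_H w * D (fun y => g y - gm y) w)
    + \int[P]_w (\sum_i c i * (\1_H w * D (\1_(B i)) w)).
  rewrite -RintegralD//; last 2 first.
  - exact: prob_bounded_integrable.
  - apply: prob_bounded_integrable; apply: bounded_mfun_sum => i _.
    by apply: bounded_mfunZ; apply: bounded_mfunM => //; exact: bD.
  apply: eq_Rintegral => w _; rewrite DE mulrDr; congr (_ + _).
  by rewrite mulr_sumr; apply: eq_bigr => i _; rewrite mulrCA.
rewrite Rintegral_sum_bounded; last first.
  by move=> i; apply: bounded_mfunZ; apply: bounded_mfunM => //; exact: bD.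
rewrite big1 ?addr0; last first.
  move=> i _; rewrite RintegralZl//; last first.
    by apply: prob_bounded_integrable; apply: bounded_mfunM => //; exact: bD.
  by rewrite Rintegral_indicM Dindic ?mulr0.
apply: le_norm_Rintegral_bounded; first by case: bDg.
move=> w; rewrite normrM -[X in _ <= X]mul1r; apply: ler_pM => //.
  by rewrite indicE ger0_norm ?ler0n// lern1 leq_b1.
have ge y : X y -> `|g y - gm y| <= eps / 2.
  by move=> Xy; have := gB y; rewrite patchE (mem_set Xy).
rewrite /D (le_trans (ler_normB _ _))// [X in _ <= X]splitr lerD//.
  exact: ge.
apply: Rintegral_weighted_norm_le => //; [exact: p0|exact: bounded_mfunB|exact: ltW].
Qed.

End Conditioning.

(** * Densities and finite-dimensional spaces of functions *)

(** The factors are exchanged one at a time. As [C] is at least 1, the power can be taken over the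
    whole list even if only some indices satisfy [P]. *)
Lemma prod_diff_le (R : realType) (I : Type) (s : seq I) (P : pred I) (a b : I -> R)
    (C : R) : 1 <= C -> (forall i, 0 <= a i <= C) -> (forall i, 0 <= b i <= C) ->
  `|\prod_(i <- s | P i) a i - \prod_(i <- s | P i) b i| <=
    C ^+ size s * \sum_(i <- s | P i) `|a i - b i|.
Proof.
move=> C1 aC bC; have C0 : 0 <= C by rewrite (le_trans _ C1).
elim: s => [|i s IH]; first by rewrite !big_nil subrr normr0 mulr0.
rewrite !big_cons /=; case: ifPn => Pi; last first.
  apply: (le_trans IH); rewrite exprS -mulrA ler_peMl// mulr_ge0 ?exprn_ge0//.
  by rewrite sumr_ge0.
have prodC : `|\prod_(j <- s | P j) a j| <= C ^+ size s.
  elim: s {IH} => [|j s IH]; first by rewrite big_nil normr1.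
  have /andP[aj0 ajC] := aC j.
  rewrite big_cons exprS; case: ifPn => _.
    by rewrite normrM ler_pM// ger0_norm.
  by rewrite (le_trans IH)// ler_peMl// exprn_ge0.
have -> : a i * \prod_(j <- s | P j) a j - b i * \prod_(j <- s | P j) b j =
    (a i - b i) * \prod_(j <- s | P j) a j +
    b i * (\prod_(j <- s | P j) a j - \prod_(j <- s | P j) b j) by ring.
apply: (le_trans (ler_normD _ _)); rewrite !normrM mulrDr lerD//.
  rewrite mulrC; apply: ler_wpM2r => //; apply: (le_trans prodC).
  by rewrite exprS ler_peMl// exprn_ge0.
have /andP[bi0 biC] := bC i.
by rewrite exprS -mulrA ler_pM// ger0_norm.
Qed.

Lemma sqr_sum_le (R : realType) (I : Type) (s : seq I) (a : I -> R) :
  (\sum_(i <- s) a i) ^+ 2 <= (size s)%:R * \sum_(i <- s) a i ^+ 2.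
Proof.
elim: s => [|i s IH]; first by rewrite !big_nil expr0n mul0r.
rewrite !big_cons /= -natr1; move: IH.
have : 0 <= \sum_(j <- s) a j ^+ 2 by rewrite sumr_ge0// => j _; rewrite sqr_ge0.
set S := \sum_(j <- s) a j; set Q := \sum_(j <- s) a j ^+ 2; set c := (size s)%:R.
have : 0 <= c by rewrite ler0n.
rewrite le_eqVlt => /predU1P[<-|c0] Q0 IH.
  have -> : S = 0.
    by apply/eqP; rewrite -sqrf_eq0 eq_le sqr_ge0 andbT (le_trans IH)// mul0r.
  by rewrite addr0 add0r mul1r lerDl.
have H : 2 * c * (a i * S) <= c * (c * a i ^+ 2 + Q).
  by have := sqr_ge0 (c * a i - S); move: IH; lra.
have : 2 * (a i * S) <= c * a i ^+ 2 + Q by rewrite -(ler_pM2l c0); move: H; lra.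
by move: IH; lra.
Qed.

Section Densities.
Context d (T : measurableType d) (R : realType) (mu : {measure set T -> \bar R}).
Variable X : set T.
Hypotheses (mX : measurable X) (muX : (mu X < +oo)%E).

Local Notation integrableX f := (mu.-integrable X (EFin \o f)).

Lemma integrableX_cM (c : R) (f : T -> R) : integrableX f -> integrableX (fun x => c * f x).
Proof. by apply: integrable_mulbounded => //; exact: bounded_mfun_cst. Qed.

Lemma integrableX_D (f g : T -> R) : integrableX f -> integrableX g ->
  integrableX (fun x => f x + g x).
Proof.
move=> intf intg; rewrite (_ : EFin \o _ = ((EFin \o f) \+ (EFin \o g))%E)//.
exact: integrableD.
Qed.

Lemma integrableX_B (f g : T -> R) : integrableX f -> integrableX g ->
  integrableX (fun x => f x - g x).
Proof.
move=> intf intg; rewrite (_ : EFin \o _ = ((EFin \o f) \- (EFin \o g))%E)//.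
exact: integrableB.
Qed.

Lemma integrableX_norm (f : T -> R) : integrableX f -> integrableX (fun x => `|f x|).
Proof. by move=> intf; exact: integrable_norm. Qed.

Lemma integrableX_sum (I : Type) (s : seq I) (P : pred I) (h : I -> T -> R) :
  (forall i, P i -> integrableX (h i)) ->
  integrableX (fun x => \sum_(i <- s | P i) h i x).
Proof.
move=> ih; rewrite (_ : EFin \o _ = (fun x => \sum_(i <- s | P i) (h i x)%:E)%E).
  by apply: (integrable_sum mX) => j /ih.
by apply/funext => x /=; rewrite sumEFin.
Qed.

Lemma ae_le_Rintegral (f1 f2 : T -> R) : integrableX f1 -> integrableX f2 ->
  (forall x, X x -> 0 <= f1 x) -> (forall x, X x -> 0 <= f2 x) ->
  {ae mu, forall x, X x -> f1 x <= f2 x} ->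
  \int[mu]_(x in X) f1 x <= \int[mu]_(x in X) f2 x.
Proof.
move=> i1 i2 f10 f20 f12; apply: fine_le; [exact: integrable_fin_num..|].
apply: ae_ge0_le_integral => //.
- exact: measurable_int i1.
- exact: measurable_int i2.
Qed.

(** The term |1/Z - 1/Z'| W integrates to |Z - Z'| / Z', so the constant contains only the second
    mass. This is essential later: [W] will be the random sampling weight, whose mass has no uniform
    lower bound, and [W'] the limiting one. *)
Lemma normalized_diff_le (W W' : T -> R) :
  integrableX W -> integrableX W' -> (forall y, X y -> 0 <= W y) ->
  0 < \int[mu]_(y in X) W y -> 0 < \int[mu]_(y in X) W' y ->
  \int[mu]_(y in X) `|W y / (\int[mu]_(z in X) W z) - W' y / (\int[mu]_(z in X) W' z)|
  <= 2 / (\int[mu]_(z in X) W' z) * \int[mu]_(y in X) `|W y - W' y|.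
Proof.
move=> iW iW' W0; set Z := \int[mu]_(z in X) W z; set Z' := \int[mu]_(z in X) W' z.
move=> Z0 Z'0; set J := \int[mu]_(y in X) `|W y - W' y|.
have iD : integrableX (fun y => W y - W' y) by exact: integrableX_B.
have JZ : `|Z - Z'| <= J by rewrite /Z /Z' -RintegralB//; exact: le_normr_Rintegral.
apply: (@le_trans _ _ (\int[mu]_(y in X) (Z'^-1 * `|W y - W' y| + `|Z^-1 - Z'^-1| * W y))).
  apply: le_Rintegral => //.
  - apply: integrableX_norm; apply: integrableX_B.
      rewrite (_ : (fun y => W y / Z) = (fun y => Z^-1 * W y)); first exact: integrableX_cM.
      by apply/funext => y; rewrite mulrC.
    rewrite (_ : (fun y => W' y / Z') = (fun y => Z'^-1 * W' y)); first exact: integrableX_cM.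
    by apply/funext => y; rewrite mulrC.
  - by apply: integrableX_D; apply: integrableX_cM => //; exact: integrableX_norm.
  move=> y Xy; have -> : W y / Z - W' y / Z' = Z'^-1 * (W y - W' y) + (Z^-1 - Z'^-1) * W y.
    by ring.
  apply: (le_trans (ler_normD _ _)); rewrite !normrM lerD//.
    by rewrite [ `|Z'^-1|]ger0_norm// invr_ge0 ltW.
  by rewrite [ `|W y|]ger0_norm// W0.
rewrite RintegralD//; last 2 first.
- by apply: integrableX_cM; exact: integrableX_norm.
- exact: integrableX_cM.
rewrite !RintegralZl//; last exact: integrableX_norm.
rewrite -/Z -/J.
have -> : `|Z^-1 - Z'^-1| * Z = Z'^-1 * `|Z - Z'|.
  rewrite -{2}(gtr0_norm Z0) -normrM -[Z'^-1 in RHS]gtr0_norm ?invr_gt0// -normrM.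
  rewrite -normrN; congr `|_|; field; rewrite !gt_eqF//.
have : Z'^-1 * `|Z - Z'| <= Z'^-1 * J by rewrite ler_wpM2l// invr_ge0 ltW.
by move: (Z'^-1 * `|Z - Z'|) => a; lra.
Qed.

(** Cauchy-Schwarz against the constant 1, obtained by expanding the integral of (|g| - J/m)^2,
    where J/m is the mean of |g| over [X]. *)
Lemma sqr_Rintegral_norm_le (g : T -> R) : (0 < mu X)%E ->
  measurable_fun X g -> integrableX (fun x => g x ^+ 2) ->
  (\int[mu]_(x in X) `|g x|) ^+ 2 <= fine (mu X) * \int[mu]_(x in X) (g x ^+ 2).
Proof.
move=> muX0 mg ig2; set m := fine (mu X); have m0 : 0 < m by rewrite fine_gt0// muX0 muX.
have icst (c : R) : integrableX (fun=> c).
  by apply: bounded_mfun_integrable => //; exact: bounded_mfun_cst.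
have ig : integrableX (fun x => `|g x|).
  apply: (@le_integrable _ _ _ mu _ mX _ (EFin \o (fun x => 1 + g x ^+ 2))).
  - by apply/measurable_EFinP; exact: measurableT_comp.
  - move=> x Xx; rewrite /= lee_fin normr_id (le_trans _ (ler_norm _))//.
    rewrite -(real_normK (num_real (g x))).
    by move: `|g x| (normr_ge0 (g x)) (sqr_ge0 (`|g x| - 1)) => t; nra.
  - exact: integrableX_D.
set J := \int[mu]_(x in X) _; set Q := \int[mu]_(x in X) _.
have : 0 <= \int[mu]_(x in X) ((g x ^+ 2 + (- (2 * (J / m))) * `|g x|) + (J / m) ^+ 2).
  apply: Rintegral_ge0 => x _; rewrite -(real_normK (num_real (g x))).
  have -> : `|g x| ^+ 2 + - (2 * (J / m)) * `|g x| + (J / m) ^+ 2 =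
      (`|g x| - J / m) ^+ 2 by ring.
  exact: sqr_ge0.
rewrite RintegralD//; last by apply: integrableX_D => //; exact: integrableX_cM.
rewrite RintegralD//; last exact: integrableX_cM.
rewrite RintegralZl// Rintegral_cst// -/J -/Q -/m => h.
have : 0 <= m * (Q + - (2 * (J / m)) * J + (J / m) ^+ 2 * m) by rewrite mulr_ge0// ltW.
have -> : m * (Q + - (2 * (J / m)) * J + (J / m) ^+ 2 * m) = m * Q - J ^+ 2.
  by field; rewrite gt_eqF.
by rewrite subr_ge0.
Qed.

Section WeightedOrthonormalization.
Variable q : T -> R.
Hypotheses (iq : integrableX q) (q0 : forall y, X y -> 0 < q y).

Local Notation dot f g := (\int[mu]_(y in X) (f y * g y * q y)).

Let idot f g : bounded_mfun X f -> bounded_mfun X g ->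
  integrableX (fun y => f y * g y * q y).
Proof. by move=> bf bg; apply: integrable_mulbounded => //; exact: bounded_mfunM. Qed.

(** Gram-Schmidt for the measure with density [q]. A function whose remainder has norm 0 adds no new
    vector: since [q] is positive on [X], the remainder vanishes almost everywhere, which is why the
    expansions hold only in that sense. *)
Lemma weighted_orthonormalization (g : nat -> T -> R) (r : nat) :
  (forall j, (j < r)%N -> bounded_mfun X (g j)) ->
  exists m (e : nat -> T -> R) (C : nat -> nat -> R),
  [/\ forall i, (i < m)%N -> bounded_mfun X (e i),
      forall i j, (i < m)%N -> (j < m)%N -> dot (e i) (e j) = (i == j)%:R &
      forall j, (j < r)%N ->
        {ae mu, forall y, X y -> g j y = \sum_(0 <= i < m) C j i * e i y}].
Proof.
elim: r => [_|r IH bg].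
  by exists 0%N, (fun=> fun=> 0), (fun=> fun=> 0).
have [|m [e [C [be oe Ce]]]] := IH; first by move=> j jr; apply: bg; exact: ltnW.
have bgr : bounded_mfun X (g r) by exact: bg.
pose a i := dot (g r) (e i).
pose s y := \sum_(0 <= i < m) a i * e i y.
have bs : bounded_mfun X s.
  rewrite /s; under eq_fun do rewrite big_mkord.
  by apply: bounded_mfun_sum => i _; apply: bounded_mfunZ; exact: be.
pose g' y := g r y - s y.
have bg' : bounded_mfun X g' by exact: bounded_mfunB.
have og' i : (i < m)%N -> dot g' (e i) = 0.
  move=> im; have be_i := be i im.
  rewrite (@eq_Rintegral _ _ _ mu X (fun y => g r y * e i y * q y - s y * e i y * q y)); last first.
    by move=> y _; rewrite /g'; ring.
  rewrite RintegralB//; [|exact: idot..].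
  rewrite [X in _ - X](@eq_Rintegral _ _ _ mu X (fun y => \sum_(k < m) a k * (e k y * e i y * q y)))
    => [|y _]; last first.
    rewrite /s big_mkord !mulr_suml; apply: eq_bigr => k _; ring.
  rewrite Rintegral_sum//; last first.
    by move=> k; apply: integrableX_cM; apply: idot => //; exact: be.
  rewrite (bigD1 (Ordinal im))//= big1 ?addr0; last first.
    move=> k kim; rewrite RintegralZl//; last by apply: idot => //; exact: be.
    by rewrite oe// (negbTE kim : (k == i :> nat) = false) mulr0.
  rewrite RintegralZl//; last exact: idot.
  by rewrite oe// eqxx mulr1 subrr.
have n0 : 0 <= dot g' g'.
  by apply: Rintegral_ge0 => y Xy; apply: mulr_ge0; [rewrite -expr2 sqr_ge0|exact/ltW/q0].
have [n_eq0|n_neq0] := eqVneq (dot g' g') 0.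
  exists m, e, (fun j i => if j == r then a i else C j i); split=> //.
  move=> j; rewrite ltnS leq_eqVlt => /predU1P[->|jr]; last first.
    by rewrite (ltn_eqF jr); exact: Ce.
  rewrite eqxx.
  pose k y := g' y * g' y * q y.
  have mg' : measurable_fun X (EFin \o k).
    by apply: measurable_int; exact: idot.
  have : (\int[mu]_(y in X) `|(EFin \o k) y| = 0)%E.
    rewrite (eq_integral (EFin \o k)); last first.
      move=> y /set_mem Xy; rewrite gee0_abs//= lee_fin.
      by apply: mulr_ge0; [rewrite -expr2 sqr_ge0|exact/ltW/q0].
    rewrite -[LHS]fineK; first by rewrite -/(Rintegral mu X k) (n_eq0 : Rintegral mu X k = 0).
    by apply: integrable_fin_num => //; exact: idot.
  move/(ae_eq_integral_abs mu mX mg'); apply: filterS => y yP Xy.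
  have /eqP := yP Xy; rewrite /= eqe !mulf_eq0 orbb (gt_eqF (q0 Xy)) orbF.
  by rewrite subr_eq0 => /eqP.
have npos : 0 < dot g' g' by rewrite lt_def n_neq0.
pose u := Num.sqrt (dot g' g'); have u0 : 0 < u by rewrite sqrtr_gt0.
exists m.+1, (fun i => if i == m then fun y => u^-1 * g' y else e i),
  (fun j i => if j == r then if i == m then u else a i else
              if i == m then 0 else C j i); split.
- move=> i; rewrite ltnS leq_eqVlt => /predU1P[->|im].
    by rewrite eqxx; exact: bounded_mfunZ.
  by rewrite (ltn_eqF im); exact: be.
- have scale (f : T -> R) : bounded_mfun X f ->
      dot (fun y => u^-1 * g' y) f = u^-1 * dot g' f.
    move=> bf; rewrite -RintegralZl//; last exact: idot.
    by apply: eq_Rintegral => y _; rewrite !mulrA.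
  have dotC (f h : T -> R) : dot f h = dot h f.
    by apply: eq_Rintegral => y _; rewrite [f y * _]mulrC.
  move=> i j; rewrite ltnS leq_eqVlt => im; rewrite ltnS leq_eqVlt => jm.
  move: im jm => /predU1P[->|im] /predU1P[->|jm].
  + rewrite !eqxx scale; last exact: bounded_mfunZ.
    rewrite dotC scale// mulrA -invfM -expr2 /u.
    by rewrite (sqr_sqrtr n0) mulVf.
  + rewrite eqxx (ltn_eqF jm) scale; last exact: be.
    by rewrite og'// mulr0 gtn_eqF.
  + rewrite eqxx (ltn_eqF im) dotC scale; last exact: be.
    by rewrite og'// mulr0.
  + by rewrite (ltn_eqF im) (ltn_eqF jm) oe.
- move=> j; rewrite ltnS leq_eqVlt => /predU1P[->|jr].
    apply/aeW => y Xy; rewrite big_nat_recr//= !eqxx mulrA mulfV ?gt_eqF// mul1r.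
    rewrite /g' /s addrC -[LHS](subrK (\sum_(0 <= i < m) a i * e i y)).
    congr (_ + _); apply: eq_big_nat => i /andP[_ im].
    by rewrite (ltn_eqF im).
  apply: filterS (Ce j jr) => y yE Xy; rewrite yE// (ltn_eqF jr).
  rewrite big_nat_recr//= eqxx mul0r addr0; apply: eq_big_nat => i /andP[_ im].
  by rewrite (ltn_eqF im).
Qed.

(* In an orthonormal basis (e_i) of the span, the coordinates of a nonnegative
   combination h are the integrals of h e_i q, hence are at most sup |e_i| times
   the mean of h. *)
Lemma nonneg_combination_le_mean (g : nat -> T -> R) (r : nat) :
  (forall j, (j < r)%N -> bounded_mfun X (g j)) ->
  exists2 K, 0 <= K & {ae mu, forall y, X y -> forall (c : 'I_r -> R) (L : R),
    (forall z, X z -> 0 <= \sum_(j < r) c j * g j z) ->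
    \int[mu]_(z in X) ((\sum_(j < r) c j * g j z) * q z) <= L ->
    \sum_(j < r) c j * g j y <= K * L}.
Proof.
move=> bg; have [m [e [C [be oe Ce]]]] := weighted_orthonormalization bg.
have /choice[E EP] (i : 'I_m) : exists E, 0 <= E /\ forall y, X y -> `|e i y| <= E.
  by have [E E0 EP] := bounded_mfun_ge0 (be i (ltn_ord i)); exists E.
(* One factor [E i] bounds the coordinate [D i] by [E i * L], the other bounds the value of
   [e i]. *)
exists (\sum_i E i ^+ 2); first by rewrite sumr_ge0// => i _; rewrite sqr_ge0.
(* The exceptional set depends only on the expansions of the [g j], so it is common to all [c] and
   [L]. *)
have aeC : {ae mu, forall y, forall j : 'I_r,
    X y -> g j y = \sum_(0 <= i < m) C j i * e i y}.
  by apply: filter_forall => j; exact: Ce.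
have aeC' := aeC; apply: filterS aeC => y yC Xy c L h0 hL.
pose h z := \sum_(j < r) c j * g j z.
have bh : bounded_mfun X h.
  by apply: bounded_mfun_sum => j _; apply: bounded_mfunZ; exact: bg.
pose D i := \sum_(j < r) c j * C j i.
have hE z : (forall j : 'I_r, g j z = \sum_(0 <= i < m) C j i * e i z) ->
    h z = \sum_(i < m) D i * e i z.
  move=> zC; rewrite /h; under eq_bigr do rewrite zC mulr_sumr big_mkord.
  rewrite exchange_big/=; apply: eq_bigr => i _; rewrite mulr_suml.
  by apply: eq_bigr => j _; rewrite mulrA.
have ih : integrableX (fun z => h z * q z) by exact: integrable_mulbounded.
have L0 : 0 <= L.
  by apply: le_trans hL; apply: Rintegral_ge0 => z Xz; rewrite mulr_ge0 ?h0 ?ltW ?q0.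
have DE (i : 'I_m) : `|D i| <= E i * L.
  have [Ei0 eE] := EP i.
  have -> : D i = dot h (e i).
    have -> : dot h (e i) = \int[mu]_(z in X) (\sum_(k < m) D k * (e k z * e i z * q z)).
      congr fine; apply: ae_eq_integral => //.
      - by apply: measurable_int; apply: idot => //; exact: be.
      - apply: measurable_int; apply: integrableX_sum => k _; apply: integrableX_cM.
        by apply: idot; exact: be.
      apply: filterS aeC' => z zC Xz; congr EFin; rewrite hE//; last by move=> j; exact: zC.
      by rewrite !mulr_suml; apply: eq_bigr => k _; ring.
    rewrite Rintegral_sum//; last first.
      by move=> k; apply: integrableX_cM; apply: idot; exact: be.
    rewrite (bigD1 i)//= big1 ?addr0 => [|k ki].
      by rewrite RintegralZl ?oe ?eqxx ?mulr1//; apply: idot; exact: be.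
    rewrite RintegralZl ?oe//; last by apply: idot; exact: be.
    by rewrite (negbTE ki : (k == i :> nat) = false) mulr0.
  apply: (le_trans (le_normr_Rintegral mX _)); first by apply: idot => //; exact: be.
  apply: (@le_trans _ _ (\int[mu]_(z in X) (E i * (h z * q z)))).
    apply: le_Rintegral => //.
    - by apply: integrableX_norm; apply: idot => //; exact: be.
    - exact: integrableX_cM.
    move=> z Xz; have qz0 := ltW (q0 Xz); have hz0 := h0 z Xz.
    rewrite !normrM [ `|h z|]ger0_norm// [ `|q z|]ger0_norm//.
    rewrite [h z * `|_|]mulrC -mulrA ler_wpM2r ?eE//.
    exact: mulr_ge0.
  by rewrite RintegralZl// ler_wpM2l.
rewrite -/(h y) hE; last by move=> j; exact: yC.
rewrite mulr_suml; apply: ler_sum => i _; have [Ei0 eE] := EP i.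
have -> : E i ^+ 2 * L = E i * L * E i by ring.
rewrite (le_trans (ler_norm _))// normrM ler_pM//; exact: eE.
Qed.

End WeightedOrthonormalization.
End Densities.

(** * Borel sets of row vectors *)

Section BorelRowVectors.
Context {R : realType} {n : nat}.

Lemma ratr_dense_rV (x : 'rV[R]_n) (e : R) : 0 < e ->
  exists q : 'rV[rat]_n, ball x e (map_mx ratr q).
Proof.
move=> e0; have /choice[f fP] (j : 'I_n) : exists q : rat, `|x 0 j - ratr q| < e.
  have /rat_in_itvoo[q] : x 0 j - e < x 0 j + e by lra.
  rewrite in_itv/= => /andP[q1 q2]; exists q.
  by rewrite ltr_norml; apply/andP; split; lra.
by exists (\row_j f j); split => // i j; rewrite !mxE (ord1 i); exact: fP.
Qed.

(** The potentials are jointly continuous, whereas Fubini works with the product of the two Borel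
    sigma-algebras. The link is that an open set of the product is a countable union of products of
    balls with rational centres. *)
Lemma open_prod_borel_measurable (O : set ('rV[R]_n * 'rV[R]_n)) : open O ->
  measurable (O : set (borel_rV R n * borel_rV R n)).
Proof.
move=> oO; pose I := ('rV[rat]_n * 'rV[rat]_n * nat)%type.
pose box (i : I) : set ('rV[R]_n * 'rV[R]_n) :=
  ball (map_mx ratr i.1.1 : 'rV[R]_n) i.2.+1%:R^-1 `*`
  ball (map_mx ratr i.1.2 : 'rV[R]_n) i.2.+1%:R^-1.
have -> : O = \bigcup_i (if `[< box i `<=` O >] then box i else set0).
  apply/seteqP; split => [[x y] Oxy|p [i _]]; last by case: ifPn => // /asboolP; exact.
  have /nbhs_ballP[e /= e0 eO] : nbhs (x, y) O by exact: open_nbhs_nbhs.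
  have [k kP] : exists k, k.+1%:R^-1 < e / 2.
    exists (Num.truncn (e / 2)^-1); rewrite -[ltRHS]invrK ltf_pV2 ?posrE ?invr_gt0 ?divr_gt0//.
    exact: truncnS_gt.
  have k0 : 0 < k.+1%:R^-1 :> R by rewrite invr_gt0.
  have [q1 q1P] := ratr_dense_rV x k0; have [q2 q2P] := ratr_dense_rV y k0.
  exists (q1, q2, k) => //; rewrite asboolT.
    by split; exact: ball_sym.
  move=> [x' y'] [/= x'P y'P]; apply: eO.
  have e2 : k.+1%:R^-1 + k.+1%:R^-1 <= e.
    by move: kP; move: (k.+1%:R^-1) => z; lra.
  by split; apply: (le_ball e2); [exact: ball_triangle q1P x'P|exact: ball_triangle q2P y'P].
apply: countable_bigcupT_measurable => [|i]; first exact: countableP.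
case: ifPn => // _; apply: measurableX; apply: sub_sigma_algebra; exact: ball_open.
Qed.

Lemma within_continuous_borel_measurable (D : set 'rV[R]_n) (f : 'rV[R]_n -> R) :
  measurable (D : set (borel_rV R n)) -> {within D, continuous f} ->
  measurable_fun (D : set (borel_rV R n)) f.
Proof.
move=> mD /continuousP cf; apply: (measurability _ (RGenOpens.measurableE R)).
move=> _ [_ [a [b ->] <-]].
have /open_subspaceP := cf `]a, b[%classic (@interval_open R (BRight a) (BLeft b) isT isT).
move=> [V oV VD].
by rewrite setIC -VD setIC; apply: measurableI => //; exact: sub_sigma_algebra.
Qed.

Lemma within_continuous_prod_borel_measurable (D : set ('rV[R]_n * 'rV[R]_n))
    (f : 'rV[R]_n * 'rV[R]_n -> R) :
  measurable (D : set (borel_rV R n * borel_rV R n)) -> {within D, continuous f} ->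
  measurable_fun (D : set (borel_rV R n * borel_rV R n)) f.
Proof.
move=> mD /continuousP cf; apply: (measurability _ (RGenOpens.measurableE R)).
move=> _ [_ [a [b ->] <-]].
have /open_subspaceP := cf `]a, b[%classic (@interval_open R (BRight a) (BLeft b) isT isT).
move=> [V oV VD].
by rewrite setIC -VD setIC; apply: measurableI => //; exact: open_prod_borel_measurable.
Qed.

Lemma compact_pos_bounds (T : topologicalType) (A : set T) (f : T -> R) :
  compact A -> {within A, continuous f} -> (forall x, A x -> 0 < f x) ->
  exists a b, 0 < a /\ forall x, A x -> a <= f x <= b.
Proof.
move=> cA cf f0; have [A0|/set0P/negP/negPn/eqP A0] := pselect (A !=set0); last first.
  by exists 1, 1; split => // x; rewrite A0.
have [u /set_mem Au uP] := compact_EVT_min A0 cA cf.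
have [v /set_mem Av vP] := compact_EVT_max A0 cA cf.
exists (f u), (f v); split; first exact: f0.
by move=> x Ax; rewrite uP ?vP//; exact/mem_set.
Qed.

End BorelRowVectors.

(** * The SOSMP model *)

Lemma ae_impl d (T : measurableType d) (R : realType) (mu : {measure set T -> \bar R})
    (P Q : T -> Prop) : {ae mu, forall x, P x} -> (forall x, P x -> Q x) ->
  {ae mu, forall x, Q x}.
Proof. by move=> aeP PQ; apply: filterS aeP. Qed.

Section Model.
Context {R : realType} {n : nat} {V : finType}.
Variables (M : pairwise_mrf R n V) (phi : nat -> 'rV[R]_n -> R) (r : nat).

Local Notation T := (borel_rV R n).
Local Notation X := (state M : set T).
Local Notation mu := (base M).
Local Notation integrableX f := (mu.-integrable X (EFin \o f)).

Hypotheses (Xclosed : closed (state M)) (Xbounded : bounded_set (state M)).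
Hypothesis muX : (mu X < +oo)%E.
Hypothesis potC : continuous_potentials M.
Hypothesis onb : orthonormal_basis M phi.

(** * Square-integrable functions on the state space *)

Lemma state_measurable : measurable X.
Proof.
by rewrite -[X]setCK; apply: measurableC; apply: sub_sigma_algebra; exact: closed_openC.
Qed.
Let mX := state_measurable.

Lemma L2_measurable (f : T -> R) : L2 M f -> measurable_fun X f.
Proof.
move=> /andP[]; rewrite inE/= => mf _.
by apply/(measurable_restrictT _ _).2.
Qed.

Lemma L2_mul_integrable (f g : T -> R) : L2 M f -> L2 M g ->
  integrableX (fun x => f x * g x).
Proof.
move=> f2 g2; have /Lfun1_integrable := Lfun2_mul_Lfun1 f2 g2.
rewrite (_ : EFin \o _ = (EFin \o (fun x => f x * g x)) \_ X); last first.
  by apply/funext => x /=; rewrite !patchE; case: ifP => // _; rewrite mul0r.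
by move=> ?; apply/(integrable_mkcond _ mX).
Qed.

Lemma L2_integrable (f : T -> R) : L2 M f -> integrableX f.
Proof.
move=> f2; apply: (@le_integrable _ _ _ mu _ mX _ (EFin \o (fun x => 1 + f x * f x))).
- by apply/measurable_EFinP; exact: L2_measurable.
- move=> x Xx; rewrite /= lee_fin (le_trans _ (ler_norm _))// -expr2.
  rewrite -(real_normK (num_real (f x))).
  by move: `|f x| (normr_ge0 (f x)) (sqr_ge0 (`|f x| - 1)) => t; nra.
- apply: integrableX_D => //; last exact: L2_mul_integrable.
  by apply: bounded_mfun_integrable => //; exact: bounded_mfun_cst.
Qed.

Lemma L2D (f1 f2 : T -> R) : L2 M f1 -> L2 M f2 -> L2 M (fun x => f1 x + f2 x).
Proof.
move=> L1 L2'; rewrite /L2 (_ : (fun x => f1 x + f2 x) \_ X = (f1 \_ X) \+ (f2 \_ X)).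
  by apply: (Lfun_addr_closed _ _).2 => //; rewrite lee_fin ler1n.
by apply/funext => x; rewrite /= !patchE; case: ifP => // _; rewrite addr0.
Qed.

Lemma L2Z (c : R) (f : T -> R) : L2 M f -> L2 M (fun x => c * f x).
Proof.
move=> Lf; rewrite /L2 (_ : (fun x => c * f x) \_ X = c \o* (f \_ X)).
  by apply: Lfun_scale => //; rewrite ler1n.
by apply/funext => x; rewrite /= !patchE; case: ifP => // _; rewrite ?mul0r// mulrC.
Qed.

Lemma L2_sum (I : Type) (u : seq I) (F : I -> T -> R) :
  (forall i, L2 M (F i)) -> L2 M (fun x => \sum_(i <- u) F i x).
Proof.
move=> LF; elim: u => [|i u IH].
  rewrite (_ : (fun _ => _) = (fun x => 0 * phi 0%N x)); last first.
    by apply/funext => x; rewrite big_nil mul0r.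
  by apply: L2Z; case: onb.
rewrite (_ : (fun _ => _) = (fun x => F i x + \sum_(j <- u) F j x)); first exact: L2D.
by apply/funext => x; rewrite big_cons.
Qed.

Lemma parseval (c : 'I_r -> R) :
  sqnormL2 M (fun x => \sum_(j < r) c j * phi j x) = \sum_(j < r) c j ^+ 2.
Proof.
case: onb => phi2 ortho _.
have ij (i j : 'I_r) : integrableX (fun x => phi i x * phi j x) by exact: L2_mul_integrable.
transitivity (\int[mu]_(x in X) (\sum_(i < r) \sum_(j < r) (c i * c j) * (phi i x * phi j x))).
  apply: eq_Rintegral => x _; rewrite mulr_suml; apply: eq_bigr => i _.
  by rewrite mulr_sumr; apply: eq_bigr => j _; ring.
rewrite Rintegral_sum//; last first.
  by move=> i; apply: integrableX_sum => // j _; exact: integrableX_cM.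
apply: eq_bigr => i _; rewrite Rintegral_sum//; last by move=> j; exact: integrableX_cM.
rewrite (bigD1 i)//= big1 ?addr0 => [|j ji].
  by rewrite RintegralZl// -/(dotL2 M (phi i) (phi i)) ortho eqxx mulr1 expr2.
rewrite RintegralZl// -/(dotL2 M (phi i) (phi j)) ortho.
by rewrite (negbTE (_ : i != j :> nat)) ?mulr0// eq_sym.
Qed.

(** On a null state space [phi 0] would have norm 0 instead of 1. *)
Lemma state_measure_gt0 : (0 < mu X)%E.
Proof.
rewrite lt_def measure_ge0 andbT; apply/eqP => muX0.
case: onb => phi2 /(_ 0%N 0%N) + _; rewrite eqxx /dotL2 /Rintegral.
rewrite null_set_integral//; last first.
  exact: measurable_int (L2_mul_integrable (phi2 0%N) (phi2 0%N)).
by move=> /= /eqP; rewrite eq_sym oner_eq0.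
Qed.

Let m : R := fine (mu X).
Let m0 : 0 < m.
Proof. by rewrite fine_gt0// state_measure_gt0 muX. Qed.

(** * Bounds and measurability of the potentials *)

Lemma state_compact : compact (state M).
Proof. exact: bounded_closed_compact. Qed.

Let dedgeP (d : dedge M) : edge M (dst d) (src d).
Proof. by rewrite edge_sym; exact: (valP d). Qed.

Lemma edge_pot_bounds (d : dedge M) : exists a b, 0 < a /\
  forall x y, X x -> X y -> a <= edge_pot M (dst d) (src d) x y <= b.
Proof.
have [a [b [a0 ab]]] := @compact_pos_bounds R _ _ _
  (compact_setX state_compact state_compact) (potC.2 _ _ (dedgeP d))
  (fun p Xp => edge_pot_gt0 (dedgeP d) Xp.1 Xp.2).
by exists a, b; split => // x y Xx Xy; exact: (ab (x, y)).
Qed.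

Lemma node_pot_bounds (d : dedge M) : exists a b, 0 < a /\
  forall y, X y -> a <= node_pot M (src d) y <= b.
Proof.
exact: (compact_pos_bounds state_compact (potC.1 _) (fun y => @node_pot_gt0 _ _ _ M _ y)).
Qed.

Lemma edge_pot_measurable (d : dedge M) : measurable_fun (X `*` X)
  (fun p : T * T => edge_pot M (dst d) (src d) p.1 p.2).
Proof.
apply: (@within_continuous_prod_borel_measurable R n _
  (fun p => edge_pot M (dst d) (src d) p.1 p.2)); last exact: potC.2 (dedgeP d).
exact: measurableX.
Qed.

Lemma edge_pot_measurable1 (d : dedge M) y : X y ->
  measurable_fun X (fun x => edge_pot M (dst d) (src d) x y).
Proof.
move=> Xy; apply: (measurable_comp (measurableX mX mX) _ (edge_pot_measurable d)
  (measurable_funTS (pair2_measurable y))).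
by move=> _ [x Xx <-].
Qed.

Lemma edge_pot_measurable2 (d : dedge M) x : X x ->
  measurable_fun X (fun y => edge_pot M (dst d) (src d) x y).
Proof.
move=> Xx; apply: (measurable_comp (measurableX mX mX) _ (edge_pot_measurable d)
  (measurable_funTS (pair1_measurable x))).
by move=> _ [y Xy <-].
Qed.

Lemma node_pot_measurable (d : dedge M) : measurable_fun X (node_pot M (src d)).
Proof. exact: within_continuous_borel_measurable (potC.1 _). Qed.

Lemma beta_measurable (d : dedge M) : measurable_fun X (beta d).
Proof.
apply: measurable_funM; first exact: node_pot_measurable.
apply: (@measurable_Rintegral_param _ _ T T R mu X X
  (fun y x => edge_pot M (dst d) (src d) x y)) => //.
apply: (measurable_comp (measurableX mX mX) _ (edge_pot_measurable d)
  (f := fun p : T * T => edge_pot M (dst d) (src d) p.1 p.2) (g := fun p => (p.2, p.1))).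
  by move=> _ [[x y] [? ?] <-].
by apply: measurable_funTS; exact: measurable_swap.
Qed.

Lemma beta_bounds (d : dedge M) : exists a b, 0 < a /\
  forall y, X y -> a <= beta d y <= b.
Proof.
have [a [b [a0 ab]]] := edge_pot_bounds d; have [a' [b' [a'0 ab']]] := node_pot_bounds d.
exists (a' * (a * m)), (b' * (b * m)); split; first by rewrite !mulr_gt0.
move=> y Xy; have /andP[a'y b'y] := ab' y Xy.
have icst (c : R) : integrableX (fun=> c).
  by apply: bounded_mfun_integrable => //; exact: bounded_mfun_cst.
have iy : integrableX (fun x => edge_pot M (dst d) (src d) x y).
  apply: bounded_mfun_integrable => //; split; first exact: edge_pot_measurable1.
  exists b => x Xx; have /andP[? ?] := ab x y Xx Xy.
  by rewrite ger0_norm// (le_trans _ (ltW (edge_pot_gt0 (dedgeP d) Xx Xy))).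
have lo : a * m <= \int[mu]_(x in X) edge_pot M (dst d) (src d) x y.
  rewrite -[a * m]Rintegral_cst//; apply: le_Rintegral => // x Xx.
  by have /andP[] := ab x y Xx Xy.
have hi : \int[mu]_(x in X) edge_pot M (dst d) (src d) x y <= b * m.
  rewrite -[b * m]Rintegral_cst//; apply: le_Rintegral => // x Xx.
  by have /andP[] := ab x y Xx Xy.
have am0 : 0 <= a * m by rewrite ltW// mulr_gt0.
have n0 := le_trans (ltW a'0) a'y; have i0 := le_trans am0 lo.
by apply/andP; split; apply: ler_pM => //; exact: ltW.
Qed.

Lemma Gam_measurable (d : dedge M) :
  measurable_fun (X `*` X) (fun p : T * T => Gam d p.1 p.2).
Proof.
have comp2 (f : T -> R) : measurable_fun X f ->
    measurable_fun (X `*` X) (fun p : T * T => f p.2).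
  move=> mf; apply: (measurable_comp mX _ mf) => //; last exact: measurable_funTS.
  by move=> _ [[x y] [_ ?] <-].
apply: measurable_funM.
  by apply: measurable_funM; [exact: edge_pot_measurable|apply: comp2; exact: node_pot_measurable].
(* The inverse is replaced by the power -1, a measurable function that agrees with it on nonnegative
   arguments. *)
apply: (@eq_measurable_fun _ _ _ _ _ (fun p : T * T => beta d p.2 `^ (-1))).
  move=> p /set_mem[_ Xp]; rewrite powR_inv1//.
  by have [a [b [a0 ab]]] := beta_bounds d; have /andP[? _] := ab _ Xp; rewrite (le_trans (ltW a0)).
apply: (measurableT_comp (measurable_powR (-1))); apply: comp2.
exact: beta_measurable.
Qed.

Lemma Gam_bounds (d : dedge M) : exists2 K, 0 <= K &
  forall x y, X x -> X y -> 0 <= Gam d x y <= K.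
Proof.
have [a [b [a0 ab]]] := edge_pot_bounds d; have [a' [b' [a'0 ab']]] := node_pot_bounds d.
have [a'' [b'' [a''0 ab'']]] := beta_bounds d.
exists (`|b * b' / a''|) => // x y Xx Xy.
have /andP[a1 b1] := ab x y Xx Xy; have /andP[a2 b2] := ab' y Xy.
have /andP[a3 b3] := ab'' y Xy.
have p1 := le_trans (ltW a0) a1; have p2 := le_trans (ltW a'0) a2.
have p3 := lt_le_trans a''0 a3.
apply/andP; split; first by apply: divr_ge0; [exact: mulr_ge0|exact: ltW].
rewrite (le_trans _ (ler_norm _))//; apply: ler_pM => //.
- exact: mulr_ge0.
- by rewrite invr_ge0 ltW.
- exact: ler_pM.
- by rewrite lef_pV2.
Qed.

Let g (d : dedge M) (j : nat) (y : T) : R := dotL2 M (Gam d ^~ y) (phi j).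

Lemma coef_bounded (d : dedge M) (j : nat) : bounded_mfun X (g d j).
Proof.
have phi2 : L2 M (phi j) by case: onb.
have mphi := L2_measurable phi2.
have [K K0 GK] := Gam_bounds d; split.
  apply: (@measurable_Rintegral_param _ _ T T R mu X X
    (fun y x => Gam d x y * phi j x)) => //.
  apply: measurable_funM.
    apply: (measurable_comp (measurableX mX mX) _ (Gam_measurable d)
      (f := fun p : T * T => Gam d p.1 p.2) (g := fun p => (p.2, p.1))).
      by move=> _ [[x y] [? ?] <-].
    by apply: measurable_funTS; exact: measurable_swap.
  apply: (measurable_comp mX _ mphi) => //; last exact: measurable_funTS.
  by move=> _ [[x y] [_ ?] <-].
exists (\int[mu]_(x in X) (K * `|phi j x|)) => y Xy.
have bG : bounded_mfun X (Gam d ^~ y).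
  split; last by exists K => x Xx; have /andP[? ?] := GK x y Xx Xy; rewrite ger0_norm.
  apply: (measurable_comp (measurableX mX mX) _ (Gam_measurable d)
    (measurable_funTS (pair2_measurable y))).
  by move=> _ [x Xx <-].
have ij := integrable_mulbounded mX bG (L2_integrable phi2).
apply: (le_trans (le_normr_Rintegral mX ij)); apply: le_Rintegral => //.
- exact: integrable_norm.
- by apply: integrableX_cM => //; apply: integrableX_norm; exact: L2_integrable.
- move=> x Xx; rewrite normrM; have /andP[? ?] := GK x y Xx Xy.
  by rewrite ler_wpM2r// ger0_norm.
Qed.

Lemma coef_le_Bcoef (d : dedge M) (j : nat) y : X y -> `|g d j y| <= Bcoef M phi j.
Proof.
move=> Xy; have [_ [K gK]] := coef_bounded d j.
apply: (@le_trans _ _ (sup [set `|g d j z| | z in X])).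
  apply: ub_le_sup; first by exists K => _ [z Xz <-]; exact: gK.
  by exists y.
exact: (le_bigmax _ (fun d => sup [set `|dotL2 M (Gam d ^~ y) (phi j)| | y in X]) d).
Qed.

Lemma Bcoef_ge0 (j : nat) : 0 <= Bcoef M phi j.
Proof. exact: bigmax_ge_id. Qed.

(** * Sampling weights and densities *)

Lemma sampling_weight_measurable (mm : dedge M -> T -> R) (d : dedge M) :
  (forall f, measurable_fun X (mm f)) -> measurable_fun X (sampling_weight mm d).
Proof.
move=> mmm; apply: measurable_funM; first exact: beta_measurable.
rewrite (_ : (fun y => _) = fun y => \prod_f (if feeds d f then Num.max 0 (mm f y) else 1)).
  apply: measurable_prod => f _; case: (feeds d f); last exact: measurable_cst.
  by apply: measurable_maxr => //; exact: measurable_cst.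
by apply/funext => y; rewrite [LHS]big_mkcond.
Qed.

Lemma sampling_weight_ge0 (mm : dedge M -> T -> R) (d : dedge M) y : X y ->
  0 <= sampling_weight mm d y.
Proof.
move=> Xy; have [a [b [a0 ab]]] := beta_bounds d; have /andP[h1 _] := ab y Xy.
apply: mulr_ge0; first exact: le_trans (ltW a0) h1.
by apply: prodr_ge0 => f _; rewrite le_max lexx.
Qed.

(** Total mass at most 1 holds for arbitrary measurable messages: if the weight has mass 0 or
    infinity, its real-valued integral is 0 and the division by 0 returns the zero density.
    Exceptional outcomes thus need no separate treatment in the bounds. *)
Lemma sampling_density_subprob (mm : dedge M -> T -> R) (d : dedge M) :
  (forall f, measurable_fun X (mm f)) ->
  [/\ integrableX (sampling_density mm d),
      forall y, X y -> 0 <= sampling_density mm d y &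
      \int[mu]_(y in X) sampling_density mm d y <= 1].
Proof.
move=> mmm; pose W := sampling_weight mm d.
have mW : measurable_fun X W by exact: sampling_weight_measurable.
have W0 y : X y -> 0 <= W y by exact: sampling_weight_ge0.
have Z0 : 0 <= \int[mu]_(z in X) W z by exact: Rintegral_ge0.
have pE : sampling_density mm d = fun y => (\int[mu]_(z in X) W z)^-1 * W y.
  by apply/funext => y; rewrite /sampling_density mulrC.
rewrite pE; split; last 2 first.
- by move=> y Xy; rewrite mulr_ge0 ?invr_ge0// W0.
- have [->|Zneq0] := eqVneq (\int[mu]_(z in X) W z) 0.
    rewrite invr0; under eq_Rintegral do rewrite mul0r.
    by rewrite Rintegral_cst// mul0r.
  have iW : integrableX W.
    apply/integrableP; split; first exact/measurable_EFinP.
    rewrite (eq_integral (fun y => (W y)%:E)); last first.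
      by move=> y /set_mem Xy; rewrite /= ger0_norm// W0.
    by rewrite ltey; apply: contra_neq Zneq0 => WE; rewrite /Rintegral WE.
  by rewrite RintegralZl// mulVf.
have [Z00|Zneq0] := eqVneq (\int[mu]_(z in X) W z) 0.
  rewrite Z00 invr0 (_ : (fun y => 0 * W y) = fun=> 0).
    by apply: bounded_mfun_integrable => //; exact: bounded_mfun_cst.
  by apply/funext => y; rewrite mul0r.
apply: integrableX_cM => //; apply/integrableP; split; first exact/measurable_EFinP.
rewrite (eq_integral (fun y => (W y)%:E)); last first.
  by move=> y /set_mem Xy; rewrite /= ger0_norm// W0.
by rewrite ltey; apply: contra_neq Zneq0 => WE; rewrite /Rintegral WE.
Qed.

Lemma sampling_density_jointly_measurable d1 (Om : measurableType d1)
    (mm : Om -> dedge M -> T -> R) (d : dedge M) :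
  (forall f, measurable_fun (setT `*` X) (fun p : Om * T => mm p.1 f p.2)) ->
  measurable_fun (setT `*` X) (fun p : Om * T => sampling_density (mm p.1) d p.2).
Proof.
move=> mmm.
have mW : measurable_fun (setT `*` X) (fun p : Om * T => sampling_weight (mm p.1) d p.2).
  apply: measurable_funM.
    apply: (measurable_comp mX _ (beta_measurable d)) => //; last exact: measurable_funTS.
    by move=> _ [[x y] [_ ?] <-].
  rewrite (_ : (fun p => _) = fun p : Om * T =>
      \prod_f (if feeds d f then Num.max 0 (mm p.1 f p.2) else 1)).
    apply: measurable_prod => f _; case: (feeds d f); last exact: measurable_cst.
    by apply: measurable_maxr => //; exact: measurable_cst.
  by apply/funext => y; rewrite [LHS]big_mkcond.
apply: measurable_funM => //.
have mZ : measurable_fun setT (fun w => \int[mu]_(z in X) sampling_weight (mm w) d z).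
  exact: (@measurable_Rintegral_param _ _ Om T R mu setT X
    (fun w z => sampling_weight (mm w) d z)).
apply: (@eq_measurable_fun _ _ _ _ _
  (fun p : Om * T => (\int[mu]_(z in X) sampling_weight (mm p.1) d z) `^ (-1))).
  move=> p _; rewrite powR_inv1//; apply: Rintegral_ge0 => z Xz.
  exact: sampling_weight_ge0.
apply: (measurableT_comp (measurable_powR (-1))).
by apply: measurable_funTS; exact: (measurableT_comp mZ).
Qed.

Lemma sqnorm_diff_le (f1 f2 : T -> R) : L2 M f1 -> L2 M f2 ->
  sqnormL2 M (fun x => f1 x - f2 x) <= 2 * (sqnormL2 M f1 + sqnormL2 M f2).
Proof.
move=> l1 l2; have i11 := L2_mul_integrable l1 l1; have i22 := L2_mul_integrable l2 l2.
rewrite /sqnormL2 /dotL2 -RintegralD// -RintegralZl//; last exact: integrableX_D.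
apply: le_Rintegral => //.
- apply: L2_mul_integrable.
    rewrite (_ : (fun _ => _) = (fun x => f1 x + -1 * f2 x)); first by apply: L2D => //; exact: L2Z.
    by apply/funext => x; rewrite mulN1r.
  rewrite (_ : (fun _ => _) = (fun x => f1 x + -1 * f2 x)); first by apply: L2D => //; exact: L2Z.
  by apply/funext => x; rewrite mulN1r.
- by apply: integrableX_cM => //; exact: integrableX_D.
- by move=> x _; have := sqr_ge0 (f1 x + f2 x); nra.
Qed.

(** The coefficient estimate computed from the draws of iteration [s], the one that enters the
    coefficients at time [s.+1]. *)
Definition sample_mean (k : nat) (y : nat -> dedge M -> 'I_k -> T) s d j : R :=
  k%:R^-1 * \sum_(i < k) dotL2 M (Gam d ^~ (y s d i)) (phi j).

Let eta (t : nat) : R := t.+1%:R^-1.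

(** The first step size is 1 and erases the initial value [r%:R^-1]; the later ones update a running
    average. *)
Lemma sosmp_coef_mean (k : nat) (y : nat -> dedge M -> 'I_k -> T) t d (j : 'I_r) :
  sosmp_coef phi eta y t.+1 d j =
  t.+1%:R^-1 * \sum_(0 <= s < t.+1) sample_mean y s d j.
Proof.
have step u : sosmp_coef phi eta y u.+1 d j =
    (1 - eta u) * sosmp_coef phi eta y u d j + eta u * sample_mean y u d j by [].
elim: t => [|t IH].
  by rewrite step big_nat1 /eta invr1 subrr mul0r add0r.
rewrite step IH [in RHS]big_nat_recr//= [RHS]mulrDr /eta; congr (_ + _).
rewrite mulrA; congr (_ * _).
have t0 : t.+1%:R != 0 :> R by rewrite pnatr_eq0.
have E : t.+2%:R = t.+1%:R + 1 :> R by rewrite natr1.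
have t1 : t.+2%:R != 0 :> R by rewrite pnatr_eq0.
move: t0 t1; rewrite E; move: (t.+1%:R : R) => x x0 x1.
by field; rewrite x0 x1.
Qed.

Lemma expansion_L2 (c : dedge M -> 'I_r -> R) d : L2 M (expansion phi c d).
Proof. by apply: L2_sum => j; apply: L2Z; case: onb. Qed.

Lemma proj_basis_L2 (f : T -> R) : L2 M (proj_basis M phi r f).
Proof. by apply: L2_sum => j; apply: L2Z; case: onb. Qed.

Lemma sosmp_error_sqnorm (mstar : dedge M -> T -> R) (k : nat)
    (y : nat -> dedge M -> 'I_k -> T) t d :
  sqnormL2 M (sosmp_error phi r eta mstar y t d) =
  \sum_(j < r) (sosmp_coef phi eta y t d j - dotL2 M (mstar d) (phi j)) ^+ 2.
Proof.
rewrite -parseval; congr sqnormL2; apply/funext => x.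
rewrite /sosmp_error /sosmp_msg /expansion /proj_basis -sumrB.
by apply: eq_bigr => j _; rewrite mulrBl.
Qed.

(** The conditional mean of [sample_mean] given the past of iteration [s]. *)
Definition sample_drift (k : nat) (y : nat -> dedge M -> 'I_k -> T) s d j : R :=
  \int[mu]_(z in X) (dotL2 M (Gam d ^~ z) (phi j) *
                     sampling_density (sosmp_msg phi r eta y s) d z).

Lemma sample_mean_le (k : nat) (y : nat -> dedge M -> 'I_k -> T) s d j :
  (0 < k)%N -> (forall t d i, X (y t d i)) -> `|sample_mean y s d j| <= Bcoef M phi j.
Proof.
move=> k0 yX; have kR : 0 < k%:R :> R by rewrite ltr0n.
rewrite /sample_mean normrM (@ger0_norm _ k%:R^-1) ?invr_ge0// ler_pdivrMl//.
apply: (le_trans (ler_norm_sum _ _ _)).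
apply: (@le_trans _ _ (\sum_(i < k) Bcoef M phi j)).
  by apply: ler_sum => i _; exact: coef_le_Bcoef.
by rewrite sumr_const card_ord mulr_natl.
Qed.

(** * Measurability in the samples drawn so far *)

Section SamplePaths.
Context d1 (Om : measurableType d1) (k : nat).
Variables (yy : Om -> nat -> dedge M -> 'I_k -> T) (t : nat).
Hypothesis myy : forall s d i, (s < t)%N -> measurable_fun setT (fun w => yy w s d i).
Hypothesis yyX : forall w s d i, X (yy w s d i).

(** [Om] may carry any sigma-algebra for which the samples before [t] are measurable: the results of
    this section are applied both to that of [Omega] and to the one generated by the past. *)
Lemma sample_mean_bounded s d j : (s < t)%N ->
  bounded_mfun setT (fun w => sample_mean (yy w) s d j).
Proof.
move=> st; apply: bounded_mfunZ; apply: bounded_mfun_sum => i _.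
have [mg [K gK]] := coef_bounded d j; split; last by exists K => w _; exact: gK.
by apply: (measurable_comp mX _ mg (myy d i st)) => _ [w _ <-].
Qed.

Lemma sosmp_coef_bounded s d (j : 'I_r) : (s <= t)%N ->
  bounded_mfun setT (fun w => sosmp_coef phi eta (yy w) s d j).
Proof.
elim: s => [_|s IH st]; first exact: bounded_mfun_cst.
by apply: bounded_mfunD; apply: bounded_mfunZ; [exact/IH/ltnW|exact: sample_mean_bounded].
Qed.

Lemma sosmp_density_measurable s d : (s <= t)%N ->
  measurable_fun (setT `*` X)
    (fun z : Om * T => sampling_density (sosmp_msg phi r eta (yy z.1) s) d z.2).
Proof.
move=> st; apply: (@sampling_density_jointly_measurable _ Om
  (fun w => sosmp_msg phi r eta (yy w) s)) => f.
apply: measurable_sum => j; apply: measurable_funM.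
  apply: (measurable_comp measurableT _ (sosmp_coef_bounded f j st).1) => //.
  exact: measurable_funTS.
have phi2 : L2 M (phi j) by case: onb.
apply: (measurable_comp mX _ (L2_measurable phi2)); last exact: measurable_funTS.
by move=> _ [[w y] [_ ?] <-].
Qed.

Lemma sosmp_msg_measurable w s f : measurable_fun X (sosmp_msg phi r eta (yy w) s f).
Proof. exact: L2_measurable (expansion_L2 _ _). Qed.

Lemma sample_drift_le w s d j : `|sample_drift (yy w) s d j| <= Bcoef M phi j.
Proof.
have [ip p0 p1] := sampling_density_subprob d (sosmp_msg_measurable w s).
apply: Rintegral_weighted_norm_le => //.
- exact: coef_bounded.
- exact: Bcoef_ge0.
- by move=> y; exact: coef_le_Bcoef.
Qed.

Lemma sample_drift_bounded s d j : (s <= t)%N ->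
  bounded_mfun setT (fun w => sample_drift (yy w) s d j).
Proof.
move=> st; split; last by exists (Bcoef M phi j) => w _; exact: sample_drift_le.
apply: (@measurable_Rintegral_param _ _ Om T R mu setT X
  (fun w y => g d j y * sampling_density (sosmp_msg phi r eta (yy w) s) d y)) => //.
apply: measurable_funM; last exact: sosmp_density_measurable.
apply: (measurable_comp mX _ (coef_bounded d j).1); last exact: measurable_funTS.
by move=> _ [[w y] [_ ?] <-].
Qed.

End SamplePaths.

(** * The noise as a conditionally centred sequence *)

Section Draws.
Context {dO : measure_display} {Omega : measurableType dO}.
Variables (P : probability Omega R) (k : nat).
Variable Y : nat -> dedge M -> 'I_k -> {RV P >-> borel_rV R n}.
Hypothesis k_gt0 : (0 < k)%N.
Hypothesis draws : sosmp_draws Y phi r eta.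

Let YX t d i w : X (Y t d i w). Proof. by case: draws. Qed.
Let ys w := samples_at Y w.
Let p t d w := sampling_density (sosmp_msg phi r eta (ys w) t) d.

Let mY t d i : measurable_fun setT (Y t d i : Omega -> T).
Proof. exact: measurable_funPT. Qed.

Let mys t s d i : (s < t)%N -> measurable_fun setT (fun w => ys w s d i).
Proof. by move=> _; exact: mY. Qed.

Let ysX w s d i : X (ys w s d i). Proof. exact: YX. Qed.

Let subp t d w : [/\ integrableX (p t d w), forall y, X y -> 0 <= p t d w y &
  \int[mu]_(y in X) p t d w y <= 1].
Proof. by apply: sampling_density_subprob => f; exact: (sosmp_msg_measurable ys). Qed.

Let mp t d : measurable_fun (setT `*` X) (fun z : Omega * T => p t d z.1 z.2).
Proof. exact: (@sosmp_density_measurable _ Omega k ys t (@mys t) ysX t d (leqnn t)). Qed.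

Lemma past_measurable t H : past Y t H -> measurable H.
Proof.
apply: smallest_sub; first exact: sigma_algebra_measurable.
move=> _ [s [d [i [B [st mB ->]]]]]; rewrite -[X in measurable X]setTI.
exact: mY.
Qed.

(** The conditional probability that a single draw falls in [B]. *)
Let mass t d (B : set T) w := \int[mu]_(y in X) (\1_B y * p t d w y).

Let massE t d (B : set T) w : measurable B ->
  (\int[mu]_(y in X `&` B) (p t d w y)%:E = (mass t d B w)%:E)%E.
Proof.
move=> mB; have [ip _ _] := subp t d w.
rewrite /mass /Rintegral fineK; last first.
  apply: integrable_fin_num => //; apply: integrable_mulbounded => //.
  exact: bounded_mfun_indic.
rewrite integral_mkcondr; apply: eq_integral => y _.
by rewrite patchE indicE; case: ifP => _; rewrite ?mul1r ?mul0r.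
Qed.

Let mass_measurable t d (B : set T) : measurable B -> measurable_fun setT (mass t d B).
Proof.
move=> mB; apply: (@measurable_Rintegral_param _ _ Omega T R mu setT X
  (fun w y => \1_B y * p t d w y)) => //.
apply: measurable_funM => //.
apply: (measurable_comp mX _ (@measurable_indic _ T R X B mB)); last exact: measurable_funTS.
by move=> _ [[w y] [_ ?] <-].
Qed.

Let mass_total t d : {ae P, forall w, mass t d setT w = 1}.
Proof.
have [_ Wfin _] := draws; apply: (ae_impl (Wfin t d)) => w /andP[W0 Woo].
have mmm f : measurable_fun X (sosmp_msg phi r eta (ys w) t f).
  exact: (sosmp_msg_measurable ys).
have mW := sampling_weight_measurable d mmm.
have iW : integrableX (sampling_weight (sosmp_msg phi r eta (ys w) t) d).
  apply/integrableP; split; first exact/measurable_EFinP.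
  rewrite (eq_integral (fun y => (sampling_weight (sosmp_msg phi r eta (ys w) t) d y)%:E))//.
  by move=> y /set_mem Xy; rewrite /= ger0_norm// sampling_weight_ge0.
have Z0 : 0 < \int[mu]_(y in X) sampling_weight (sosmp_msg phi r eta (ys w) t) d y.
  by apply: fine_gt0; rewrite W0.
rewrite /mass (@eq_Rintegral _ _ _ mu X (fun y => p t d w y)); last first.
  by move=> y _; rewrite indicT mul1r.
by rewrite /p /sampling_density RintegralZr// mulfV// gt_eqF.
Qed.

(** The other draws are left free by taking the whole space as their test set; their factors are
    total masses, almost surely equal to 1. *)
Lemma single_draw_law t d i H B : past Y t H -> measurable B ->
  P (H `&` Y t d i @^-1` B) =
  (\int[P]_(w in H) \int[mu]_(y in X `&` B) (p t d w y)%:E)%E.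
Proof.
move=> pH mB; have mH := past_measurable pH.
pose B' i' := if i' == i then B else setT.
have mB' i' : measurable (B' i') by rewrite /B'; case: ifP.
have [_ _ /(_ t d H B' pH mB')] := draws.
have -> : \bigcap_i0 (Y t d i0 @^-1` B' i0) = Y t d i @^-1` B.
  apply/seteqP; split => w; first by move=> /(_ i I); rewrite /B' eqxx.
  by move=> Bw i' _; rewrite /= /B'; case: eqP => // ->.
move=> ->; under eq_integral do rewrite -/(p t d _) (eq_bigr _ (fun i' _ => massE t d _ (mB' i'))) prodEFin.
under [RHS]eq_integral do rewrite massE//.
apply: ae_eq_integral => //.
- apply/measurable_EFinP; apply: measurable_funTS; apply: measurable_prod => i' _.
  exact: mass_measurable.
- by apply/measurable_EFinP; apply: measurable_funTS; exact: mass_measurable.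
apply: (ae_impl (mass_total t d)) => w w1 _; congr EFin.
rewrite (bigD1 i)//= big1 ?mulr1; first by rewrite /B' eqxx.
by move=> i' /negbTE i'i; rewrite /B' i'i.
Qed.

Let noise d j t w := sample_mean (ys w) t d j - sample_drift (ys w) t d j.

Let noise_bounded d j t : bounded_mfun setT (noise d j t).
Proof.
apply: bounded_mfunB.
  exact: (@sample_mean_bounded _ Omega k ys t.+1 (@mys t.+1) ysX t d j (ltnSn t)).
exact: (@sample_drift_bounded _ Omega k ys t (@mys t) ysX t d j (leqnn t)).
Qed.

Lemma noise_le d j t w : `|noise d j t w| <= 2 * Bcoef M phi j.
Proof.
rewrite (le_trans (ler_normB _ _))// mulr_natl mulr2n lerD//.
  exact: sample_mean_le.
exact: (sample_drift_le ys).
Qed.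

(** By linearity the mean over the [k] draws only involves the conditional law of each single
    draw. *)
Lemma noise_past d j t H : past Y t H -> \int[P]_(w in H) noise d j t w = 0.
Proof.
move=> pH; have mH := past_measurable pH.
have gY i : \int[P]_(w in H) (g d j (Y t d i w) - sample_drift (ys w) t d j) = 0.
  have hp0 w y : X y -> 0 <= p t d w y by have [_ + _] := subp t d w; exact.
  have hip w : integrableX (p t d w) by have [] := subp t d w.
  have hp1 w : \int[mu]_(y in X) p t d w y <= 1 by have [] := subp t d w.
  have law B : measurable B -> P (H `&` Y t d i @^-1` B) =
      (\int[P]_(w in H) \int[mu]_(y in X `&` B) (p t d w y)%:E)%E.
    by move=> mB; exact: single_draw_law.
  exact: (@Rintegral_conditional_law _ _ _ P _ T mu X mX muX (p t d) (Y t d i) H (mp t d)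
    hp0 hip hp1 mH (mY t d i) (YX t d i) law (g d j) (coef_bounded d j)).
have kR : k%:R != 0 :> R by rewrite pnatr_eq0 -lt0n.
have bd : bounded_mfun setT (fun w => sample_drift (ys w) t d j).
  exact: (@sample_drift_bounded _ Omega k ys t (@mys t) ysX t d j (leqnn t)).
have bg i : bounded_mfun setT (fun w => g d j (Y t d i w)).
  have [mg [K gK]] := coef_bounded d j; split; last by exists K => w _; exact: gK.
  by apply: (measurable_comp mX _ mg (mY t d i)) => _ [w _ <-].
have iH f : bounded_mfun setT f -> P.-integrable H (EFin \o f).
  by move=> bf; apply: (integrableS measurableT) => //; exact: prob_bounded_integrable.
rewrite (@eq_Rintegral _ _ _ P H (fun w =>
    \sum_(i < k) k%:R^-1 * (g d j (Y t d i w) - sample_drift (ys w) t d j))); last first.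
  move=> w _; rewrite -mulr_sumr sumrB sumr_const card_ord mulrBr -(mulr_natl (sample_drift _ _ _ _)).
  by rewrite mulrA mulVf ?mul1r.
rewrite Rintegral_sum//; last first.
  by move=> i; apply: iH; apply: bounded_mfunZ; exact: bounded_mfunB.
rewrite big1// => i _; rewrite RintegralZl ?gY ?mulr0//.
by apply: iH; exact: bounded_mfunB.
Qed.

Lemma noise_orthogonal d j s t : (s < t)%N ->
  \int[P]_w (noise d j s w * noise d j t w) = 0.
Proof.
move=> st; pose G : set (set Omega) := [set H | exists s d i (B : set T),
  [/\ (s < t)%N, measurable B & H = Y s d i @^-1` B]].
have mYG s' d' i : (s' < t)%N ->
    measurable_fun setT (Y s' d' i : g_sigma_algebraType G -> T).
  move=> s't _ B mB; rewrite setTI; apply: sub_sigma_algebra.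
  by exists s', d', i, B.
apply: (@Rintegral_orthogonal _ _ _ P G) => //.
- exact: (@past_measurable t).
(* The noise at time [s] is measurable for the past of [t]: the lemmas on sample paths are used here
   with the generated sigma-algebra in place of that of [Omega]. *)
- apply: bounded_mfunB.
    exact: (@sample_mean_bounded _ (g_sigma_algebraType G) k ys t mYG (fun w s d i => YX s d i w)).
  exact: (@sample_drift_bounded _ (g_sigma_algebraType G) k ys t mYG (fun w s d i => YX s d i w)
    s d j (ltnW st)).
- by move=> H; exact: noise_past.
Qed.

(** Given the past, each draw has a density with respect to [mu], so it misses a given null set
    almost surely; there are countably many draws. *)
Lemma samples_ae (good : dedge M -> set T) :
  (forall d, {ae mu, forall y, X y -> good d y}) ->
  {ae P, forall w, forall t d i, good d (Y t d i w)}.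
Proof.
move=> goodP.
have single t d i : {ae P, forall w, good d (Y t d i w)}.
  have [N [mN N0 Ngood]] := goodP d.
  exists (Y t d i @^-1` N); split.
  - by rewrite -[X in measurable X]setTI; exact: mY.
  - rewrite -[X in P X]setTI single_draw_law//; last first.
      exact: (@measurableT _ (g_sigma_algebraType [set H : set Omega |
        exists s d i (B : set T), [/\ (s < t)%N, measurable B & H = Y s d i @^-1` B]])).
    rewrite (eq_integral (fun=> 0%E)) ?integral0// => w _.
    rewrite null_set_integral//.
    + exact: measurableI.
    + apply/measurable_EFinP; have [ip _ _] := subp t d w.
      apply: (measurable_funS mX); first exact: subIsetl.
      by apply/measurable_EFinP; exact: measurable_int ip.
    + by apply: (subset_measure0 _ mN _ N0); [exact: measurableI|exact: subIsetr].
  - move=> w /= ngood; apply: Ngood => /= /(_ (YX _ _ _ _)); exact: ngood.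
apply: ae_foralln => t.
apply: (@filter_forall Omega _ _ _ (ae_filter_ringOfSetsType P)) => d.
apply: (@filter_forall Omega _ _ _ (ae_filter_ringOfSetsType P)) => i.
exact: single.
Qed.

End Draws.

(** * The fixed point as a mixture, and boundedness of the messages *)

Section FixedPoint.
Variable mstar : dedge M -> T -> R.
Hypothesis bp : bp_fixed_point mstar.
Hypothesis incoh : forall x (d : dedge M), X x ->
  0 < inf_proj_Gam phi r d x /\
  `|proj_residual phi r mstar d x| <= 2^-1 * inf_proj_Gam phi r d x.

Let ms_L2 d : L2 M (mstar d). Proof. by case: (bp.1 d). Qed.
Let ms_ge0 d y : X y -> 0 <= mstar d y. Proof. by case: (bp.1 d) => _ + _; exact. Qed.
Let ms_measurable d : measurable_fun X (mstar d).
Proof. exact: L2_measurable. Qed.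

Let Pm d y := \prod_(f | feeds d f) mstar f y.

Let Pm_ge0 d y : X y -> 0 <= Pm d y.
Proof. by move=> Xy; apply: prodr_ge0 => f _; exact: ms_ge0. Qed.

Let Pm_measurable d : measurable_fun X (Pm d).
Proof.
rewrite (_ : Pm d = fun y => \prod_f (if feeds d f then mstar f y else 1)).
  by apply: measurable_prod => f _; case: (feeds d f); [exact: ms_measurable|exact: measurable_cst].
by apply/funext => y; rewrite /Pm [LHS]big_mkcond.
Qed.

Let kernelPm_measurable d x : X x ->
  measurable_fun X (fun y => edge_pot M (dst d) (src d) x y * node_pot M (src d) y * Pm d y).
Proof.
move=> Xx; apply: measurable_funM => //; apply: measurable_funM.
  exact: edge_pot_measurable2.
exact: node_pot_measurable.
Qed.

(** Otherwise the update, and with it [mstar d], would vanish almost everywhere, although [mstar d]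
    has integral 1. *)
Let bp_integral_neq0 d : ~ (forall x, X x -> bp_integral mstar d x = 0).
Proof.
move=> J0; have [_ _] := bp.1 d.
have ae0 : ae_eq mu X (fun x => (mstar d x)%:E) (cst 0%E).
  apply: (ae_impl (bp.2 d)) => x xE Xx.
  by rewrite -(xE Xx) /bp_update J0// mul0r.
have -> : (\int[mu]_(x in X) (mstar d x)%:E = \int[mu]_(x in X) cst 0 x)%E.
  by apply: ae_eq_integral => //; exact/measurable_EFinP.
by rewrite integral0 => /eqP; rewrite eqe eq_sym oner_eq0.
Qed.

Let kernel_bounds (d : dedge M) : exists a b, 0 < a /\ forall x y, X x -> X y ->
  a <= edge_pot M (dst d) (src d) x y * node_pot M (src d) y <= b.
Proof.
have [a [b [a0 ab]]] := edge_pot_bounds d; have [a' [b' [a'0 ab']]] := node_pot_bounds d.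
exists (a * a'), (b * b'); split; first exact: mulr_gt0.
move=> x y Xx Xy; have /andP[a1 b1] := ab x y Xx Xy; have /andP[a2 b2] := ab' y Xy.
have p1 := le_trans (ltW a0) a1; have p2 := le_trans (ltW a'0) a2.
by apply/andP; split; apply: ler_pM => //; exact: ltW.
Qed.

(** Each message is in L^2, but a product of several of them need not be integrable a priori. If its
    integral were infinite, so would be that of the update at every [x], the kernel being bounded
    below by a positive constant; its real value would then be 0 by convention, which
    [bp_integral_neq0] excludes. *)
Lemma incoming_product_integrable d : integrableX (Pm d).
Proof.
apply/integrableP; split; first exact/measurable_EFinP.
rewrite (eq_integral (fun y => (Pm d y)%:E)); last first.
  by move=> y /set_mem Xy; rewrite /= ger0_norm// Pm_ge0.
rewrite ltNge leye_eq; apply/negP => /eqP Iy.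
apply: (@bp_integral_neq0 d) => x Xx.
have [a [b [a0 ab]]] := kernel_bounds d.
suff Jy : (\int[mu]_(y in X) (edge_pot M (dst d) (src d) x y * node_pot M (src d) y *
    Pm d y)%:E = +oo)%E by rewrite /bp_integral /Rintegral Jy.
apply/eqP; rewrite -leye_eq.
have -> : (+oo = \int[mu]_(y in X) (a%:E * (Pm d y)%:E))%E.
  rewrite ge0_integralZl//; last 3 first.
  - exact/measurable_EFinP.
  - by move=> y Xy; rewrite lee_fin Pm_ge0.
  - by rewrite lee_fin ltW.
  by rewrite Iy gt0_muley.
apply: ge0_le_integral => //.
- by move=> y Xy; rewrite -EFinM lee_fin mulr_ge0 ?(ltW a0)// Pm_ge0.
- by apply/measurable_EFinP; apply: measurable_funM.
- by apply/measurable_EFinP; exact: kernelPm_measurable.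
- move=> y Xy; rewrite -EFinM lee_fin ler_wpM2r ?Pm_ge0//.
  by have /andP[] := ab x y Xx Xy.
Qed.
Let iPm := incoming_product_integrable.

Let Pm_int_gt0 d : 0 < \int[mu]_(y in X) Pm d y.
Proof.
rewrite lt_def Rintegral_ge0 ?andbT; last by move=> y; exact: Pm_ge0.
apply/eqP => I0; apply: (@bp_integral_neq0 d) => x Xx.
have [a [b [a0 ab]]] := kernel_bounds d.
have bK : bounded_mfun X (fun y => edge_pot M (dst d) (src d) x y * node_pot M (src d) y).
  split; last first.
    exists b => y Xy; have /andP[h1 h2] := ab x y Xx Xy.
    by rewrite ger0_norm// (le_trans (ltW a0)).
  by apply: measurable_funM; [exact: edge_pot_measurable2|exact: node_pot_measurable].
apply/eqP; rewrite eq_le; apply/andP; split; last first.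
  apply: Rintegral_ge0 => y Xy; have /andP[h1 _] := ab x y Xx Xy.
  by apply: mulr_ge0; [exact: le_trans (ltW a0) h1|exact: Pm_ge0].
rewrite -(mulr0 b) -I0 -RintegralZl//; apply: le_Rintegral => //.
- exact: (integrable_mulbounded mX bK (iPm d)).
- exact: integrableX_cM.
- move=> y Xy; have /andP[_ h2] := ab x y Xx Xy.
  by rewrite ler_wpM2r// Pm_ge0.
Qed.

Let beta_bounded (d : dedge M) : bounded_mfun X (beta d).
Proof.
split; first exact: beta_measurable.
have [a [b [a0 ab]]] := beta_bounds d; exists b => y Xy.
by have /andP[h1 h2] := ab y Xy; rewrite ger0_norm// (le_trans (ltW a0)).
Qed.

Let Wstar d y := beta d y * Pm d y.
Let iWstar d : integrableX (Wstar d).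
Proof. exact: integrable_mulbounded. Qed.

Let Zs d := \int[mu]_(y in X) Wstar d y.

Let Zs_gt0 d : 0 < Zs d.
Proof.
have [a [b [a0 ab]]] := beta_bounds d.
apply: (@lt_le_trans _ _ (a * \int[mu]_(y in X) Pm d y)); first exact: mulr_gt0.
rewrite -RintegralZl//; apply: le_Rintegral => //; first exact: integrableX_cM.
by move=> y Xy; have /andP[h1 _] := ab y Xy; rewrite ler_wpM2r// Pm_ge0.
Qed.

(** The limiting sampling density, that of the fixed point messages. *)
Let q d y := Wstar d y / Zs d.
Let iq d : integrableX (q d).
Proof.
rewrite (_ : q d = fun y => (Zs d)^-1 * Wstar d y); first exact: integrableX_cM.
by apply/funext => y; rewrite mulrC.
Qed.

Let q_ge0 d y : X y -> 0 <= q d y.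
Proof.
move=> Xy; have [a [b [a0 ab]]] := beta_bounds d; have /andP[h1 _] := ab y Xy.
apply: divr_ge0; last exact: ltW.
by apply: mulr_ge0; [exact: le_trans (ltW a0) h1|exact: Pm_ge0].
Qed.

Let q_int1 d : \int[mu]_(y in X) q d y = 1.
Proof.
rewrite /q RintegralZr// -/(Zs d) mulfV// gt_eqF//; exact: Zs_gt0.
Qed.

(** Fubini identifies the normalising constant of the BP update with that of the limiting sampling
    density. *)
Let sum_bp_integral d : \int[mu]_(x in X) bp_integral mstar d x = Zs d.
Proof.
have [a [b [a0 ab]]] := kernel_bounds d.
rewrite /bp_integral (@Rintegral_fubini_in _ _ T T R mu mu X X _ (fun=> b) (Pm d))//.
- apply: eq_Rintegral => y /set_mem Xy; rewrite /Wstar /beta.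
  have bE : bounded_mfun X (fun x => edge_pot M (dst d) (src d) x y).
    split; first exact: edge_pot_measurable1.
    have [c [c' [c0 cc']]] := edge_pot_bounds d.
    exists c' => x Xx; have /andP[h1 h2] := cc' x y Xx Xy.
    by rewrite ger0_norm// (le_trans (ltW c0)).
  rewrite mulrAC -RintegralZl//; last exact: bounded_mfun_integrable.
  by apply: eq_Rintegral => x _; rewrite /Pm; ring.
- apply: measurable_funM.
    apply: measurable_funM; first exact: edge_pot_measurable.
    apply: (measurable_comp mX _ (node_pot_measurable d)) => //; last exact: measurable_funTS.
    by move=> _ [[x y] [_ ?] <-].
  apply: (measurable_comp mX _ (Pm_measurable d)) => //; last exact: measurable_funTS.
  by move=> _ [[x y] [_ ?] <-].
- by apply: bounded_mfun_integrable => //; exact: bounded_mfun_cst.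
- move=> x y Xx Xy; have /andP[h1 h2] := ab x y Xx Xy.
  by rewrite normrM !ger0_norm ?Pm_ge0// ?ler_wpM2r ?Pm_ge0// (le_trans (ltW a0)).
Qed.

(** Multiplying and dividing by [beta] turns the BP equation into an average of the functions
    [Gam d ^~ y] over y, which is what the algorithm estimates by sampling. *)
Lemma fixed_point_mixture d :
  {ae mu, forall x, X x -> mstar d x = \int[mu]_(y in X) (Gam d x y * q d y)}.
Proof.
apply: (ae_impl (bp.2 d)) => x xE Xx; rewrite -xE// /bp_update sum_bp_integral.
have [b [b' [b0 bb']]] := beta_bounds d.
have [a [a' [a0 aa']]] := kernel_bounds d.
have bK : bounded_mfun X (fun y => edge_pot M (dst d) (src d) x y * node_pot M (src d) y).
  split; last first.
    exists a' => y Xy; have /andP[h1 h2] := aa' x y Xx Xy.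
    by rewrite ger0_norm// (le_trans (ltW a0)).
  by apply: measurable_funM; [exact: edge_pot_measurable2|exact: node_pot_measurable].
rewrite /bp_integral -RintegralZr//; last exact: (integrable_mulbounded mX bK (iPm d)).
apply: eq_Rintegral => y /set_mem Xy; rewrite /q /Wstar /Gam -/(Pm d y).
have /andP[h1 _] := bb' y Xy.
by field; rewrite !gt_eqF// (lt_le_trans b0).
Qed.

(** This is the integral defining [sample_drift], with the limiting density in place of the current
    one; the bias is thus governed by the difference of two densities. *)
Lemma fixed_point_coef d j :
  dotL2 M (mstar d) (phi j) = \int[mu]_(y in X) (g d j y * q d y).
Proof.
have phi2 : L2 M (phi j) by case: onb.
have mphi := L2_measurable phi2; have iphi := L2_integrable phi2.
have [K K0 GK] := Gam_bounds d.
have mF : measurable_fun (X `*` X) (fun p : T * T => Gam d p.1 p.2 * q d p.2 * phi j p.1).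
  apply: measurable_funM.
    apply: measurable_funM; first exact: Gam_measurable.
    apply: (measurable_comp mX _ (f := q d)); last exact: measurable_funTS.
      by move=> _ [[x y] [_ ?] <-].
    by apply/measurable_EFinP; exact: measurable_int (iq d).
  apply: (measurable_comp mX _ mphi) => //; last exact: measurable_funTS.
  by move=> _ [[x y] [? _] <-].
transitivity (\int[mu]_(x in X) \int[mu]_(y in X) (Gam d x y * q d y * phi j x)).
  congr fine; apply: ae_eq_integral => //.
  - by apply/measurable_EFinP; apply: measurable_funM.
  - apply/measurable_EFinP.
    exact: (@measurable_Rintegral_param _ _ T T R mu X X
      (fun x y => Gam d x y * q d y * phi j x)).
  - apply: (ae_impl (fixed_point_mixture d)) => x xE Xx; rewrite xE//; congr EFin.
    rewrite -RintegralZr//; apply: integrable_mulbounded => //.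
    split; last by exists K => y Xy; have /andP[? ?] := GK x y Xx Xy; rewrite ger0_norm.
    apply: (measurable_comp (measurableX mX mX) _ (Gam_measurable d)
      (measurable_funTS (pair1_measurable x))).
    by move=> _ [y Xy <-].
rewrite (@Rintegral_fubini_in _ _ T T R mu mu X X _ (fun x => K * `|phi j x|) (q d))//.
- apply: eq_Rintegral => y /set_mem Xy; rewrite /g /dotL2 -RintegralZr//.
    by apply: eq_Rintegral => x _; ring.
  apply: integrable_mulbounded => //.
  split; last by exists K => x Xx; have /andP[? ?] := GK x y Xx Xy; rewrite ger0_norm.
  apply: (measurable_comp (measurableX mX mX) _ (Gam_measurable d)
    (measurable_funTS (pair2_measurable y))).
  by move=> _ [x Xx <-].
- by apply: integrableX_cM => //; exact: integrableX_norm.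
- move=> x y Xx Xy; have /andP[h1 h2] := GK x y Xx Xy.
  rewrite normrM [X in X * _ <= _]normrM (ger0_norm h1) (ger0_norm (q_ge0 d Xy)) mulrAC.
  by rewrite ler_wpM2r ?q_ge0// ler_wpM2r.
Qed.

(** Pi^r(Gamma(x,y)), arranged as a function of [y]: for every [x] it is a combination of the same
    [r] functions [g d j]. *)
Let h d x y := \sum_(j < r) phi j x * g d j y.

Let h_ge d x y : X x -> X y -> inf_proj_Gam phi r d x <= h d x y.
Proof.
move=> Xx Xy; have [I0 _] := incoh d Xx.
have -> : h d x y = proj_basis M phi r (Gam d ^~ y) x.
  by apply: eq_bigr => j _; rewrite mulrC.
apply: ge_inf; last by exists y.
(* An infimum that does not exist is 0 by convention, so its positivity guarantees a lower bound. *)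
by apply: contrapT => nlb; move: I0; rewrite /inf_proj_Gam inf_out ?ltxx// => -[].
Qed.

Let h_gt0 d x y : X x -> X y -> 0 < h d x y.
Proof. by move=> Xx Xy; have [I0 _] := incoh d Xx; exact: lt_le_trans (h_ge d Xx Xy). Qed.

Lemma proj_fixed_pointE d x :
  proj_basis M phi r (mstar d) x = \int[mu]_(y in X) (h d x y * q d y).
Proof.
transitivity (\int[mu]_(y in X) (\sum_(j < r) phi j x * (g d j y * q d y))).
  rewrite Rintegral_sum//; last first.
    move=> j; apply: integrableX_cM => //; apply: integrable_mulbounded => //.
    exact: coef_bounded.
  apply: eq_bigr => j _; rewrite RintegralZl//; last first.
    by apply: integrable_mulbounded => //; exact: coef_bounded.
  by rewrite mulrC fixed_point_coef.
by apply: eq_Rintegral => y _; rewrite /h mulr_suml; apply: eq_bigr => j _; rewrite mulrA.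
Qed.

Let h_bounded d x : bounded_mfun X (h d x).
Proof. by apply: bounded_mfun_sum => j _; apply: bounded_mfunZ; exact: coef_bounded. Qed.

Let proj_ge d x : X x -> inf_proj_Gam phi r d x <= proj_basis M phi r (mstar d) x.
Proof.
move=> Xx; rewrite proj_fixed_pointE -[leLHS]mulr1 -(q_int1 d) -RintegralZl//.
apply: le_Rintegral => //; first exact: integrableX_cM.
  exact: integrable_mulbounded.
by move=> y Xy; rewrite ler_wpM2r ?q_ge0// h_ge.
Qed.

(** With I the infimum in the hypothesis, Pi^r(mstar) is an average of values at least I and the
    residual is at least -I/2, so mstar >= I/2 at every point. *)
Lemma fixed_point_gt0 d x : X x -> 0 < mstar d x.
Proof.
move=> Xx; have [I0] := incoh d Xx; rewrite ler_norml => /andP[+ _].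
by have := proj_ge d Xx; rewrite /proj_residual; lra.
Qed.

(** The residual is at least -I/2, hence at least -Pi^r(mstar)/2, so mstar is at least half of
    Pi^r(mstar). *)
Lemma proj_le_fixed_point d x : X x ->
  proj_basis M phi r (mstar d) x <= 2 * mstar d x.
Proof.
move=> Xx; have [I0] := incoh d Xx; rewrite ler_norml => /andP[+ _].
by have := proj_ge d Xx; rewrite /proj_residual; lra.
Qed.

Let q_gt0 d y : X y -> 0 < q d y.
Proof.
move=> Xy; have [a [b [a0 ab]]] := beta_bounds d; have /andP[h1 _] := ab y Xy.
apply: divr_gt0 => //; apply: mulr_gt0; first exact: lt_le_trans h1.
by apply: prodr_gt0 => f _; exact: fixed_point_gt0.
Qed.

Lemma fixed_point_ae_bounded d : exists2 K, 0 <= K &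
  {ae mu, forall x, X x -> mstar d x <= K}.
Proof.
have [K K0 GK] := Gam_bounds d; exists K => //.
apply: (ae_impl (fixed_point_mixture d)) => x xE Xx; rewrite xE//.
rewrite -[leRHS]mulr1 -(q_int1 d) -RintegralZl//.
apply: le_Rintegral => //; last 2 first.
- exact: integrableX_cM.
- by move=> y Xy; have /andP[_ ?] := GK x y Xx Xy; rewrite ler_wpM2r ?q_ge0.
apply: integrable_mulbounded => //.
split; last by exists K => y Xy; have /andP[? ?] := GK x y Xx Xy; rewrite ger0_norm.
apply: (measurable_comp (measurableX mX mX) _ (Gam_measurable d)
  (measurable_funTS (pair1_measurable x))).
by move=> _ [y Xy <-].
Qed.

(* The set of good y does not depend on x, so almost surely every sample lies in it. *)
Lemma proj_Gam_ae_bounded d : exists2 K, 0 <= K &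
  {ae mu, forall y, X y -> {ae mu, forall x, X x -> h d x y <= K}}.
Proof.
have [L L0 mL] := fixed_point_ae_bounded d.
have [K K0 KP] := nonneg_combination_le_mean mX (iq d) (@q_gt0 d) (g := g d) (r := r)
  (fun j _ => coef_bounded d j).
(* The mean of [h d x] under [q d] is Pi^r(mstar)(x), at most 2 mstar(x) and so almost everywhere at
   most [2 * L]. *)
exists (K * (2 * L)); first by rewrite !mulr_ge0.
apply: (ae_impl KP) => y yP Xy; apply: (ae_impl mL) => x xP Xx.
apply: (yP Xy (fun j => phi j x)); first by move=> z Xz; exact: ltW (h_gt0 d Xx Xz).
rewrite -/(h d x) -proj_fixed_pointE (le_trans (proj_le_fixed_point d Xx))//.
by rewrite ler_wpM2l// xP.
Qed.

Lemma fixed_coef_le d j : `|dotL2 M (mstar d) (phi j)| <= Bcoef M phi j.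
Proof.
rewrite fixed_point_coef; apply: Rintegral_weighted_norm_le => //.
- by move=> y; exact: q_ge0.
- by rewrite q_int1.
- exact: coef_bounded.
- exact: Bcoef_ge0.
- by move=> y; exact: coef_le_Bcoef.
Qed.

Lemma sampling_coef_le (mm : dedge M -> T -> R) d j :
  (forall f, measurable_fun X (mm f)) ->
  `|\int[mu]_(y in X) (g d j y * sampling_density mm d y)| <= Bcoef M phi j.
Proof.
move=> mmm; have [ip p0 p1] := sampling_density_subprob d mmm.
apply: Rintegral_weighted_norm_le => //.
- exact: coef_bounded.
- exact: Bcoef_ge0.
- by move=> y; exact: coef_le_Bcoef.
Qed.

Let sigma := \sum_(j < r) Bcoef M phi j ^+ 2.

(** The bias of coefficient [j] is at most B_j times the L^1 distance of the two densities.
    [normalized_diff_le] passes to the unnormalised weights, [prod_diff_le] to the single messages,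
    and Cauchy-Schwarz to L^2. Upper bounds on the messages suffice because the weights contain
    positive parts; [L] depends on [mm] only through [C]. *)
Lemma sampling_bias_le d (C : R) : 1 <= C ->
  (forall f, {ae mu, forall x, X x -> mstar f x <= C}) ->
  exists2 L, 0 <= L & forall mm : dedge M -> T -> R,
    (forall f, L2 M (mm f)) ->
    (forall f, {ae mu, forall x, X x -> mm f x <= C}) ->
    (0 < \int[mu]_(y in X) (sampling_weight mm d y)%:E < +oo)%E ->
    \sum_(j < r) (\int[mu]_(y in X) (g d j y * sampling_density mm d y)
                  - dotL2 M (mstar d) (phi j)) ^+ 2 <=
    L * \sum_(f | feeds d f) sqnormL2 M (fun x => mm f x - mstar f x).
Proof.
move=> C1 msC; have C0 : 0 <= C by rewrite (le_trans _ C1).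
have [a [b [a0 ab]]] := beta_bounds d.
pose D := size (index_enum (dedge M)).
pose G := 2 / Zs d * (`|b| * C ^+ D).
have G0 : 0 <= G.
  apply: mulr_ge0; first by apply: divr_ge0 => //; exact: ltW (Zs_gt0 d).
  by apply: mulr_ge0 => //; exact: exprn_ge0.
(* [sigma] collects the B_j^2, [G] is the Lipschitz constant in L^1, and [D%:R] and [m] come from
   Cauchy-Schwarz over the edges and over the state space. *)
exists (sigma * (G ^+ 2 * (D%:R * m))).
  apply: mulr_ge0; first by apply: sumr_ge0 => j _; rewrite sqr_ge0.
  by rewrite mulr_ge0 ?sqr_ge0// mulr_ge0// ltW.
move=> mm mm2 mmC Wfin.
have mmm f : measurable_fun X (mm f) by exact: L2_measurable.
have mW := sampling_weight_measurable d mmm.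
have W0 y : X y -> 0 <= sampling_weight mm d y by exact: sampling_weight_ge0.
have iW : integrableX (sampling_weight mm d).
  apply/integrableP; split; first exact/measurable_EFinP.
  rewrite (eq_integral (fun y => (sampling_weight mm d y)%:E)); last first.
    by move=> y /set_mem Xy; rewrite /= ger0_norm// W0.
  by have /andP[] := Wfin.
have Z0 : 0 < \int[mu]_(y in X) sampling_weight mm d y by exact: fine_gt0.
pose J f := \int[mu]_(y in X) `|mm f y - mstar f y|.
have idiff f : integrableX (fun y => mm f y - mstar f y).
  by apply: integrableX_B => //; exact: L2_integrable.
have WJ : \int[mu]_(y in X) `|sampling_weight mm d y - Wstar d y| <=
    `|b| * C ^+ D * \sum_(f | feeds d f) J f.
  apply: (@le_trans _ _ (\int[mu]_(y in X) (`|b| * C ^+ D *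
      \sum_f (if feeds d f then `|mm f y - mstar f y| else 0)))); last first.
    have icond f : integrableX (fun y => if feeds d f then `|mm f y - mstar f y| else 0).
      case: (feeds d f); first exact: (integrableX_norm (idiff f)).
      by apply: bounded_mfun_integrable => //; exact: bounded_mfun_cst.
    rewrite RintegralZl//; last by apply: integrableX_sum => // f _; exact: icond.
    rewrite Rintegral_sum// [in leRHS]big_mkcond/=.
    rewrite le_eqVlt; apply/orP; left; apply/eqP; congr (_ * _).
    by apply: eq_bigr => f _; case: (feeds d f) => //; rewrite Rintegral_cst// mul0r.
  apply: ae_le_Rintegral => //.
  - by apply: integrableX_norm; exact: integrableX_B.
  - apply: integrableX_cM => //; apply: integrableX_sum => // f _.
    case: (feeds d f); first exact: (integrableX_norm (idiff f)).
    by apply: bounded_mfun_integrable => //; exact: bounded_mfun_cst.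
  - move=> y Xy; rewrite !mulr_ge0 ?exprn_ge0//; apply: sumr_ge0 => f _.
    by case: ifP.
  have msC' : {ae mu, forall x f, X x -> mstar f x <= C}.
    exact: (@filter_forall T _ _ _ (ae_filter_ringOfSetsType mu) msC).
  have mmC' : {ae mu, forall x f, X x -> mm f x <= C}.
    exact: (@filter_forall T _ _ _ (ae_filter_ringOfSetsType mu) mmC).
  apply: (ae_impl (@filterI T _ (ae_filter_ringOfSetsType mu) _ _ msC' mmC')).
  move=> y [msy mmy] Xy; rewrite /Wstar /sampling_weight -mulrBr normrM -mulrA.
  have /andP[h1 h2] := ab y Xy; apply: ler_pM => //.
    rewrite ger0_norm ?(le_trans (ltW a0))//.
    by rewrite (le_trans h2)// ler_norm.
  apply: (@le_trans _ _ (C ^+ D *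
      \sum_(f | feeds d f) `|Num.max 0 (mm f y) - mstar f y|)).
    rewrite /Pm.
    apply: (@le_trans _ _ (`|\prod_(f | feeds d f) Num.max 0 (mm f y) -
        \prod_(f | feeds d f) Num.max 0 (mstar f y)|)).
      rewrite [X in `|_ - X|](eq_bigr (fun f => Num.max 0 (mstar f y)))// => f _.
      by rewrite max_r// ms_ge0.
    have clip v : v <= C -> 0 <= Num.max 0 v <= C.
      by move=> vC; rewrite le_max lexx /= ge_max C0 vC.
    apply: (le_trans (prod_diff_le _ _ C1 _ _)).
    - by move=> f; apply: clip; exact: mmy.
    - by move=> f; apply: clip; exact: msy.
    rewrite ler_wpM2l ?exprn_ge0// ler_sum// => f _.
    by rewrite [Num.max 0 (mstar f y)]max_r// ms_ge0.
  (* Taking the positive part does not increase the distance to the nonnegative [mstar f y]. *)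
  rewrite ler_wpM2l ?exprn_ge0// [leLHS]big_mkcond; apply: ler_sum => f _.
  case: ifP => // _; have := ms_ge0 f Xy.
  case: (leP 0 (mm f y)) => // mm0 ms0.
  by rewrite sub0r normrN ger0_norm// ler0_norm; lra.
have pq : \int[mu]_(y in X) `|sampling_density mm d y - q d y| <=
    G * \sum_(f | feeds d f) J f.
  apply: (le_trans (normalized_diff_le mX iW (iWstar d) W0 Z0 (Zs_gt0 d))).
  rewrite /G -[2 / _ * _ * _]mulrA ler_wpM2l// divr_ge0// ltW//.
  exact: Zs_gt0.
have [ip p0 p1] := sampling_density_subprob d mmm.
have ipq : integrableX (fun y => sampling_density mm d y - q d y) by exact: integrableX_B.
have SJ0 : 0 <= \sum_(f | feeds d f) J f by apply: sumr_ge0 => f _; exact: Rintegral_ge0.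
have step (j : 'I_r) : (\int[mu]_(y in X) (g d j y * sampling_density mm d y)
    - dotL2 M (mstar d) (phi j)) ^+ 2 <=
    Bcoef M phi j ^+ 2 * (G * \sum_(f | feeds d f) J f) ^+ 2.
  rewrite fixed_point_coef -RintegralB//; last 2 first.
  - by apply: integrable_mulbounded => //; exact: coef_bounded.
  - by apply: integrable_mulbounded => //; exact: coef_bounded.
  have ig : integrableX (fun y => g d j y * (sampling_density mm d y - q d y)).
    by apply: integrable_mulbounded => //; exact: coef_bounded.
  rewrite -exprMn -real_normK ?num_real// lerXn2r ?nnegrE//.
    by rewrite mulr_ge0 ?Bcoef_ge0// mulr_ge0.
  under eq_Rintegral do rewrite -mulrBr.
  apply: (le_trans (le_normr_Rintegral mX ig)).
  apply: (@le_trans _ _ (\int[mu]_(y in X)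
      (Bcoef M phi j * `|sampling_density mm d y - q d y|))).
    apply: le_Rintegral => //.
    - exact: integrableX_norm.
    - by apply: integrableX_cM => //; exact: integrableX_norm.
    - by move=> y Xy; rewrite normrM ler_wpM2r// coef_le_Bcoef.
  rewrite RintegralZl//; last exact: integrableX_norm.
  by rewrite ler_wpM2l// Bcoef_ge0.
apply: (le_trans (ler_sum _ (fun j _ => step j))).
rewrite -mulr_suml -/sigma.
set Q := \sum_(f | feeds d f) sqnormL2 _ _.
have -> : sigma * (G ^+ 2 * (D%:R * m)) * Q = sigma * (G ^+ 2 * (D%:R * (m * Q))) by ring.
apply: ler_wpM2l; first by apply: sumr_ge0 => j _; rewrite sqr_ge0.
rewrite exprMn ler_wpM2l ?sqr_ge0// /Q {Q}.
rewrite big_mkcond/= [in leRHS]big_mkcond/=.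
apply: (le_trans (sqr_sum_le _ _)); rewrite -/D ler_wpM2l// mulr_sumr.
apply: ler_sum => f _; case: ifP => _; last by rewrite expr0n mulr0.
have ldiff : L2 M (fun x => mm f x - mstar f x).
  rewrite (_ : (fun _ => _) = (fun x => mm f x + -1 * mstar f x)).
    by apply: L2D => //; exact: L2Z.
  by apply/funext => x; rewrite mulN1r.
apply: (sqr_Rintegral_norm_le mX muX state_measure_gt0).
  exact: L2_measurable.
exact: L2_mul_integrable.
Qed.

Let message_bound : exists2 C, 1 <= C &
  (forall f, {ae mu, forall x, X x -> mstar f x <= C}) /\
  (forall d, {ae mu, forall y, X y -> {ae mu, forall x, X x -> h d x y <= C}}).
Proof.
have /choice[K1 K1P] f : exists K, 0 <= K /\ {ae mu, forall x, X x -> mstar f x <= K}.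
  by have [K ? ?] := fixed_point_ae_bounded f; exists K.
have /choice[K2 K2P] d : exists K, 0 <= K /\
    {ae mu, forall y, X y -> {ae mu, forall x, X x -> h d x y <= K}}.
  by have [K ? ?] := proj_Gam_ae_bounded d; exists K.
have K0 f : 0 <= K1 f + K2 f by rewrite addr_ge0 ?(K1P f).1 ?(K2P f).1.
pose C := 1 + \sum_f (K1 f + K2 f).
have KC f : K1 f + K2 f <= C.
  by rewrite /C (bigD1 f)//= addrCA lerDl addr_ge0// sumr_ge0.
exists C; first by rewrite lerDl sumr_ge0.
split=> f.
  apply: (ae_impl (K1P f).2) => x xK Xx; rewrite (le_trans (xK Xx))//.
  by rewrite (le_trans _ (KC f))// lerDl (K2P f).1.
apply: (ae_impl (K2P f).2) => y yK Xy; apply: (ae_impl (yK Xy)) => x xK Xx.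
by rewrite (le_trans (xK Xx))// (le_trans _ (KC f))// lerDr (K1P f).1.
Qed.

(** A deterministic statement about every admissible sequence of samples: chance enters only through
    the sums of noises on the right. [L] and [good] are fixed before [k] and the samples. *)
Lemma sosmp_error_recursion : exists (L : dedge M -> R) (good : dedge M -> set T),
  [/\ forall d, 0 <= L d, forall d, {ae mu, forall y, X y -> good d y} &
  forall k (y : nat -> dedge M -> 'I_k -> T), (0 < k)%N ->
    (forall t d i, X (y t d i)) -> (forall t d i, good d (y t d i)) ->
    (forall t d, (0 < \int[mu]_(z in X)
       (sampling_weight (sosmp_msg phi r eta y t) d z)%:E < +oo)%E) ->
    forall t, (0 < t)%N -> forall d,
    sqnormL2 M (sosmp_error phi r eta mstar y t d) <=
      2 / t%:R ^+ 2 * \sum_(j < r)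
        (\sum_(0 <= s < t) (sample_mean y s d j - sample_drift y s d j)) ^+ 2 +
      8 * sigma / t%:R +
      t%:R^-1 * \sum_(1 <= s < t) (L d * \sum_(f | feeds d f)
        (sqnormL2 M (sosmp_error phi r eta mstar y s f) +
         sqnormL2 M (proj_residual phi r mstar f)))].
Proof.
have [C C1 [msC hC]] := message_bound.
have /choice[L LP] d : exists L, 0 <= L /\ forall mm : dedge M -> T -> R,
    (forall f, L2 M (mm f)) -> (forall f, {ae mu, forall x, X x -> mm f x <= C}) ->
    (0 < \int[mu]_(y in X) (sampling_weight mm d y)%:E < +oo)%E ->
    \sum_(j < r) (\int[mu]_(y in X) (g d j y * sampling_density mm d y)
                  - dotL2 M (mstar d) (phi j)) ^+ 2 <=
    L * \sum_(f | feeds d f) sqnormL2 M (fun x => mm f x - mstar f x).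
  by have [L ? ?] := sampling_bias_le d C1 msC; exists L.
(* One factor 2 comes from separating noise and bias, the other from writing a message minus [mstar]
   as error minus residual. *)
exists (fun d => 4 * L d), (fun d y => {ae mu, forall x, X x -> h d x y <= C}).
split=> [d|d|k y k0 yX ygood Wfin t]; first by rewrite mulr_ge0// (LP d).1.
  exact: hC.
have msg2 s f : L2 M (sosmp_msg phi r eta y s f) by exact: expansion_L2.
(* At positive times a message is an average of values [h f x y] over good samples [y], hence at
   most [C]. *)
have msgC s f : {ae mu, forall x, X x -> sosmp_msg phi r eta y s.+1 f x <= C}.
  have hall : {ae mu, forall x (u : 'I_s.+1) (i : 'I_k), X x -> h f x (y u f i) <= C}.
    apply: (@filter_forall T _ _ _ (ae_filter_ringOfSetsType mu)) => u.
    apply: (@filter_forall T _ _ _ (ae_filter_ringOfSetsType mu)) => i.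
    exact: ygood.
  apply: (ae_impl hall) => x xh Xx.
  have kR : 0 < k%:R :> R by rewrite ltr0n.
  have sR : 0 < s.+1%:R :> R by rewrite ltr0n.
  have -> : sosmp_msg phi r eta y s.+1 f x =
      (\sum_(u < s.+1) (\sum_(i < k) h f x (y u f i)) / k%:R) / s.+1%:R.
    rewrite /sosmp_msg /expansion; under eq_bigr do rewrite sosmp_coef_mean -mulrA mulr_suml.
    rewrite -mulr_sumr mulrC; congr (_ / _); rewrite exchange_big big_mkord.
    apply: eq_bigr => u _; rewrite [RHS]mulr_suml.
    under [RHS]eq_bigr do rewrite /h mulr_suml.
    rewrite [RHS]exchange_big/=; apply: eq_bigr => j _.
    rewrite /sample_mean -mulrA mulr_suml mulr_sumr; apply: eq_bigr => i _.
    by rewrite /g; ring.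
  rewrite ler_pdivrMr//; apply: (@le_trans _ _ (\sum_(u < s.+1) C)).
    apply: ler_sum => u _; rewrite ler_pdivrMr//.
    apply: (@le_trans _ _ (\sum_(i < k) C)); first by apply: ler_sum => i _; exact: xh.
    by rewrite sumr_const card_ord mulr_natr.
  by rewrite sumr_const card_ord mulr_natr.
case: t => // t _ d.
have tR : 0 < t.+1%:R :> R by rewrite ltr0n.
pose bias s (j : 'I_r) := sample_drift y s d j - dotL2 M (mstar d) (phi j).
pose S (j : 'I_r) := \sum_(0 <= s < t.+1) (sample_mean y s d j - sample_drift y s d j).
have errE (j : 'I_r) : sosmp_coef phi eta y t.+1 d j - dotL2 M (mstar d) (phi j) =
    t.+1%:R^-1 * (S j + \sum_(0 <= s < t.+1) bias s j).
  rewrite sosmp_coef_mean /S -big_split/=.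
  under [X in _ = _ * X]eq_bigr do rewrite /bias addrA subrK.
  rewrite sumrB mulrBr; congr (_ - _).
  rewrite big_const_nat subn0 iter_addr addr0 -(mulr_natl (dotL2 M _ _)) mulrA mulVf ?mul1r//.
have coef_sq (j : 'I_r) :
    (sosmp_coef phi eta y t.+1 d j - dotL2 M (mstar d) (phi j)) ^+ 2 <=
    2 / t.+1%:R ^+ 2 * S j ^+ 2 + 2 / t.+1%:R * \sum_(0 <= s < t.+1) bias s j ^+ 2.
  have := sqr_sum_le (index_iota 0 t.+1) (fun s => bias s j).
  rewrite size_iota subn0 errE exprMn; set B := \sum_(_ <- _) _; set Q := \sum_(_ <- _) _.
  move=> BQ.
  have -> : 2 / t.+1%:R * Q = t.+1%:R^-1 ^+ 2 * (2 * (t.+1%:R * Q)).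
    by field; exact: lt0r_neq0.
  rewrite [2 / _ * _](_ : _ = t.+1%:R^-1 ^+ 2 * (2 * S j ^+ 2)); last first.
    by field; exact: lt0r_neq0.
  rewrite -mulrDr ler_wpM2l ?sqr_ge0//.
  by have := sqr_ge0 (S j - B); move: BQ; lra.
rewrite sosmp_error_sqnorm; apply: (le_trans (ler_sum _ (fun j _ => coef_sq j))).
rewrite big_split/= -[X in X + _ <= _]mulr_sumr -[X in _ + X <= _]mulr_sumr -addrA lerD2l exchange_big/=.
(* Time 0 has no bound on the message; drift and target are each at most B_j in absolute value. *)
have bias0 : \sum_(j < r) bias 0%N j ^+ 2 <= 4 * sigma.
  rewrite /sigma mulr_sumr; apply: ler_sum => j _.
  have b1 := sampling_coef_le d j (fun f => L2_measurable (msg2 0%N f)).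
  have b2 := fixed_coef_le d j.
  have : `|bias 0%N j| <= 2 * Bcoef M phi j.
    by rewrite (le_trans (ler_normB _ _))// mulr_natl mulr2n lerD.
  have := Bcoef_ge0 j; rewrite -(real_normK (num_real (bias _ _))).
  by move: `|bias 0%N j| (normr_ge0 (bias 0%N j)) => z; nra.
have biass s : \sum_(j < r) bias s.+1 j ^+ 2 <= 2 * L d * \sum_(f | feeds d f)
    (sqnormL2 M (sosmp_error phi r eta mstar y s.+1 f) +
     sqnormL2 M (proj_residual phi r mstar f)).
  apply: (le_trans ((LP d).2 _ (msg2 s.+1) (msgC s) (Wfin _ d))).
  rewrite -mulrA mulrCA ler_wpM2l ?(LP d).1// mulr_sumr; apply: ler_sum => f _.
  have -> : (fun x => sosmp_msg phi r eta y s.+1 f x - mstar f x) =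
      (fun x => sosmp_error phi r eta mstar y s.+1 f x - proj_residual phi r mstar f x).
    by apply/funext => x; rewrite /sosmp_error /proj_residual; ring.
  apply: sqnorm_diff_le.
    rewrite /sosmp_error (_ : (fun _ => _) = (fun x => sosmp_msg phi r eta y s.+1 f x +
      -1 * proj_basis M phi r (mstar f) x)); last by apply/funext => x; rewrite mulN1r.
    by apply: L2D => //; apply: L2Z; exact: proj_basis_L2.
  rewrite /proj_residual (_ : (fun _ => _) = (fun x => mstar f x +
    -1 * proj_basis M phi r (mstar f) x)); last by apply/funext => x; rewrite mulN1r.
  by apply: L2D => //; apply: L2Z; exact: proj_basis_L2.
rewrite big_ltn// mulrDr lerD//.
  have -> : 8 * sigma / t.+1%:R = 2 / t.+1%:R * (4 * sigma) by ring.
  by rewrite ler_wpM2l// divr_ge0// ltW.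
rewrite [2 / _]mulrC -mulrA ler_wpM2l ?invr_ge0// [leLHS]mulr_sumr.
rewrite [leLHS]big_nat_cond [leRHS]big_nat_cond; apply: ler_sum => s.
rewrite andbT; case: s => // s _.
rewrite -mulrA (_ : 4 * _ = 2 * (2 * L d * \sum_(f | feeds d f)
    (sqnormL2 M (sosmp_error phi r eta mstar y s.+1 f) +
     sqnormL2 M (proj_residual phi r mstar f)))); last by ring.
by rewrite ler_wpM2l.
Qed.

(** * The error recursion almost surely and in mean *)

Section Convergence.
Context {dO : measure_display} {Omega : measurableType dO}.
Variables (P : probability Omega R) (k : nat).
Variable Y : nat -> dedge M -> 'I_k -> {RV P >-> borel_rV R n}.
Hypothesis k_gt0 : (0 < k)%N.
Hypothesis draws : sosmp_draws Y phi r eta.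

Let err t d w := sqnormL2 M (sosmp_error phi r eta mstar (samples_at Y w) t d).
Let res d := sqnormL2 M (proj_residual phi r mstar d).

Let YX w t d i : X (samples_at Y w t d i). Proof. by case: draws => YX _ _; exact: YX. Qed.
Let mY t s d i : (s < t)%N -> measurable_fun setT (fun w => samples_at Y w s d i : T).
Proof. by move=> _; exact: measurable_funPT. Qed.

Lemma sqnorm_error_bounded t d : bounded_mfun setT (err t d).
Proof.
rewrite (_ : err t d = fun w => \sum_(j < r) (sosmp_coef phi eta (samples_at Y w) t d j -
    dotL2 M (mstar d) (phi j)) ^+ 2).
  apply: bounded_mfun_sum => j _; apply: bounded_mfun_sqr; apply: bounded_mfunB.
    exact: (@sosmp_coef_bounded _ Omega k (samples_at Y) t (@mY t) YX t d j (leqnn t)).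
  exact: bounded_mfun_cst.
by apply/funext => w; rewrite /err sosmp_error_sqnorm.
Qed.

Lemma sqnorm_error_ge0 t d w : 0 <= err t d w.
Proof. by apply: Rintegral_ge0 => x _; rewrite -expr2 sqr_ge0. Qed.

Lemma sqnorm_error_le t d w : (0 < t)%N -> err t d w <= 4 * sigma.
Proof.
case: t => // t _; rewrite /err sosmp_error_sqnorm /sigma mulr_sumr.
apply: ler_sum => j _; have tR : 0 < t.+1%:R :> R by rewrite ltr0n.
have a1 : `|sosmp_coef phi eta (samples_at Y w) t.+1 d j| <= Bcoef M phi j.
  rewrite sosmp_coef_mean normrM (@ger0_norm _ t.+1%:R^-1) ?invr_ge0// ler_pdivrMl//.
  apply: (le_trans (ler_norm_sum _ _ _)).
  apply: (@le_trans _ _ (\sum_(0 <= s < t.+1) Bcoef M phi j)).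
    by apply: ler_sum => s _; apply: sample_mean_le => // t' d' i'; exact: YX.
  by rewrite big_const_nat subn0 iter_addr addr0 mulr_natl.
have a2 := fixed_coef_le d j.
set z := _ - _; have : `|z| <= 2 * Bcoef M phi j.
  by rewrite (le_trans (ler_normB _ _))// mulr_natl mulr2n lerD.
have := Bcoef_ge0 j; rewrite -(real_normK (num_real z)).
by move: `|z| (normr_ge0 z) => u; nra.
Qed.

Let noise d j s w :=
  sample_mean (samples_at Y w) s d j - sample_drift (samples_at Y w) s d j.

Let noise_b d j s : bounded_mfun setT (noise d j s).
Proof.
apply: bounded_mfunB.
  exact: (@sample_mean_bounded _ Omega k (samples_at Y) s.+1 (@mY s.+1) YX s d j (ltnSn s)).
exact: (@sample_drift_bounded _ Omega k (samples_at Y) s (@mY s) YX s d j (leqnn s)).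
Qed.

(** The pathwise recursion is used twice with the same [L]: the strong law makes the noise term
    vanish almost surely, and orthogonality bounds its expectation. *)
Lemma stochastic_recursion : exists L : dedge M -> R,
  [/\ forall d, 0 <= L d,
  {ae P, forall w, exists2 b : nat -> dedge M -> R,
    (forall d eps, 0 < eps -> exists t0, forall t, (t0 <= t)%N -> b t d <= eps) &
    forall t, (0 < t)%N -> forall d, err t d w <= b t d +
      t%:R^-1 * \sum_(1 <= s < t) (L d * \sum_(f | feeds d f) (err s f w + res f))} &
  forall t, (0 < t)%N -> forall d, \int[P]_w err t d w <= 16 * sigma / t%:R +
    t%:R^-1 * \sum_(1 <= s < t) (L d * \sum_(f | feeds d f) (\int[P]_w err s f w + res f))].
Proof.
have [L [good [L0 goodP recP]]] := sosmp_error_recursion.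
have sigma0 : 0 <= sigma by apply: sumr_ge0 => j _; rewrite sqr_ge0.
pose S d (j : 'I_r) t w := \sum_(0 <= s < t) noise d j s w.
have aerec : {ae P, forall w, forall t, (0 < t)%N -> forall d, err t d w <=
    2 / t%:R ^+ 2 * \sum_(j < r) S d j t w ^+ 2 + 8 * sigma / t%:R +
    t%:R^-1 * \sum_(1 <= s < t) (L d * \sum_(f | feeds d f) (err s f w + res f))}.
  have [_ Wfin _] := draws.
  have Wfin' : {ae P, forall w, forall t d, (0 < \int[mu]_(y in X)
      (sampling_weight (sosmp_msg phi r eta (samples_at Y w) t) d y)%:E < +oo)%E}.
    apply: ae_foralln => t.
    by apply: (@filter_forall Omega _ _ _ (ae_filter_ringOfSetsType P)) => d; exact: Wfin.
  have goodY := samples_ae draws goodP.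
  apply: (ae_impl (@filterI Omega _ (ae_filter_ringOfSetsType P) _ _ Wfin' goodY)).
  by move=> w [Ww gw] t t0 d; exact: (recP k (samples_at Y w) k_gt0 (YX w) gw Ww t t0 d).
exists L; split=> //.
- have slln : {ae P, forall w, forall d (j : 'I_r),
      (fun t => t%:R^-1 * S d j t w) @ \oo --> (0 : R)}.
    apply: (@filter_forall Omega _ _ _ (ae_filter_ringOfSetsType P)) => d.
    apply: (@filter_forall Omega _ _ _ (ae_filter_ringOfSetsType P)) => j.
    apply: (@orthogonal_strong_law _ Omega R P (noise d j) (2 * Bcoef M phi j)).
    - by move=> s; case: (noise_b d j s).
    - by move=> s w; exact: noise_le.
    - by move=> s t st; exact: noise_orthogonal.
  apply: (ae_impl (@filterI Omega _ (ae_filter_ringOfSetsType P) _ _ aerec slln)).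
  move=> w [wrec wS].
  exists (fun t d => 2 / t%:R ^+ 2 * \sum_(j < r) S d j t w ^+ 2 + 8 * sigma / t%:R).
    move=> d eps eps0.
    (* The minimum with 1 gives [del ^+ 2 <= del], so that twice [r] squares stay below [eps / 2];
       [r.+1] avoids a division by 0. *)
    pose del := Num.min 1 (eps / (4 * r.+1%:R)).
    have r4 : 0 < 4 * r.+1%:R :> R by rewrite mulr_gt0.
    have del0 : 0 < del by rewrite lt_min ltr01 divr_gt0.
    have /choice[t1 t1P] (j : 'I_r) : exists t1, forall t, (t1 <= t)%N ->
        `|t%:R^-1 * S d j t w| <= del.
      have /cvgr0Pnorm_le/(_ del del0)[t1 _ t1P] := wS d j.
      by exists t1 => t; exact: t1P.
    have [t2 t2P] : exists t2 : nat, 16 * sigma / eps <= t2%:R.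
      by exists (Num.truncn (16 * sigma / eps)).+1; rewrite ltW// truncnS_gt.
    exists (maxn 1 (maxn t2 (\max_j t1 j))) => t; rewrite !geq_max.
    move=> /and3P[t_gt0 t2t t1t].
    have tR : 0 < t%:R :> R by rewrite ltr0n.
    have h1 : 8 * sigma / t%:R <= eps / 2.
      rewrite ler_pdivrMr//; have : t2%:R <= t%:R :> R by rewrite ler_nat.
      move=> t2t'; move: (le_trans t2P t2t'); rewrite ler_pdivrMr//.
      by move: (t%:R : R) => u; lra.
    have h2 : 2 / t%:R ^+ 2 * \sum_(j < r) S d j t w ^+ 2 <= eps / 2.
      have -> : 2 / t%:R ^+ 2 * \sum_(j < r) S d j t w ^+ 2 =
          2 * \sum_(j < r) (t%:R^-1 * S d j t w) ^+ 2.
        rewrite -mulrA; congr (_ * _); rewrite mulr_sumr; apply: eq_bigr => j _.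
        by rewrite exprMn exprVn.
      apply: (@le_trans _ _ (2 * \sum_(j < r) del)).
        rewrite ler_wpM2l//; apply: ler_sum => j _.
        rewrite -(real_normK (num_real (_ * _))).
        have j1 : `|t%:R^-1 * S d j t w| <= del.
          by apply: t1P; rewrite (leq_trans _ t1t)// leq_bigmax.
        apply: (@le_trans _ _ (del ^+ 2)); first by rewrite lerXn2r ?nnegrE// ltW.
        by rewrite expr2 ger_pMr// ge_min lexx.
      rewrite sumr_const card_ord -(mulr_natl del).
      apply: (@le_trans _ _ (2 * (r.+1%:R * (eps / (4 * r.+1%:R))))).
        rewrite ler_wpM2l//; apply: ler_pM => //; first exact: ltW.
          by rewrite ler_nat.
        by rewrite ge_min lexx orbT.
      rewrite le_eqVlt; apply/orP; left; apply/eqP.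
      have : r.+1%:R != 0 :> R by rewrite pnatr_eq0.
      by move: (r.+1%:R : R) => u u0; field.
    by rewrite [eps]splitr lerD.
  by move=> t t0 d; exact: wrec.
- move=> t t0 d; have tR : 0 < t%:R :> R by rewrite ltr0n.
  have PT : (P setT < +oo)%E by rewrite [X in (X < _)%E]probability_setT ltry.
  have iP f : bounded_mfun setT f -> P.-integrable setT (EFin \o f).
    exact: prob_bounded_integrable.
  have bS j : bounded_mfun setT (S d j t) by exact: bounded_mfun_sum.
  have bS2 j : bounded_mfun setT (fun w => S d j t w ^+ 2) by exact: bounded_mfun_sqr.
  have bF s f : bounded_mfun setT
      (fun w => (L d * (feeds d f)%:R) * (err s f w + res f)).
    by apply: bounded_mfunZ; apply: bounded_mfunD;
      [exact: sqnorm_error_bounded|exact: bounded_mfun_cst].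
  pose U w := \sum_(s <- index_iota 1 t) \sum_f
    (L d * (feeds d f)%:R) * (err s f w + res f).
  have bU : bounded_mfun setT U.
    by apply: bounded_mfun_sum => s _; exact: bounded_mfun_sum.
  have condE (F : dedge M -> R) : L d * \sum_(f | feeds d f) F f =
      \sum_f (L d * (feeds d f)%:R) * F f.
    rewrite big_mkcond mulr_sumr; apply: eq_bigr => f _.
    by case: (feeds d f); rewrite ?mulr1 ?mulr0 ?mul0r.
  have UE w : \sum_(1 <= s < t) (L d * \sum_(f | feeds d f) (err s f w + res f)) = U w.
    by apply: eq_bigr => s _; rewrite condE.
  have UI : \int[P]_w U w =
      \sum_(1 <= s < t) (L d * \sum_(f | feeds d f) (\int[P]_w err s f w + res f)).
    rewrite Rintegral_sum//; last by move=> s; apply: iP; exact: bounded_mfun_sum.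
    apply: eq_bigr => s _; rewrite condE Rintegral_sum//; last by move=> f; exact: iP.
    apply: eq_bigr => f _; have be := sqnorm_error_bounded s f.
    rewrite RintegralZl//; last first.
      by apply: iP; apply: bounded_mfunD => //; exact: bounded_mfun_cst.
    rewrite RintegralD//; [|exact: iP|by apply: iP; exact: bounded_mfun_cst].
    by rewrite Rintegral_cst// [X in fine X]probability_setT mulr1.
  pose c1 : R := 2 / t%:R ^+ 2; pose c2 := 8 * sigma / t%:R.
  pose Bd w := c1 * \sum_(j < r) S d j t w ^+ 2 + (c2 + t%:R^-1 * U w).
  have bS2sum : bounded_mfun setT (fun w => \sum_(j < r) S d j t w ^+ 2).
    exact: bounded_mfun_sum.
  have bcU : bounded_mfun setT (fun w => c2 + t%:R^-1 * U w).
    by apply: bounded_mfunD; [exact: bounded_mfun_cst|exact: bounded_mfunZ].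
  have bBd : bounded_mfun setT Bd by apply: bounded_mfunD => //; exact: bounded_mfunZ.
  have U0 w : 0 <= U w.
    apply: sumr_ge0 => s _; apply: sumr_ge0 => f _.
    apply: mulr_ge0; first exact: mulr_ge0.
    apply: addr_ge0; first exact: sqnorm_error_ge0.
    by apply: Rintegral_ge0 => x _; rewrite -expr2 sqr_ge0.
  have c10 : 0 <= c1 by rewrite divr_ge0// exprn_ge0.
  have c20 : 0 <= c2 by rewrite divr_ge0 ?mulr_ge0.
  apply: (@le_trans _ _ (\int[P]_w Bd w)).
    apply: (@ae_le_Rintegral _ Omega R P setT measurableT).
    - exact/iP/sqnorm_error_bounded.
    - exact: iP.
    - by move=> w _; exact: sqnorm_error_ge0.
    - move=> w _; apply: addr_ge0; first by rewrite mulr_ge0// sumr_ge0// => j _; rewrite sqr_ge0.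
      by apply: addr_ge0 => //; rewrite mulr_ge0 ?invr_ge0.
    - apply: (ae_impl aerec) => w wrec _; have := wrec t t0 d.
      by rewrite UE /Bd addrA.
  rewrite /Bd RintegralD//; [|by apply: iP; exact: bounded_mfunZ|exact: iP].
  rewrite RintegralZl//; last exact: iP.
  rewrite RintegralD//; [|by apply: iP; exact: bounded_mfun_cst|by apply: iP; exact: bounded_mfunZ].
  rewrite [X in _ + (_ + X)]RintegralZl//; last exact: iP.
  rewrite Rintegral_cst// [X in fine X]probability_setT mulr1 UI addrA lerD2r.
  have S2 j : \int[P]_w (S d j t w ^+ 2) <= t%:R * (2 * Bcoef M phi j) ^+ 2.
    apply: (@orthogonal_sum_sqr _ Omega R P (noise d j) (2 * Bcoef M phi j)).
    - by move=> s; case: (noise_b d j s).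
    - by move=> s w; exact: noise_le.
    - by move=> s u su; exact: noise_orthogonal.
  rewrite Rintegral_sum//; last by move=> j; exact: iP.
  (* The noises are at most 2 B_j, so their squared sums contribute 2/t^2 times 4 t sigma; the other
     half is the bias at time 0. *)
  have -> : 16 * sigma / t%:R = c1 * \sum_(j < r) (t%:R * (2 * Bcoef M phi j) ^+ 2) + c2.
    have -> : \sum_(j < r) (t%:R * (2 * Bcoef M phi j) ^+ 2) = t%:R * (4 * sigma).
      by rewrite /sigma !mulr_sumr; apply: eq_bigr => j _; ring.
    by rewrite /c1 /c2; field; rewrite gt_eqF.
  by rewrite lerD2r ler_wpM2l//; apply: ler_sum => j _.
Qed.

End Convergence.

End FixedPoint.

End Model.

(** * The theorem *)

(** For a nonnegative vector, truncating each coordinate at [c] gives a nearest point of the box,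
    and its distance tends to 0 by the asymptotic bound. *)
Lemma projection_box_cvg (R : realType) (p : nat) (x : nat -> 'cV[R]_p) (c : 'cV[R]_p) :
  (forall i, 0 <= c i 0) -> (forall t i, 0 <= x t i 0) ->
  (forall i eps, 0 < eps -> exists t0, forall t, (t0 <= t)%N -> x t i 0 <= c i 0 + eps) ->
  (fun t => x t - projection (box c) (x t)) @ \oo --> (0 : 'cV[R]_p).
Proof.
move=> c0 x0 xc.
pose clip t : 'cV[R]_p := \col_i Num.min (x t i 0) (c i 0).
have clip_le t i : x t i 0 - clip t i 0 = Num.max 0 (x t i 0 - c i 0).
  by rewrite mxE; case: (leP (x t i 0) (c i 0)) => h; [rewrite max_l|rewrite max_r]; lra.
have clip_proj t : is_projection (box c) (x t) (clip t).
  split=> [i|s sbox].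
    by rewrite mxE ger0_norm ?ge_min ?lexx ?orbT// le_min x0 c0.
  apply: ler_sum => i _; rewrite clip_le; have /ler_normlP[_ sc] := sbox i.
  case: (leP 0 (x t i 0 - c i 0)) => h; last by rewrite expr0n sqr_ge0.
  by rewrite lerXn2r ?nnegrE//; lra.
have proj_le t i : (x t i 0 - projection (box c) (x t) i 0) ^+ 2 <=
    \sum_j Num.max 0 (x t j 0 - c j 0) ^+ 2.
  (* [projection] picks a nearest point by choice; one exists since [clip t] is one, and the chosen
     point is at least as near as [clip t]. *)
  have [_ /(_ _ (clip_proj t).1)] : is_projection (box c) (x t) (projection (box c) (x t)).
    by rewrite /projection; case: xgetP => [z _ //|/(_ (clip t))]; move: (clip_proj t).
  rewrite /sqdist (eq_bigr _ (fun j _ => congr1 (fun z => z ^+ 2) (clip_le t j))) => le1.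
  apply: le_trans le1; rewrite (bigD1 i)//= lerDl sumr_ge0// => j _.
  exact: sqr_ge0.
apply/cvg_ballP => eps eps0.
(* The sum of [p] squares of [del] is then at most [(eps / 2) ^+ 2]. *)
pose del := eps / 2 / p.+1%:R.
have p0 : 0 < p.+1%:R :> R by rewrite ltr0n.
have del0 : 0 < del by rewrite !divr_gt0.
have /choice[t1 t1P] i := xc i del del0.
exists (\max_i t1 i)%N => // t /= tP; split=> // i j.
rewrite (ord1 j) !mxE /ball /= sub0r normrN.
apply: (@le_lt_trans _ _ (eps / 2)); last by rewrite ltr_pdivrMr// ltr_pMr// ltr1n.
have e2 : 0 <= eps / 2 by rewrite divr_ge0// ltW.
rewrite -(@ler_pXn2r _ 2)// ?nnegrE// real_normK ?num_real//.
apply: (le_trans (proj_le t i)).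
apply: (@le_trans _ _ (\sum_(j < p) del ^+ 2)).
  apply: ler_sum => l _; rewrite lerXn2r ?nnegrE ?le_max ?lexx ?(ltW del0)//.
  have := t1P l t (leq_trans (leq_bigmax l) tP).
  by rewrite ge_max (ltW del0) /=; lra.
rewrite sumr_const card_ord -(mulr_natl (del ^+ 2)).
have -> : (eps / 2) ^+ 2 = p.+1%:R ^+ 2 * del ^+ 2.
  by rewrite -exprMn /del mulrCA mulfV ?mulr1// gt_eqF.
apply: ler_wpM2r; first exact: sqr_ge0.
rewrite -natrX ler_nat expnS expn1; apply: leq_trans (leqnSn p) _.
by rewrite leq_pmulr.
Qed.

Theorem theorem1 (R : realType) (n : nat) (V : finType)
    (M : pairwise_mrf R n V) (phi : nat -> 'rV[R]_n -> R) (r k : nat)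
    (mstar : dedge M -> 'rV[R]_n -> R)
    (dO : measure_display) (Omega : measurableType dO) (P : probability Omega R)
    (Y : nat -> dedge M -> 'I_k -> {RV P >-> borel_rV R n}) :
  let eta : nat -> R := fun t => t.+1%:R^-1 in
  let rhoDelta (t : nat) (w : Omega) : 'cV[R]_#|{: dedge M}| :=
    sqnorm_vec (sosmp_error phi r eta mstar (samples_at Y w) t) in
  let rhoA : 'cV[R]_#|{: dedge M}| :=
    sqnorm_vec (proj_residual phi r mstar) in
  is_tree (edge M) ->
  closed (state M) -> bounded_set (state M) ->
  (base M (state M) < +oo)%E ->
  continuous_potentials M ->
  orthonormal_basis M phi ->
  (0 < r)%N -> (0 < k)%N ->
  bp_fixed_point mstar ->
  (forall x (d : dedge M), state M x ->
     0 < inf_proj_Gam phi r d x /\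
     `|proj_residual phi r mstar d x| <= 2^-1 * inf_proj_Gam phi r d x) ->
  sosmp_draws Y phi r eta ->
  exists N : 'M[R]_#|{: dedge M}|,
    [/\ exists q : nat, N ^+ q = 0,
        {ae P, forall w,
           (fun t => rhoDelta t w -
              projection (box (N *m invmx (1%:M - N) *m rhoA)) (rhoDelta t w))
             @ \oo --> (0 : 'cV[R]_#|{: dedge M}|)} &
        forall t : nat, (0 < t)%N -> forall i,
          ('E_P[fun w => (rhoDelta t w i 0)%R] <=
           (((6 * \sum_(j < r) Bcoef M phi j ^+ 2) *:
               ((t%:R^-1 *: invmx (1%:M - ln t%:R *: N)) *m
                  (N *m const_mx 1 + 16 *: const_mx 1)) +
             N *m invmx (1%:M - N) *m rhoA) i 0)%:E)%E].
Proof.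
move=> eta rhoDelta rhoA tree Xc Xb muX potC onb r0 k0 bp incoh draws.
have [L [L0 aerec exprec]] := stochastic_recursion Xc Xb muX potC onb bp incoh k0 draws.
pose ev (i : 'I_#|{: dedge M}|) : dedge M := enum_val i.
pose N : 'M[R]_#|{: dedge M}| :=
  \matrix_(i, j) (if feeds (ev i) (ev j) then L (ev i) else 0).
have N0 i j : 0 <= N i j by rewrite mxE; case: ifP.
have NE (x : 'cV[R]_#|{: dedge M}|) (F : dedge M -> R) i :
    (forall j, x j 0 = F (ev j)) ->
    (N *m x) i 0 = L (ev i) * \sum_(f | feeds (ev i) f) F f.
  move=> xF; rewrite mxE [in RHS]big_mkcond/= mulr_sumr.
  rewrite [RHS](reindex ev); last exact: onW_bij (enum_val_bij _).
  by apply: eq_bigr => j _; rewrite mxE xF; case: ifP => _; rewrite ?mulr0 ?mul0r.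
(* A walk in the support of [N] is a feeding walk, which is shorter than the number of vertices. *)
have Nq : N ^+ #|V| = 0.
  apply: nilpotent_of_path_size => i s pth.
  rewrite -(size_map ev); apply: (feeding_walk_size (d := ev i) tree).
  rewrite path_map; apply: sub_path pth => a b; rewrite mxE.
  by case: ifP; rewrite ?eqxx.
have sqn0 f : 0 <= sqnormL2 M f by apply: Rintegral_ge0 => x _; rewrite -expr2 sqr_ge0.
have A0 i : 0 <= rhoA i 0 by rewrite mxE.
have rho0 t w i : 0 <= rhoDelta t w i 0 by rewrite mxE.
pose sigma := \sum_(j < r) Bcoef M phi j ^+ 2.
have sigma0 : 0 <= sigma by apply: sumr_ge0 => j _; rewrite sqr_ge0.
have rho_le t w i : (0 < t)%N -> rhoDelta t w i 0 <= 4 * sigma.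
  move=> t0; rewrite mxE.
  exact: (sqnorm_error_le Xc Xb muX potC onb bp k0 draws (ev i) w t0).
exists N; split.
- by exists #|V|.
- apply: (ae_impl aerec) => w [b b0 rec].
  apply: projection_box_cvg => //; first exact: (fixed_point_rec_ge0 Nq N0 A0).
  apply: (@limsup_rec R _ N #|V| rhoA Nq N0 A0 (4 * sigma) (fun t => rhoDelta t w)
    (fun t => \col_i b t (ev i))).
  + by rewrite mulr_ge0.
  + by move=> t t0 i; exact: rho_le.
  + move=> i eps eps0; have [t0 t0P] := b0 (ev i) eps eps0.
    by exists t0 => t tP; rewrite mxE t0P.
  + move=> t t0 i; rewrite [X in X <= _]mxE [X in X + _]mxE.
    apply: (le_trans (rec t t0 (ev i))); rewrite lerD2l ler_wpM2l ?invr_ge0//.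
    apply: ler_sum => s _; rewrite (NE _ (fun f =>
      sqnormL2 M (sosmp_error phi r eta mstar (samples_at Y w) s f) +
      sqnormL2 M (proj_residual phi r mstar f)))// => j.
    by rewrite !mxE.
pose e t : 'cV[R]_#|{: dedge M}| := \col_i \int[P]_w rhoDelta t w i 0.
have brho t i : bounded_mfun setT (fun w => rhoDelta t w i 0).
  rewrite (_ : (fun w => _) = fun w =>
    sqnormL2 M (sosmp_error phi r eta mstar (samples_at Y w) t (ev i))).
    exact: (sqnorm_error_bounded Xc Xb muX potC onb mstar draws t (ev i)).
  by apply/funext => w; rewrite mxE.
have eE t i : e t i 0 =
    \int[P]_w sqnormL2 M (sosmp_error phi r eta mstar (samples_at Y w) t (ev i)).
  by rewrite mxE; apply: eq_Rintegral => w _; rewrite mxE.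
move=> t t0 i; rewrite unlock.
rewrite -[X in (X <= _)%E]fineK; last first.
  exact: integrable_fin_num (prob_bounded_integrable P (brho t i)).
rewrite lee_fin -/(Rintegral P setT (fun w => rhoDelta t w i 0)).
have -> : Rintegral P setT (fun w => rhoDelta t w i 0) = e t i 0 by rewrite mxE.
apply: (expectation_rec Nq N0 A0 sigma0 _ _ t0).
- move=> j; rewrite mxE; apply: (@le_trans _ _ (\int[P]_w (4 * sigma))).
    apply: le_Rintegral => //.
    + exact: prob_bounded_integrable.
    + by apply: prob_bounded_integrable; exact: bounded_mfun_cst.
    + by move=> w _; exact: rho_le.
  by rewrite Rintegral_cst// [X in fine X]probability_setT mulr1.
- move=> u u0 j; rewrite eE; apply: (le_trans (exprec u u0 (ev j))).
  rewrite lerD2l ler_wpM2l ?invr_ge0//; apply: ler_sum => s _.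
  rewrite (NE _ (fun f => \int[P]_w sqnormL2 M (sosmp_error phi r eta mstar
    (samples_at Y w) s f) + sqnormL2 M (proj_residual phi r mstar f)))// => l.
  by rewrite [X in X = _]mxE eE [X in _ + X = _]mxE.
Qed.
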